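(* Consider the family of It\^o stochastic linear systems with additive Poisson jump noise, indexed by $\beta\in K$, $$\mathrm{d}X(t,\beta)=A(t,\beta)X(t,\beta)\,\mathrm{d}t+B(t,\beta)u(t)\,\mathrm{d}t+G(t,\beta)\,\mathrm{d}N(t),$$ with $A\in L_\infty^{n\times n}(D)$, $B\in L_2^{n\times m}(D)$, $G\in L_2^{n\times k}(D)$, $D=[0,T]\times K$, where $N$ is a vector of Poisson counters with vector of constant intensities $\lambda\in\mathbb{R}^k$, and suppose that this family is ensemble controllable on $\mathcal{H}_K$. Let $X_0,X_F\in\mathcal{H}_K$. Then the control $u\in\mathcal{H}_T$ which steers the system from the initial state $X(0,\beta)=X_0(\beta)$ to the terminal state $X(T,\beta)=X_F(\beta)$, while minimizing $$\mathcal{J}_2=\mathcal{E}\|X_T-X_F\|_K^2=\int_K\mathcal{E}\|X(T,\beta)-X_F(\beta)\|_2^2\,\mathrm{d}\mu(\beta),$$ the mean square error in the terminal state, must satisfy $$\int_0^{T}\Phi(0,\sigma,\beta)\bigl(B(\sigma,\beta)u(\sigma)+G(\sigma,\beta)\lambda\bigr)\,\mathrm{d}\sigma=\Phi(0,T,\beta)X_F(\beta)-X_0(\beta)$$ for all $\beta\in K$. The minimum value of $\mathcal{J}_2$ is $$\int_K\mathrm{tr}\,C(T,\beta)\,\mathrm{d}\mu(\beta),\qquad\text{where}\quad C(t,\beta)=\int_0^t\Phi(t,\sigma,\beta)G(\sigma,\beta)\Lambda G'(\sigma,\beta)\Phi'(t,\sigma,\beta)\,\mathrm{d}\sigma$$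 and $\Lambda=\mathrm{diag}(\lambda)$ is the diagonal matrix of intensities.
   Context: Setting: $T>0$; $K\subset\mathbb{R}$ is compact; $D=[0,T]\times K\subset\mathbb{R}^2$; the state $X$ takes values in $M\subset\mathbb{R}^n$, and the control $u:[0,T]\to U\subset\mathbb{R}^m$ is open-loop, i.e. a function of $t$ only, the same for all $\beta$ and all realizations of the noise. $A\in L_\infty^{n\times n}(D)$, $B\in L_2^{n\times m}(D)$, $G\in L_2^{n\times k}(D)$ mean that $A(t,\beta)\in\mathbb{R}^{n\times n}$, $B(t,\beta)\in\mathbb{R}^{n\times m}$, $G(t,\beta)\in\mathbb{R}^{n\times k}$ have entries that are real $L_\infty(D)$, $L_2(D)$, $L_2(D)$ functions, respectively. $N:[0,T]\times\Xi\to\mathbb{R}^k$ is a vector-valued process whose components are independent Poisson counters on a probability space $(\Xi,\mathcal{G},\mathbb{N})$ with its natural filtration, with vector $\lambda\in\mathbb{R}^k$ of constant intensities, so that $\mathcal{E}N(t)=\lambda t$ and $\mathrm{Cov}(N(t),N(s))=\Lambda\min(t,s)$, where $\Lambda=\mathrm{diag}(\lambda)$ is the diagonal matrix with the entries of $\lambda$ on its diagonal. $\mathcal{E}$ denotes expectation with respect to $\mathbb{N}$, $'$ denotes transpose, and $\mathrm{tr}$ denotes trace. The argument $\xi\in\Xi$ of $X$ and $N$ is suppressed. Function spaces: $\mathcal{H}_T=L_2^m[0,T]$ is the Hilbert space of square-integrable $\mathbb{R}^m$-valued functions on $[0,T]$ with inner product $\langle g,h\rangle_T=\int_0^T g'(t)h(t)\,\mathrm{d}t$.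 $\mathcal{H}_K=L_2^n(K)$ is the Hilbert space of square-integrable $\mathbb{R}^n$-valued functions on $K$ with inner product $\langle p,q\rangle_K=\int_K p'(\beta)q(\beta)\,\mathrm{d}\mu(\beta)$, $\mu$ being Lebesgue measure, and induced norm $\|\cdot\|_K$; $\|\cdot\|_2$ is the Euclidean norm. $X_T(\beta)=X(T,\beta)$ is the terminal state. The initial and target states $X_0,X_F$ are (non-random) elements of $\mathcal{H}_K$. Steering the stochastic ensemble between states in $\mathcal{H}_K$ by an open-loop control refers to steering its instantaneous expected state $\mathcal{E}X$. $\Phi(t,s,\beta)$ denotes the transition matrix (from time $s$ to time $t$) of the homogeneous system $\dot X(t,\beta)=A(t,\beta)X(t,\beta)$. Ensemble controllable: the family is ensemble controllable on $\mathcal{H}_K$ if for all $\epsilon>0$ and all $X_0,X_F\in\mathcal{H}_K$ there exist $T>0$ and an open-loop piecewise-continuous control $u\in\mathcal{H}_T$ such that, starting from $X(0,\beta)=X_0(\beta)$, the final state $X(T,\beta)=X_T(\beta)$ satisfies $\|\mathcal{E}X_T-X_F\|_K<\epsilon$.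
   Formalization: Since ensemble controllability is only approximate, a minimizing control need not exist: the infimum of J_2 is shown to equal the stated value, every minimizer (if any) attains it, and the terminal identity holds for almost every β in K, as the data are only L_2/L_∞ classes. *)

(* Defs.v *)
From HB Require Import structures.
From mathcomp Require Import all_boot all_order all_algebra.
From mathcomp Require Import all_classical all_reals all_analysis.
From mathcomp Require Import measurable_realfun.

Set Implicit Arguments.
Unset Strict Implicit.
Unset Printing Implicit Defensive.

Import Order.TTheory GRing.Theory Num.Theory.
Import numFieldNormedType.Exports.

Local Open Scope classical_set_scope.
Local Open Scope ring_scope.

Section matrix_valued_functions.
Context {R : realType} {d : measure_display} {S : measurableType d}.
Variable mu : {measure set S -> \bar R}.

(* Elements of L_p are represented by everywhere defined functions with Borel
   entries; only their restriction to D matters, and equalities between them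
   are meant almost everywhere. *)
Definition mxLp (p : \bar R) (D : set S) (a b : nat) (F : S -> 'M[R]_(a, b))
    : Prop :=
  forall i j, ((fun x => F x i j) \_ D) \in Lfun mu p.

Definition mxintegrable (D : set S) (a b : nat) (F : S -> 'M[R]_(a, b))
    : Prop :=
  forall i j, mu.-integrable D (fun x => (F x i j)%:E).

Definition mxintegral (D : set S) (a b : nat) (F : S -> 'M[R]_(a, b))
    : 'M[R]_(a, b) :=
  \matrix_(i, j) (\int[mu]_(x in D) (F x i j))%R.

End matrix_valued_functions.

Section function_spaces.
Context {R : realType}.
Local Notation mu := (@lebesgue_measure R).

Definition in_HT (m : nat) (T : R) (u : R -> 'cV[R]_m) : Prop :=
  mxLp mu 2%:E `[0, T]%classic u.

Definition in_HK (n : nat) (K : set R) (p : R -> 'cV[R]_n) : Prop :=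
  mxLp mu 2%:E K p.

Definition sqnorm2 (n : nat) (v : 'cV[R]_n) : R := (v^T *m v) ord0 ord0.

Definition normK (n : nat) (K : set R) (p : R -> 'cV[R]_n) : \bar R :=
  sqrte (\int[mu]_(beta in K) (sqnorm2 (p beta))%:E)%E.

Definition in_LpD (p : \bar R) (T : R) (K : set R) (a b : nat)
    (F : R -> R -> 'M[R]_(a, b)) : Prop :=
  mxLp (mu \x mu)%E p (`[0, T]%classic `*` K)
    (fun z : measurableTypeR R * measurableTypeR R => F z.1 z.2).

(* The points of s are the possible discontinuities inside ]0, T[. *)
Definition piecewise_continuous (m : nat) (T : R) (u : R -> 'cV[R]_m) : Prop :=
  exists s : seq R, forall i : 'I_m,
    let f : R -> R := fun t => u t i ord0 in
    [/\ forall t, 0 < t < T -> t \notin s -> {for t, continuous f},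
        forall t, 0 <= t < T -> cvg (f x @[x --> t^'+]) &
        forall t, 0 < t <= T -> cvg (f x @[x --> t^'-]) ].

End function_spaces.

Section poisson_counters.
Context {R : realType} {d : measure_display} {Xi : measurableType d}.
Context {k : nat}.
Implicit Types (P : probability Xi R) (N : 'I_k -> Xi -> cumulative R R).

(* sigma-algebra generated by N j r, for j in J and 0 <= r <= t *)
Definition path_sigma N (J : set 'I_k) (t : R) : set (set Xi) :=
  <<s [set E | exists j r (B : set R),
         [/\ J j, 0 <= r <= t, measurable B
           & E = [set xi | B (N j xi r)]] ]>>.

Definition natural_filtration N (t : R) : set (set Xi) :=
  path_sigma N [set: 'I_k] t.

(* The paths are nondecreasing and right-continuous because N j xi is of type
   cumulative R R; N j xi t is only constrained, and only used, for
   0 <= t <= T.  The second argument of poisson_prob is a dummy. *)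
Definition poisson_counter P N (T : R) (j : 'I_k) (rate : R) : Prop :=
  0 <= rate /\
  [/\ forall t, 0 <= t <= T -> measurable_fun [set: Xi] (fun xi => N j xi t),
      forall xi, N j xi 0 = 0,
      forall t xi, 0 <= t <= T -> exists q : nat, N j xi t = q%:R,
      forall (s t : R) (q : nat), 0 <= s -> s <= t -> t <= T ->
        P [set xi | N j xi t - N j xi s = q%:R] =
        poisson_prob (rate * (t - s)) 0%N [set q] &
      forall (s t : R) (E : set Xi) (B : set R), 0 <= s -> s <= t -> t <= T ->
        path_sigma N [set j] s E -> measurable B ->
        P (E `&` [set xi | B (N j xi t - N j xi s)]) =
        (P E * P [set xi | B (N j xi t - N j xi s)%R])%E ].

(* Each component sigma-algebra contains the whole space, so the product rule
   over all components includes the one over every subfamily. *)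
Definition independent_components P N (T : R) : Prop :=
  forall E : 'I_k -> set Xi,
    (forall j, path_sigma N [set j] T (E j)) ->
    P (\bigcap_(j in [set: 'I_k]) E j) = (\prod_(j < k) P (E j))%E.

Definition independent_poisson_counters P N (T : R) (lambda : 'cV[R]_k)
    : Prop :=
  (forall j, poisson_counter P N T j (lambda j ord0)) /\
  independent_components P N T.

End poisson_counters.

Section transition_matrix.
Context {R : realType} {n : nat}.
Local Notation mu := (@lebesgue_measure R).

(* integral from s to t, with the usual sign convention when t < s *)
Definition oriented_integral (a b : nat) (s t : R) (F : R -> 'M[R]_(a, b))
    : 'M[R]_(a, b) :=
  mxintegral mu `[s, t]%classic F - mxintegral mu `[t, s]%classic F.

(* Since A(., beta) is bounded only for almost every beta, so does the initial
   value problem (in integrated form) determine Phi(., ., beta) only for almost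
   every beta; the measurability clause selects a Borel representative. *)
Definition transition_matrix (T : R) (K : set R) (A : R -> R -> 'M[R]_n)
    (Phi : R -> R -> R -> 'M[R]_n) : Prop :=
  (forall i j, measurable_fun
     ((`[0, T]%classic `*` `[0, T]%classic) `*` K)
     (fun z : (measurableTypeR R * measurableTypeR R) * measurableTypeR R =>
        Phi z.1.1 z.1.2 z.2 i j)) /\
  {ae mu, forall beta, K beta -> forall s, 0 <= s <= T ->
     mxintegrable mu `[0, T]%classic (fun r => Phi r s beta) /\
     forall t, 0 <= t <= T ->
       Phi t s beta =
       1%:M + oriented_integral s t (fun r => A r beta *m Phi r s beta)}.

End transition_matrix.

Section stochastic_ensemble.
Context {R : realType} {d : measure_display} {Xi : measurableType d}.
Variable P : probability Xi R.
Variables n m k : nat.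
Local Notation mu := (@lebesgue_measure R).

Variable K : set R.
Variable A : R -> R -> 'M[R]_n.
Variable B : R -> R -> 'M[R]_(n, m).
Variable G : R -> R -> 'M[R]_(n, k).
Variable N : 'I_k -> Xi -> cumulative R R.

Implicit Types (u : R -> 'cV[R]_m) (X : R -> R -> Xi -> 'cV[R]_n).

(* The integrators have paths of finite variation and G is deterministic, so
   the stochastic integral is the pathwise Lebesgue-Stieltjes integral. *)
Definition jump_integral (t beta : R) (xi : Xi) : 'cV[R]_n :=
  \col_i \sum_(j < k)
    (\int[lebesgue_stieltjes_measure (N j xi)]_(s in `]0%R, t]%classic)
      (G s beta i j))%R.

(* X solves dX = A X dt + B u dt + G dN on [0, tau] with X(0, .) = X0. *)
Definition is_solution (tau : R) (X0 : R -> 'cV[R]_n) u X : Prop :=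
  [/\ forall t i, 0 <= t <= tau ->
        measurable_fun (K `*` [set: Xi])
          (fun z : measurableTypeR R * Xi => X t z.1 z.2 i ord0),
      {ae mu, forall beta, K beta -> forall t i (E : set R), 0 <= t <= tau ->
        measurable E ->
        natural_filtration N t [set xi | E (X t beta xi i ord0)]} &
      {ae mu, forall beta, K beta -> {ae P, forall xi,
        mxintegrable mu `[0, tau]%classic (fun s => X s beta xi) /\
        forall t, 0 <= t <= tau ->
          X t beta xi = X0 beta
            + mxintegral mu `[0, t]%classic
                (fun s => A s beta *m X s beta xi + B s beta *m u s)
            + jump_integral t beta xi}} ].

Definition mean_state X (t beta : R) : 'cV[R]_n :=
  \col_i fine 'E_P[fun xi => X t beta xi i ord0].

(* The coefficients and the noise are given on [0, T] only, hence the bound on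
   the steering time tau. *)
Definition ensemble_controllable (T : R) : Prop :=
  forall eps : R, 0 < eps ->
  forall X0 XF : R -> 'cV[R]_n, in_HK K X0 -> in_HK K XF ->
  exists (tau : R) u X,
    [/\ 0 < tau <= T, piecewise_continuous tau u, in_HT tau u,
        is_solution tau X0 u X &
        (normK K (fun beta => mean_state X tau beta - XF beta)%R < eps%:E)%E ].

Definition J2 (T : R) (XF : R -> 'cV[R]_n) X : \bar R :=
  (\int[P]_xi (normK K (fun beta => X T beta xi - XF beta)%R ^+ 2))%E.

Lemma sqnorm2E (v : 'cV[R]_n) : sqnorm2 v = \sum_i v i ord0 ^+ 2.
Proof.
rewrite /sqnorm2 mxE; apply: eq_bigr => i _.
by rewrite mxE expr2.
Qed.

Lemma J2_tonelli (T : R) (X0 XF : R -> 'cV[R]_n) u X :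
  compact K -> 0 <= T -> in_HK K XF -> is_solution T X0 u X ->
  J2 T XF X =
  (\int[mu]_(beta in K) \int[P]_xi
     (sqnorm2 (X T beta xi - XF beta)%R)%:E)%E.
Proof.
move=> cK T0 hXF [mX _ _].
have mK : measurable (K : set (measurableTypeR R)) := compact_measurable cK.
pose D : set (measurableTypeR R * Xi) := K `*` [set: Xi].
have mD : measurable D by exact: measurableX.
pose f (z : measurableTypeR R * Xi) : \bar R :=
  (sqnorm2 (X T z.1 z.2 - XF z.1))%:E.
have mf : measurable_fun setT (f \_ D).
  apply/(measurable_restrictT _ mD)/measurable_EFinP => /=.
  apply: (eq_measurable_fun (fun z : measurableTypeR R * Xi =>
    \sum_i (X T z.1 z.2 i ord0 - XF z.1 i ord0) ^+ 2)).
    by move=> z _; rewrite sqnorm2E; apply: eq_bigr => i _; rewrite !mxE.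
  apply: measurable_sum => i; apply: measurable_funX.
  apply: measurable_funB; first by apply: mX; rewrite T0 lexx.
  have /andP[/mem_set + _] := hXF i ord0.
  rewrite !inE => /(measurable_restrictT _ mK) mXF.
  apply: (measurable_comp mK _ mXF); first by move=> _ [z [Kz _] <-].
  exact: measurable_funTS.
have f0 z : (0 <= (f \_ D) z)%E.
  apply: erestrict_ge0 => x _; rewrite lee_fin sqnorm2E.
  by apply: sumr_ge0 => i _; exact: sqr_ge0.
transitivity (\int[P]_xi \int[mu]_beta (f \_ D) (beta, xi))%E.
  apply: eq_integral => xi _; rewrite /normK sqr_sqrte; last first.
    apply: integral_ge0 => beta _; rewrite lee_fin sqnorm2E.
    by apply: sumr_ge0 => i _; exact: sqr_ge0.
  rewrite integral_mkcond; apply: eq_integral => beta _.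
  rewrite /patch /D; congr (if _ then _ else _).
  by apply/idP/idP; rewrite !inE => //= -[].
rewrite -fubini_tonelli//= [RHS]integral_mkcond.
apply: eq_integral => beta _; rewrite [RHS]/patch; case: ifPn => Kb.
  apply: eq_integral => xi _; rewrite /patch ifT//.
  by rewrite inE; split=> //; rewrite inE in Kb.
apply: integral0_eq => xi _; rewrite /patch ifF//.
by apply/negbTE; apply: contra Kb; rewrite !inE => -[].
Qed.

Definition minimizes_J2 (T : R) (X0 XF : R -> 'cV[R]_n) u X : Prop :=
  [/\ in_HT T u, is_solution T X0 u X &
      forall v Y, in_HT T v -> is_solution T X0 v Y ->
        (J2 T XF X <= J2 T XF Y)%E ].

Definition state_covariance (Phi : R -> R -> R -> 'M[R]_n)
    (lambda : 'cV[R]_k) (t beta : R) : 'M[R]_n :=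
  mxintegral mu `[0, t]%classic (fun sigma =>
    Phi t sigma beta *m G sigma beta *m diag_mx lambda^T
      *m (G sigma beta)^T *m (Phi t sigma beta)^T).

End stochastic_ensemble.

(* Main.v *)
(* Variation of constants gives X(t) = Phi(t, 0) X0 + int_0^t Phi(t, s) B u ds
   + int_0^t Phi(t, s) G dN. By Campbell's formula and the isometry for Poisson
   counters, the mean square error is the sum of
   Q(u) = int_K |E X(T) - XF|^2 and of int_K tr C(T), which does not depend on u.
   Multiplying by Phi(0, T), which is invertible, Q(u) = 0 is the stated integral
   equation, so everything reduces to inf Q = 0. Ensemble controllability yields
   it by homogeneity: steering - c p to 0 within error 1, where
   p = Phi(0, T) XF - X0 - int_0^T Phi(0, s) G lambda ds, and dividing the control
   by c gives Q = O(c^-2), since the contribution of the noise to the mean does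
   not scale with c. *)
Require Import Defs.
From HB Require Import structures.
From mathcomp Require Import all_boot all_order all_algebra.
From mathcomp Require Import all_classical all_reals all_analysis.
From mathcomp Require Import measurable_realfun ess_sup_inf.
From mathcomp Require Import finmap ring lra.
Set Implicit Arguments.
Unset Strict Implicit.
Unset Printing Implicit Defensive.
Import Order.TTheory GRing.Theory Num.Theory.
Import numFieldNormedType.Exports.
Local Open Scope classical_set_scope.
Local Open Scope ring_scope.

(** * Measures defined by monotone functionals *)

(** The stochastic integral is a pathwise Stieltjes integral, so its moments are obtained by
    comparing measures on the time axis. For a nonnegative random weight w, the functional g |-> E
    (w int g dN_j) is integration against a measure, identified by its values on the intervals (0,
    t]. The weights 1, N_j(s) and int f dN_i yield in turn the mean, the mixed moment and the
    isometry, each one supplying the interval values of the next. The pathwise view also turns the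
    state equation, for fixed beta and almost every path, into a deterministic linear equation
    driven by measures. The data are controlled only almost everywhere, and Phi solves its equation
    only for almost every beta. Borel versions with bounds valid everywhere are therefore built
    once, on a subset of K of full measure. Controllability leaves the steering time tau <= T
    unspecified and gives no bound on the control. Pulling states back to time 0 removes the
    dependence on tau: a control set to 0 after tau contributes the same vector at tau and at T. *)

Section monotone_functionals.
Context d (T : measurableType d) (R : realType).
Local Open Scope ereal_scope.

(** The properties that characterize integration of nonnegative functions against a measure.
    Isolating them allows a weighted expectation of Stieltjes integrals and an integral with a
    density to be compared as measures. *)
Definition monotone_functional (I : (T -> \bar R) -> \bar R) : Prop :=
  [/\ forall f g, measurable_fun setT f -> measurable_fun setT g ->
        (forall x, 0 <= f x) -> (forall x, 0 <= g x) ->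
        I (f \+ g) = I f + I g,
      forall r f, (0 <= r)%R -> measurable_fun setT f -> (forall x, 0 <= f x) ->
        I (fun x => r%:E * f x) = r%:E * I f,
      forall f, (forall x, 0 <= f x) -> 0 <= I f &
      forall f : nat -> T -> \bar R, (forall n, measurable_fun setT (f n)) ->
        (forall n x, 0 <= f n x) -> (forall x, nondecreasing_seq (f^~ x)) ->
        I (fun x => limn (f^~ x)) = limn (fun n => I (f n)) ].

Variable I : (T -> \bar R) -> \bar R.
Hypothesis hI : monotone_functional I.

(* The proof argument lets the measure structure be inferred. *)
Definition functional_measure of monotone_functional I : set T -> \bar R :=
  fun E => I (EFin \o \1_E).

Let Iadd := let: And4 h _ _ _ := hI in h.
Let Iscale := let: And4 _ h _ _ := hI in h.
Let Ige0 := let: And4 _ _ h _ := hI in h.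
Let Ilim := let: And4 _ _ _ h := hI in h.

Let I0 : I (cst 0) = 0.
Proof.
have -> : cst 0 = (fun x : T => 0%:E * cst 0 x :> \bar R).
  by apply/funext => x; rewrite mul0e.
by rewrite Iscale// mul0e.
Qed.

Let Isum (J : Type) (s : seq J) (f : J -> T -> \bar R) :
  (forall j, measurable_fun setT (f j)) -> (forall j x, 0 <= f j x) ->
  I (fun x => \sum_(j <- s) f j x) = \sum_(j <- s) I (f j).
Proof.
move=> mf f0; elim: s => [|j s ih].
  by rewrite big_nil -[RHS]I0; congr I; apply/funext => x; rewrite big_nil.
rewrite big_cons -ih -Iadd//.
- by congr I; apply/funext => x; rewrite big_cons.
- exact: emeasurable_sum.
- by move=> x; exact: sume_ge0.
Qed.

Let meas0 : functional_measure hI set0 = 0.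
Proof.
rewrite /functional_measure -[RHS]I0; congr I.
by apply/funext => x; rewrite /= indicE in_set0.
Qed.

Let meas_ge0 E : 0 <= functional_measure hI E.
Proof. by apply: Ige0 => x; rewrite lee_fin. Qed.

Let meas_sigma_additive : semi_sigma_additive (functional_measure hI).
Proof.
move=> F mF tF mUF; apply: cvg_toP.
  by apply: is_cvg_nneseries => n _ _; exact: meas_ge0.
rewrite /functional_measure.
transitivity (limn (fun n => I (fun x => \sum_(0 <= i < n) (\1_(F i) x)%:E))).
  congr (limn _); apply/funext => n; rewrite Isum//.
  by move=> j; apply/measurable_EFinP.
rewrite -Ilim.
- congr I; apply/funext => x /=.
  by rewrite indic_bigcup.
- by move=> n; apply: emeasurable_sum => j; apply/measurable_EFinP.
- by move=> n x; apply: sume_ge0.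
- by move=> x; apply: ereal_nondecreasing_series.
Qed.

HB.instance Definition _ := isMeasure.Build d T R (functional_measure hI)
  meas0 meas_ge0 meas_sigma_additive.

Import HBNNSimple.

(** Both sides agree on indicators by definition, hence on nonnegative simple functions, and both
    commute with the increasing limit of the simple approximations of [f]. *)
Lemma functional_measureE f : measurable_fun setT f -> (forall x, 0 <= f x) ->
  I f = \int[functional_measure hI]_x f x.
Proof.
move=> mf f0.
pose f_ := nnsfun_approx measurableT mf.
have fE : f = fun x => limn (fun n => (f_ n x)%:E).
  apply/funext => x; apply/esym/cvg_lim => //.
  by apply: cvg_nnsfun_approx => //.
rewrite [in LHS]fE [in RHS]fE Ilim; last 3 first.
- by move=> n; exact/measurable_EFinP.
- by move=> n x; rewrite lee_fin.
- by move=> x m n mn; rewrite lee_fin; exact/lefP/nd_nnsfun_approx.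
rewrite monotone_convergence//; last 3 first.
- by move=> n; exact/measurable_EFinP.
- by move=> n x; rewrite lee_fin.
- by move=> x _ m n mn; rewrite lee_fin; exact/lefP/nd_nnsfun_approx.
congr (limn _); apply/funext => n.
have gE : (fun x => (f_ n x)%:E) = fun x =>
    \sum_(r <- fset_set (range (f_ n))) r%:E * (\1_(f_ n @^-1` [set r]) x)%:E.
  apply/funext => x; rewrite fimfunE fsbig_finite//= -sumEFin.
  by apply: eq_bigr => r _; rewrite EFinM.
have mg r : measurable_fun setT (fun x => (\1_(f_ n @^-1` [set r]) x)%:E : \bar R).
  by apply/measurable_EFinP.
rewrite gE.
have rew r : r \in fset_set (range (f_ n)) -> (0 <= r)%R.
  by rewrite in_fset_set// => /set_mem[x _ <-].
(* The induction runs over sublists of the range, so that every coefficient met is nonnegative: [I]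
   is additive on nonnegative functions only. *)
have : forall s, {subset s <= fset_set (range (f_ n))} ->
    I (fun x => \sum_(r <- s) r%:E * (\1_(f_ n @^-1` [set r]) x)%:E) =
    \int[functional_measure hI]_x
      \sum_(r <- s) r%:E * (\1_(f_ n @^-1` [set r]) x)%:E.
  elim=> [|r s ih] sub.
    under [in LHS]eq_fun do rewrite big_nil.
    under [in RHS]eq_integral do rewrite big_nil.
    by rewrite integral0 -[RHS]I0.
  have r0 : (0 <= r)%R by apply/rew/sub; rewrite mem_head.
  have {}ih : _ := ih (fun q qs => sub q (@mem_behead _ (r :: s) q qs)).
  have s0 x : 0 <= \sum_(q <- s) q%:E * (\1_(f_ n @^-1` [set q]) x)%:E.
    rewrite big_seq; apply: sume_ge0 => q qs.
    by rewrite mule_ge0// lee_fin// rew// sub// inE qs orbT.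
  have ms : measurable_fun setT
      (fun x => \sum_(q <- s) q%:E * (\1_(f_ n @^-1` [set q]) x)%:E).
    by apply: emeasurable_sum => q; exact: measurable_funeM.
  under [in LHS]eq_fun do rewrite big_cons.
  under [in RHS]eq_integral do rewrite big_cons.
  rewrite [LHS]Iadd//; last 2 first.
    exact: measurable_funeM.
    by move=> x; rewrite mule_ge0// lee_fin.
  rewrite [RHS]ge0_integralD//; last 2 first.
    by move=> x _; rewrite mule_ge0// lee_fin.
    exact: measurable_funeM.
  congr (_ + _).
    by rewrite Iscale// ge0_integralZl_EFin// integral_indic// setIT.
  exact: ih.
by move=> /(_ _ (fun _ => id)).
Qed.

End monotone_functionals.

(** * Measurability of Stieltjes integrals in the integrator *)

Section stieltjes_kernel.
Context {R : realType}.
Local Open Scope ereal_scope.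

Lemma lebesgue_stieltjes_itv_oc (F : cumulative R R) (a b : R) : (a <= b)%R ->
  lebesgue_stieltjes_measure F `]a, b]%classic = (F b - F a)%:E.
Proof.
move=> ab; rewrite /lebesgue_stieltjes_measure /measure_extension/=.
by rewrite measurable_mu_extE/= ?wlength_itv_bnd//; exact: is_ocitv.
Qed.

Lemma lebesgue_measure_itv_oc (a b : R) : (a <= b)%R ->
  lebesgue_measure (`]a, b]%classic : set R) = (b - a)%:E.
Proof.
move=> ab; rewrite lebesgue_measure_itv/= lte_fin; case: ltP => //.
by move=> ba; congr EFin; apply/esym/eqP; rewrite subr_eq0 eq_le ba ab.
Qed.

(** Counter paths are constrained only up to the horizon, so measurability in the path can only be
    expected of the restriction to []0, t]]. That restriction is also finite, of mass
    [F t - F 0]. *)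
Definition stieltjes_trace (F : cumulative R R) (t : R)
    : set (measurableTypeR R) -> \bar R :=
  mrestr (lebesgue_stieltjes_measure F) (measurable_itv `]0%R, t]).

HB.instance Definition _ F t := Measure.on (stieltjes_trace F t).

Lemma stieltjes_traceE F t (f : R -> \bar R) :
  \int[stieltjes_trace F t]_(s in `]0%R, t]) f s =
  \int[lebesgue_stieltjes_measure F]_(s in `]0%R, t]) f s.
Proof.
apply: eq_measure_integral => A mA A0t.
by rewrite /= /stieltjes_trace /mrestr setIidl.
Qed.

(** [a'] is [a] clipped to [[0, t]], and [b'] is [b] clipped from above by [t] and from below by
    [a']. Since [a' <= b'] always holds, the Stieltjes measure of the intersection is [F b' - F a']
    even when the intersection is empty. *)
Lemma setI_itv_oc (t a b : R) : (0 <= t)%R ->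
  let a' := Num.min (Num.max a 0%R) t in let b' := Num.max a' (Num.min b t) in
  `]a, b]%classic `&` `]0%R, t]%classic = `]a', b']%classic :> set R.
Proof.
move=> t0 a' b'; apply/seteqP; split=> x /=; rewrite !in_itv/=.
  move=> [/andP[ax xb] /andP[x0 xt]].
  rewrite {1}/a' gt_min gt_max ax x0/= /b' le_max; apply/orP; right.
  by rewrite le_min xb.
move=> /andP[a'x]; rewrite le_max leNgt a'x/= le_min => /andP[xb xt].
move: a'x; rewrite gt_min gt_max (ltNge t) xt orbF => /andP[ax x0].
by rewrite ax x0 xb.
Qed.

Lemma stieltjes_trace_itv F t (a b : R) : (0 <= t)%R ->
  let a' := Num.min (Num.max a 0%R) t in let b' := Num.max a' (Num.min b t) in
  stieltjes_trace F t `]a, b]%classic = (F b' - F a')%:E.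
Proof.
move=> t0 a' b'; rewrite /stieltjes_trace /mrestr setI_itv_oc//.
by rewrite lebesgue_stieltjes_itv_oc// le_max lexx.
Qed.

Lemma stieltjes_trace_setT F t : (0 <= t)%R ->
  stieltjes_trace F t setT = (F t - F 0%R)%:E.
Proof.
by move=> t0; rewrite /stieltjes_trace /mrestr setTI lebesgue_stieltjes_itv_oc.
Qed.

Section measurability.
Context d (X : measurableType d) (F : X -> cumulative R R) (t : R).
Hypothesis t0 : (0 <= t)%R.
Hypothesis mF : forall s, (0 <= s <= t)%R -> measurable_fun setT (F ^~ s).

(** Dynkin's theorem on half-open intervals, whose measure is a difference of values of [F x] at
    points of [[0, t]]. Complements are handled by subtraction, which the finite total mass
    permits. *)
Lemma measurable_stieltjes_trace U : measurable U ->
  measurable_fun setT (fun x => stieltjes_trace (F x) t U).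
Proof.
move: U; refine (@dynkin_induction _ (measurableTypeR R) (@ocitv R)
  (fun U => measurable_fun setT (fun x => stieltjes_trace (F x) t U))
  _ _ _ _ _ _) => //.
- move=> A B; exact: (@measurableI _ (ocitv_type R)).
- under eq_fun do rewrite stieltjes_trace_setT//.
  apply/measurable_EFinP/measurable_funB; apply: mF; first by rewrite t0 lexx.
  by rewrite lexx t0.
- move=> _ [[a b] _ <-]; under eq_fun do rewrite stieltjes_trace_itv//=.
  apply/measurable_EFinP/measurable_funB; apply: mF.
    have : (0 <= Num.min (Num.max a 0) t <= t)%R.
      by rewrite le_min t0 le_max lexx orbT ge_min lexx orbT.
    by rewrite le_max ge_max => /andP[-> ->]; rewrite ge_min lexx orbT.
  by rewrite le_min t0 le_max lexx orbT ge_min lexx orbT.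
- move=> S mS ih.
  rewrite (_ : (fun x => _) = fun x => stieltjes_trace (F x) t setT -
      stieltjes_trace (F x) t S).
    apply: emeasurable_funB => //.
    under eq_fun do rewrite stieltjes_trace_setT//.
    apply/measurable_EFinP/measurable_funB; apply: mF; first by rewrite t0 lexx.
    by rewrite lexx t0.
  apply/funext => x; rewrite -(setvU S) measureU//; last 2 first.
  - exact: measurableC.
  - by rewrite setICl.
  rewrite addeK// ge0_fin_numE//.
  apply: (@le_lt_trans _ _ (stieltjes_trace (F x) t setT)).
    by apply: le_measure => //; exact: mem_set.
  by rewrite stieltjes_trace_setT// ltry.
- move=> E mE tE ih.
  rewrite (_ : (fun x => _) =
    fun x => \sum_(0 <= n <oo) stieltjes_trace (F x) t (E n)).
    by apply: ge0_emeasurable_sum => //.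
  apply/funext => x; apply/esym/cvg_lim => //.
  by apply: measure_semi_sigma_additive => //; exact: bigcup_measurable.
Qed.

(** The two proof arguments are there so that the kernel structure declared next can be inferred
    from the term. *)
Definition stieltjes_ker of (0 <= t)%R &
    (forall s, (0 <= s <= t)%R -> measurable_fun setT (F ^~ s)) :
    X -> {measure set (measurableTypeR R) -> \bar R} :=
  fun x => stieltjes_trace (F x) t.

HB.instance Definition _ := isKernel.Build _ _ _ _ _ (stieltjes_ker t0 mF)
  measurable_stieltjes_trace.

Import HBNNSimple.

(** Extending the integrand by 0 outside []0, t]] makes this the integral of a jointly measurable
    function against a kernel, which depends measurably on [x]. *)
Lemma measurable_stieltjes_integral (f : X * measurableTypeR R -> \bar R) :
  measurable_fun setT f -> (forall z, 0 <= f z) ->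
  measurable_fun setT (fun x =>
    \int[lebesgue_stieltjes_measure (F x)]_(s in `]0%R, t]) f (x, s)).
Proof.
move=> mf f0.
pose g (z : X * measurableTypeR R) :=
  if z.2 \in (`]0%R, t]%classic : set (measurableTypeR R)) then f z else 0.
have mD : measurable (setT `*` (`]0%R, t]%classic : set (measurableTypeR R)) :
    set (X * measurableTypeR R)).
  by apply: measurableX => //; exact: measurable_itv.
have mg : measurable_fun setT g.
  rewrite (_ : g = f \_ (setT `*` `]0%R, t]%classic)).
    exact/(measurable_restrictT _ mD)/measurable_funTS.
  apply/funext => z; rewrite /g patchE; congr (if _ then _ else _).
  by apply/idP/idP => /set_mem h; apply/mem_set => //; case: h.
have g0 z : 0 <= g z by rewrite /g; case: ifP.
under eq_fun do rewrite -stieltjes_traceE integral_mkcond.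
rewrite (_ : (fun x => _) = fun x => \int[stieltjes_ker t0 mF x]_s g (x, s));
  last first.
  by apply/funext => x; apply: eq_integral => s _; rewrite patchE.
pose g_ := nnsfun_approx measurableT mg.
apply: (measurable_fun_xsection_integral g (stieltjes_ker t0 mF) g_).
- by move=> a b ab; exact/nd_nnsfun_approx.
- by move=> z; exact/cvg_nnsfun_approx.
move=> n r.
rewrite (_ : (fun x => _) = fun x => mrestr (stieltjes_ker t0 mF x) measurableT
    (xsection (g_ n @^-1` [set r]) x)); last first.
  by apply/funext => x; rewrite /mrestr setIT.
have : measurable (g_ n @^-1` [set r]) by [].
move=> /(@measurable_prod_subset_xsection_kernel _ _ _ _ _ (stieltjes_ker t0 mF)
  setT measurableT) => /(_ _)[]//.
(* The added 1 makes the bound on the mass strict. *)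
move=> x; exists (F x t - F x 0 + 1)%R => U mU.
rewrite /= /mrestr setIT (@le_lt_trans _ _ (stieltjes_trace (F x) t setT))//.
  by apply: le_measure => //; exact: mem_set.
by rewrite stieltjes_trace_setT// lte_fin ltrDl.
Qed.

(** Integrability is not at issue: the real integral is [fine] of a difference of two measurable
    extended functions, whatever values these take. *)
Lemma measurable_stieltjes_Rintegral (f : X * measurableTypeR R -> R) :
  measurable_fun setT f ->
  measurable_fun setT (fun x =>
    (\int[lebesgue_stieltjes_measure (F x)]_(s in `]0%R, t]) f (x, s))%R).
Proof.
move=> mf; apply: measurableT_comp => //.
rewrite (_ : (fun x => _) = (fun x =>
    \int[lebesgue_stieltjes_measure (F x)]_(s in `]0%R, t]) ((EFin \o f)^\+ (x, s)))
  \- (fun x =>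
    \int[lebesgue_stieltjes_measure (F x)]_(s in `]0%R, t]) ((EFin \o f)^\- (x, s))));
  last first.
  apply/funext => x; rewrite [LHS]integralE.
  by congr (_ - _); apply: eq_integral => s _; rewrite ?funeposE ?funenegE.
have mEf : measurable_fun setT (EFin \o f) by exact/measurable_EFinP.
apply: emeasurable_funB; apply: measurable_stieltjes_integral => //.
- exact: measurable_funepos.
- exact: measurable_funeneg.
Qed.

End measurability.
End stieltjes_kernel.

(** * Moments and independence *)

Section nat_valued_moments.
Context d (Xi : measurableType d) (R : realType) (P : probability Xi R).
Local Open Scope ereal_scope.

Lemma nneseries_shift0 (f : nat -> \bar R) : (forall k, 0 <= f k) -> f 0%N = 0 ->
  \sum_(k <oo) f k = \sum_(k <oo) f k.+1.
Proof.
move=> f0 f00; apply/cvg_lim => //; rewrite -cvg_shiftS/=.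
rewrite (_ : (fun n => _) = fun n => \sum_(0 <= k < n) f k.+1).
  by apply: is_cvg_nneseries => n _ _.
by apply/funext => n; rewrite big_nat_recl// f00 add0e.
Qed.

Lemma integral_nat_valued (Y : Xi -> R) (phi : R -> R) (p : nat -> \bar R) :
  measurable_fun setT Y -> (forall xi, exists q : nat, Y xi = q%:R) ->
  (forall q : nat, P [set xi | Y xi = q%:R] = p q) ->
  (forall x, (0 <= phi x)%R) -> measurable_fun setT phi ->
  \int[P]_xi (phi (Y xi))%:E = \sum_(q <oo) (phi q%:R)%:E * p q.
Proof.
move=> mY nY pE phi0 mphi.
pose F (q : nat) := [set xi | Y xi = q%:R].
have mF q : measurable (F q).
  by have := mY measurableT [set q%:R] (measurable_set1 _); rewrite setTI.
have FT : setT = \bigcup_q F q.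
  by apply/esym/seteqP; split=> // xi _; have [q Yq] := nY xi; exists q.
rewrite FT ge0_integral_bigcup//; last 3 first.
- rewrite -FT; apply/measurable_EFinP; exact: measurableT_comp.
- by move=> xi _; rewrite lee_fin.
- apply/trivIsetP => i j _ _ ij; apply/seteqP; split=> // xi [].
  by rewrite /F/= => -> /eqP; rewrite eqr_nat (negbTE ij).
apply: eq_eseriesr => q _; rewrite -pE.
rewrite (eq_integral (cst (phi q%:R)%:E)) ?integral_cst//.
by move=> xi /set_mem/= ->.
Qed.

Let pm_ge0 (r : R) q : 0 <= poisson_prob r 0%N [set q].
Proof. exact: measure_ge0. Qed.

(** The recursion of the Poisson weights. With it, the first two moments follow from the total mass
    by shifting the index of the series. *)
Lemma poisson_prob_recl (r : R) (q : nat) : (0 <= r)%R ->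
  q.+1%:R%:E * poisson_prob r 0%N [set q.+1] = r%:E * poisson_prob r 0%N [set q].
Proof.
rewrite le_eqVlt => /predU1P[<-|r0].
  (* At rate 0 the law is the Dirac mass at 0, and both sides vanish. *)
  rewrite /poisson_prob ltxx mul0e diracE.
  by rewrite (_ : (0%N \in _) = false) ?mule0//; apply/negP => /set_mem.
rewrite /poisson_prob r0 !esum_set1 ?lee_fin ?poisson_pmf_ge0//.
rewrite -!EFinM /poisson_pmf r0 factS natrM; congr EFin.
rewrite exprS; field.
by rewrite nat1r !pnatr_eq0 -lt0n fact_gt0.
Qed.

Lemma poisson_prob_total (r : R) : \sum_(q <oo) poisson_prob r 0%N [set q] = 1.
Proof.
rewrite -(probability_setT (poisson_prob r 0%N)).
rewrite (_ : [set: nat] = \bigcup_q [set q]); last first.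
  by apply/esym/seteqP; split=> // x _; exists x.
rewrite measure_bigcup//; last first.
  by apply/trivIsetP => i j _ _ ij; apply/seteqP; split=> // x [/= -> ji];
    rewrite ji eqxx in ij.
by apply: eq_eseriesl => q; rewrite in_setT.
Qed.

Lemma poisson_first_moment (r : R) : (0 <= r)%R ->
  \sum_(q <oo) q%:R%:E * poisson_prob r 0%N [set q] = r%:E.
Proof.
move=> r0; rewrite nneseries_shift0 ?mul0e//; last first.
  by move=> q; rewrite mule_ge0.
under eq_eseriesr do rewrite poisson_prob_recl//.
by rewrite nneseriesZl// poisson_prob_total mule1.
Qed.

(** After the shift, the recursion absorbs one factor [q + 1] and produces [r]; the other leaves the
    first moment plus the total mass. *)
Lemma poisson_second_moment (r : R) : (0 <= r)%R ->
  \sum_(q <oo) (q%:R ^+ 2)%:E * poisson_prob r 0%N [set q] = (r ^+ 2 + r)%:E.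
Proof.
move=> r0; rewrite nneseries_shift0; last 2 first.
- by move=> q; rewrite mule_ge0// lee_fin sqr_ge0.
- by rewrite expr0n mul0e.
under eq_eseriesr => q _.
  rewrite expr2 EFinM -muleA poisson_prob_recl// muleCA -natr1 EFinD ge0_muleDl// mul1e.
  over.
rewrite nneseriesZl/=; last first.
  by move=> q _; rewrite adde_ge0// mule_ge0.
rewrite nneseriesD//; last by move=> q _ _; rewrite mule_ge0.
by rewrite poisson_first_moment// poisson_prob_total -EFinD -EFinM expr2 mulrDr mulr1.
Qed.

(** Independence says that the joint law agrees with the product of the marginals on rectangles,
    hence everywhere by uniqueness of the product measure; Tonelli then factors the integral. *)
Lemma expectation_independentM (X Y : Xi -> R) :
  measurable_fun setT X -> measurable_fun setT Y ->
  (forall xi, 0 <= X xi)%R -> (forall xi, 0 <= Y xi)%R ->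
  (forall A B : set R, measurable A -> measurable B ->
    P (X @^-1` A `&` Y @^-1` B) = P (X @^-1` A) * P (Y @^-1` B)) ->
  \int[P]_xi (X xi * Y xi)%:E = (\int[P]_xi (X xi)%:E) * (\int[P]_xi (Y xi)%:E).
Proof.
move=> mX mY X0 Y0 XY.
pose XM : {mfun Xi >-> R} := HB.pack X (isMeasurableFun.Build _ _ _ _ X mX).
pose YM : {mfun Xi >-> R} := HB.pack Y (isMeasurableFun.Build _ _ _ _ Y mY).
pose m1 : probability _ R := distribution P XM.
pose m2 : probability _ R := distribution P YM.
have mXY : measurable_fun setT (fun xi => (X xi, Y xi)).
  exact: measurable_fun_pair.
(* The absolute values make the integrand nonnegative on the whole plane, and disappear along [X]
   and [Y]. *)
pose f (z : R * R) : \bar R := (`|z.1| * `|z.2|)%:E.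
have mf : measurable_fun setT f.
  by apply/measurable_EFinP/measurable_funM; exact: measurableT_comp.
have f0 z : 0 <= f z by rewrite lee_fin mulr_ge0.
transitivity (\int[pushforward P (fun xi => (X xi, Y xi))]_z f z).
  rewrite ge0_integral_pushforward// preimage_setT.
  by apply: eq_integral => xi _; rewrite /f/= !ger0_norm.
transitivity (\int[m1 \x m2]_z f z).
  apply: eq_measure_integral => A mA _; apply/esym.
  by apply: product_measure_unique => // B C mB mC; rewrite /pushforward -XY.
rewrite fubini_tonelli1// /fubini_F.
under eq_integral => x _.
  under eq_integral do rewrite /f/= EFinM.
  rewrite ge0_integralZl_EFin//; last by do 2 apply: measurableT_comp => //.
  over.
have mnorm : measurable_fun setT (fun x : R => `|x|%:E).
  by apply/measurable_EFinP; exact: normr_measurable.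
rewrite ge0_integralZr//=; last first.
  by apply: integral_ge0 => y _; rewrite lee_fin.
congr (_ * _); rewrite ge0_integral_pushforward//; last first.
- by rewrite preimage_setT; apply: eq_integral => xi _ /=; rewrite ger0_norm.
- by rewrite preimage_setT; apply: eq_integral => xi _ /=; rewrite ger0_norm.
Qed.

End nat_valued_moments.

(** * Campbell's formula *)

Section campbell.
Context {R : realType} d (Xi : measurableType d) (P : probability Xi R).
Variables (F : Xi -> cumulative R R) (T : R).
Hypothesis T0 : (0 <= T)%R.
Hypothesis mF : forall s, (0 <= s <= T)%R -> measurable_fun setT (F ^~ s).
Local Notation mu := (@lebesgue_measure R).
Local Notation mR := (measurableTypeR R).
Local Notation I0T := (`]0%R, T]%classic : set mR).
Local Open Scope ereal_scope.

Let mI0T : measurable I0T. Proof. exact: measurable_itv. Qed.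

Let mint (g : mR -> \bar R) : measurable_fun setT g -> (forall s, 0 <= g s) ->
  measurable_fun setT
    (fun xi => \int[lebesgue_stieltjes_measure (F xi)]_(s in I0T) g s).
Proof.
move=> mg g0; apply: (@measurable_stieltjes_integral _ _ _ F T T0 mF (g \o snd)).
- exact: measurableT_comp.
- by move=> z; exact: g0.
Qed.

(** On indicators this is the mean of the Stieltjes measure weighted by [w]. Additivity and monotone
    convergence pass through both integrals because the weight and the integrands are
    nonnegative. *)
Lemma campbell_functional (w : Xi -> R) :
  measurable_fun setT w -> (forall xi, 0 <= w xi)%R ->
  monotone_functional (fun g : mR -> \bar R =>
    \int[P]_xi ((w xi)%:E * \int[lebesgue_stieltjes_measure (F xi)]_(s in I0T) g s)).
Proof.
move=> mw w0; have mEw : measurable_fun setT (EFin \o w) by exact/measurable_EFinP.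
have {}w0 xi : 0 <= (w xi)%:E by rewrite lee_fin.
split.
- move=> f g mf mg f0 g0; rewrite -ge0_integralD//; last 4 first.
  + by move=> xi _; rewrite mule_ge0// integral_ge0.
  + by apply: emeasurable_funM => //; exact: mint.
  + by move=> xi _; rewrite mule_ge0// integral_ge0.
  + by apply: emeasurable_funM => //; exact: mint.
  apply: eq_integral => xi _; rewrite ge0_integralD//; last 2 first.
  + exact: measurable_funTS.
  + exact: measurable_funTS.
  by rewrite ge0_muleDr// integral_ge0.
- move=> r f r0 mf f0; rewrite -ge0_integralZl_EFin//; last 2 first.
  + by move=> xi _; rewrite mule_ge0// integral_ge0.
  + by apply: emeasurable_funM => //; exact: mint.
  apply: eq_integral => xi _; rewrite ge0_integralZl_EFin//; last first.
    exact: measurable_funTS.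
  by rewrite muleCA.
- by move=> f f0; apply: integral_ge0 => xi _; rewrite mule_ge0// integral_ge0.
- move=> f mf f0 ndf.
  rewrite -monotone_convergence//; last 3 first.
  + by move=> n; apply: emeasurable_funM => //; exact: mint.
  + by move=> n xi _; rewrite mule_ge0// integral_ge0.
  + move=> xi _ m n mn; rewrite lee_wpmul2l// ge0_le_integral//.
    * exact: measurable_funTS.
    * exact: measurable_funTS.
    * by move=> x _; exact: ndf.
  apply: eq_integral => xi _.
  rewrite monotone_convergence//; last first.
    by move=> n; exact: measurable_funTS.
  rewrite limeMl//.
  apply: ereal_nondecreasing_is_cvgn => m n mn; rewrite ge0_le_integral//.
  + exact: measurable_funTS.
  + exact: measurable_funTS.
  + by move=> x _; exact: ndf.
Qed.

Lemma density_functional (h : mR -> R) :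
  measurable_fun setT h -> (forall s, 0 <= h s)%R ->
  monotone_functional (fun g : mR -> \bar R =>
    \int[mu]_(s in I0T) (g s * (h s)%:E)).
Proof.
move=> mh h0; have mEh : measurable_fun setT (EFin \o h) by exact/measurable_EFinP.
have m1 g : measurable_fun setT g -> measurable_fun I0T (fun s => g s * (h s)%:E).
  by move=> mg; apply/measurable_funTS/emeasurable_funM.
have h1 (g : mR -> \bar R) : (forall s, 0 <= g s) ->
    forall s, 0 <= g s * (h s)%:E.
  by move=> g0 s; rewrite mule_ge0// lee_fin.
split.
- move=> f g mf mg f0 g0; rewrite -ge0_integralD//; last 4 first.
  + by move=> xi _; exact: h1.
  + exact: m1.
  + by move=> xi _; exact: h1.
  + exact: m1.
  by apply: eq_integral => s _; rewrite ge0_muleDl.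
- move=> r f r0 mf f0; rewrite -ge0_integralZl_EFin//; last 2 first.
  + by move=> xi _; exact: h1.
  + exact: m1.
  by apply: eq_integral => s _; rewrite muleA.
- by move=> f f0; apply: integral_ge0 => xi _; exact: h1.
- move=> f mf f0 ndf.
  rewrite -monotone_convergence//; last 3 first.
  + by move=> n; exact: m1.
  + by move=> n xi _; exact: h1.
  + by move=> xi _ m n mn; rewrite lee_wpmul2r ?lee_fin// ndf.
  apply: eq_integral => s _; rewrite limeMr//.
  exact: ereal_nondecreasing_is_cvgn.
Qed.

(* A measure with density [h] is determined by its values on the intervals
   [(0, s]]: it suffices to test the weighted counting process there. *)
Lemma weighted_campbell (w : Xi -> R) (h : mR -> R) :
  measurable_fun setT w -> (forall xi, 0 <= w xi)%R ->
  measurable_fun setT h -> (forall s, 0 <= h s)%R ->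
  \int[mu]_(s in I0T) (h s)%:E < +oo ->
  (forall t, (0 <= t <= T)%R ->
    \int[P]_xi ((w xi)%:E * (F xi t - F xi 0%R)%:E) =
    \int[mu]_(s in `]0%R, t]) (h s)%:E) ->
  forall g : mR -> \bar R,
    measurable_fun setT g -> (forall s, 0 <= g s) ->
  \int[P]_xi ((w xi)%:E * \int[lebesgue_stieltjes_measure (F xi)]_(s in I0T) g s) =
  \int[mu]_(s in I0T) (g s * (h s)%:E).
Proof.
move=> mw w0 mh h0 hoo hwh g mg g0.
have H1 := campbell_functional mw w0.
have H2 := density_functional mh h0.
pose m1 := functional_measure H1; pose m2 := functional_measure H2.
have tail b : m1 `]-oo, b]%classic = m2 `]-oo, b]%classic /\
    m2 `]-oo, b]%classic < +oo.
  (* [b] clipped to [[0, T]]: the trace of []-oo, b]] on []0, T]] is then []0, b']], possibly empty,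
     and the hypothesis applies at time [b']. *)
  pose b' := Num.max 0%R (Num.min b T).
  have b'T : (0 <= b' <= T)%R by rewrite le_max lexx ge_max T0 ge_min lexx orbT.
  have IE : `]-oo, b]%classic `&` I0T = `]0%R, b']%classic :> set R.
    apply/seteqP; split=> x /=; rewrite !in_itv/=.
      move=> [xb /andP[x0 xT]]; rewrite x0/= /b' le_max; apply/orP; right.
      by rewrite le_min xb.
    move=> /andP[x0]; rewrite /b' le_max leNgt x0/= le_min => /andP[xb xT].
    by rewrite xb xT.
  have mb : measurable (`]-oo, b]%classic : set R) by exact: measurable_itv.
  have m1E : m1 `]-oo, b]%classic =
      \int[P]_xi ((w xi)%:E * (F xi b' - F xi 0%R)%:E).
    apply: eq_integral => xi _; congr (_ * _).
    rewrite integral_indic// IE.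
    by apply: lebesgue_stieltjes_itv_oc; case/andP: b'T.
  have m2E : m2 `]-oo, b]%classic = \int[mu]_(s in `]0%R, b']) (h s)%:E.
    rewrite -IE setIC integral_mkcondr; apply: eq_integral => s _.
    rewrite patchE /= indicE.
    by case: ifPn => _; rewrite ?mul1e ?mul0e.
  rewrite m1E m2E; split; first exact: hwh.
  apply: le_lt_trans hoo; apply: ge0_subset_integral => //.
  - exact/measurable_funTS/measurable_EFinP.
  - by move=> x _; rewrite lee_fin.
  - by move=> x /=; rewrite !in_itv/= => /andP[->/= /le_trans]; apply;
      case/andP: b'T.
have mT b : measurable (`]-oo, b]%classic : set mR).
  exact: measurable_itv.
have m1oo b : m1 `]-oo, b]%classic < +oo by have [->] := tail b.
(* Half-open intervals are differences of two half-lines of finite measure. They generate the Borel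
   sets, and the intervals []-n, n]] exhaust the line, which is what uniqueness of measures
   requires. *)
have oc a b : m1 `]a, b]%classic = m2 `]a, b]%classic /\
    m1 `]a, b]%classic < +oo.
  have -> : `]a, b]%classic = `]-oo, b]%classic `\` `]-oo, a]%classic :> set R.
    apply/seteqP; split=> x /=; rewrite !in_itv/=.
      by move=> /andP[ax ->]; split=> //; apply/negP; rewrite -ltNge.
    by move=> [->] /negP; rewrite -ltNge => ->.
  have -> : m1 (`]-oo, b] `\` `]-oo, a]) =
      m1 `]-oo, b]%classic - m1 (`]-oo, b] `&` `]-oo, a]).
    exact: measureD.
  have -> : m2 (`]-oo, b] `\` `]-oo, a]) =
      m2 `]-oo, b]%classic - m2 (`]-oo, b] `&` `]-oo, a]).
    by apply: measureD => //; have [] := tail b.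
  have -> : `]-oo, b] `&` `]-oo, a] = `]-oo, Num.min b a]%classic :> set R.
    apply/seteqP; split=> x /=; rewrite !in_itv/= le_min.
      by move=> [-> ->].
    by move=> /andP[-> ->].
  have [-> b2] := tail b; have [-> _] := tail (Num.min b a).
  split=> //; apply: (le_lt_trans _ b2).
  rewrite leeBlDr//; last first.
    by rewrite ge0_fin_numE//; have [] := tail (Num.min b a).
  by rewrite leeDl.
have m12 A : measurable A -> m1 A = m2 A.
  move=> mA; refine (@measure_unique _ _ mR (@ocitv R)
    (fun n : nat => `](- n%:R)%R, n%:R%R]%classic) _ _ _ _ m1 m2 _ _ A mA) => //.
  - by move=> B C; exact: (@measurableI _ (ocitv_type R)).
  - by move=> n; exact: is_ocitv.
  - exact: bigcup_itvT.
  - by move=> _ [[a b] _ <-]; have [] := oc a b.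
  - by move=> n; have [] := oc (- n%:R)%R n%:R.
have := functional_measureE H1 mg g0 => /= ->.
have := functional_measureE H2 mg g0 => /= ->.
by apply: eq_measure_integral => A mA _; exact: m12.
Qed.

End campbell.

(** * Poisson counters *)

Section counter_moments.
Context {R : realType} d (Xi : measurableType d) (P : probability Xi R).
Context (k : nat) (N : 'I_k -> Xi -> cumulative R R) (T : R) (lambda : 'cV[R]_k).
Hypothesis hN : independent_poisson_counters P N T lambda.
Local Notation mu := (@lebesgue_measure R).
Local Notation rate j := (lambda j ord0).
Local Open Scope ereal_scope.

Lemma rate_ge0 j : (0 <= rate j)%R.
Proof. by have [/(_ j)[]] := hN. Qed.

Lemma counter_measurable j t : (0 <= t <= T)%R ->
  measurable_fun setT (fun xi => N j xi t).
Proof. by have [/(_ j)[_ [h _ _ _ _]] _] := hN; exact: h. Qed.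

Lemma counter0 j xi : N j xi 0%R = 0%R.
Proof. by have [/(_ j)[_ [_ h _ _ _]] _] := hN; exact: h. Qed.

Lemma counter_ge0 j xi t : (0 <= t)%R -> (0 <= N j xi t)%R.
Proof.
by move=> t0; rewrite -(counter0 j xi); exact: cumulative_is_nondecreasing.
Qed.

Lemma path_sigma_counter j (J : set 'I_k) (s t : R) (B : set R) :
  J j -> (0 <= s <= t)%R -> measurable B ->
  path_sigma N J t [set xi | B (N j xi s)].
Proof.
by move=> Jj st mB; apply: sub_sigma_algebra; exists j, s, B.
Qed.

Let counter_nat j t xi : (0 <= t <= T)%R -> exists q : nat, N j xi t = q%:R.
Proof. by move=> t0T; have [/(_ j)[_ [_ _ h _ _]] _] := hN; exact: h. Qed.

Let counter_law j t (q : nat) : (0 <= t <= T)%R ->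
  P [set xi | N j xi t = q%:R] = poisson_prob (rate j * t) 0%N [set q].
Proof.
move=> /andP[t0 tT]; have [/(_ j)[_ [_ _ _ h _]] _] := hN.
rewrite -[in RHS](subr0 t) -(h 0%R t q)//; congr (P _).
by apply/seteqP; split=> xi /=; rewrite counter0 subr0.
Qed.

Lemma counter_first_moment j t : (0 <= t <= T)%R ->
  \int[P]_xi (N j xi t)%:E = (rate j * t)%:E.
Proof.
move=> t0T; have t0 : (0 <= t)%R by case/andP: t0T.
transitivity (\int[P]_xi (`|N j xi t|)%:E).
  by apply: eq_integral => xi _; rewrite ger0_norm// counter_ge0.
rewrite (integral_nat_valued (counter_measurable j t0T) _
  (fun q => counter_law j q t0T))//; last by move=> xi; exact: counter_nat.
under eq_eseriesr do rewrite ger0_norm//.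
by rewrite poisson_first_moment// mulr_ge0// rate_ge0.
Qed.

Lemma counter_second_moment j t : (0 <= t <= T)%R ->
  \int[P]_xi (N j xi t * N j xi t)%:E = ((rate j * t) ^+ 2 + rate j * t)%:E.
Proof.
move=> t0T; have t0 : (0 <= t)%R by case/andP: t0T.
under eq_integral do rewrite -expr2.
rewrite (@integral_nat_valued _ _ _ _ _ (fun x => x ^+ 2)%R _
  (counter_measurable j t0T) _ (fun q => counter_law j q t0T))//; last 2 first.
- by move=> xi; exact: counter_nat.
- by move=> x; exact: sqr_ge0.
by rewrite poisson_second_moment// mulr_ge0// rate_ge0.
Qed.

(** Write [N t] as [N s] plus an increment. The square of [N s] gives the second moment, and the
    increment is independent of the past, so the cross term is a product of means. *)
Let counter_product_le j s t : (0 <= s <= t)%R -> (t <= T)%R ->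
  \int[P]_xi (N j xi s * N j xi t)%:E =
  (rate j * s * (rate j * t) + rate j * s)%:E.
Proof.
move=> /andP[s0 st] tT.
have s0T : (0 <= s <= T)%R by rewrite s0 (le_trans st).
have t0T : (0 <= t <= T)%R by rewrite (le_trans s0).
have ms := counter_measurable j s0T; have mt := counter_measurable j t0T.
have inc0 xi : (0 <= N j xi t - N j xi s)%R.
  by rewrite subr_ge0; exact: cumulative_is_nondecreasing.
have minc : measurable_fun setT (fun xi => N j xi t - N j xi s)%R.
  exact: measurable_funB.
transitivity (\int[P]_xi ((N j xi s * N j xi s)%:E +
    (N j xi s * (N j xi t - N j xi s))%:E)).
  by apply: eq_integral => xi _; rewrite -EFinD -mulrDr addrC subrK.
rewrite ge0_integralD//; last 4 first.
- by move=> xi _; rewrite lee_fin mulr_ge0// counter_ge0.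
- by apply/measurable_EFinP/measurable_funM.
- by move=> xi _; rewrite lee_fin mulr_ge0// counter_ge0.
- by apply/measurable_EFinP/measurable_funM.
rewrite counter_second_moment// expectation_independentM//; last 2 first.
- by move=> xi; exact: counter_ge0.
- move=> A B mA mB; have [/(_ j)[_ [_ _ _ _ h]] _] := hN.
  by apply: (h s t) => //; apply: path_sigma_counter => //; rewrite s0 lexx.
have -> : \int[P]_xi (N j xi t - N j xi s)%:E = (rate j * t - rate j * s)%:E.
  have : \int[P]_xi (N j xi t)%:E = \int[P]_xi (N j xi s)%:E +
      \int[P]_xi (N j xi t - N j xi s)%:E.
    rewrite -ge0_integralD//; last 4 first.
    - by move=> xi _; rewrite lee_fin counter_ge0.
    - exact/measurable_EFinP.
    - by move=> xi _; rewrite lee_fin.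
    - exact/measurable_EFinP.
    by apply: eq_integral => xi _; rewrite -EFinD addrC subrK.
  rewrite !counter_first_moment// EFinB => ->.
  by rewrite addeAC subee// add0e.
by rewrite counter_first_moment// -EFinM -EFinD; congr EFin; ring.
Qed.

Lemma counter_product i j s t : (0 <= s <= T)%R -> (0 <= t <= T)%R ->
  \int[P]_xi (N i xi s * N j xi t)%:E =
  (rate i * s * (rate j * t) + (i == j)%:R * (rate i * Num.min s t))%:E.
Proof.
move=> s0T t0T; have [<-|ij] := eqVneq i j.
  have /andP[s0 sT] := s0T; have /andP[t0 tT] := t0T.
  rewrite mul1r; have [st|/ltW ts] := leP s t.
    by rewrite counter_product_le// s0.
  under eq_integral do rewrite mulrC.
  by rewrite counter_product_le ?t0//; congr EFin; ring.
rewrite mul0r addr0 expectation_independentM//; last 5 first.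
- exact: counter_measurable.
- exact: counter_measurable.
- by move=> xi; apply: counter_ge0; case/andP: s0T.
- by move=> xi; apply: counter_ge0; case/andP: t0T.
- move=> A B mA mB; have [_ indep] := hN.
  (* Taking the whole space for every component other than [i] and [j] reduces independence of all
     the components to a product of two factors. *)
  pose E l : set Xi := if l == i then [set xi | A (N i xi s)]
    else if l == j then [set xi | B (N j xi t)] else setT.
  have -> : (fun xi => N i xi s) @^-1` A `&` (fun xi => N j xi t) @^-1` B =
      \bigcap_(l in [set: 'I_k]) E l.
    apply/seteqP; split=> xi.
      move=> [/= Axi Bxi] l _; rewrite /E.
      by case: eqVneq => // _; case: eqVneq.
    move=> h; split; first by have := h i I; rewrite /E eqxx.
    by have := h j I; rewrite /E eqxx eq_sym (negbTE ij).
  rewrite indep; last first.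
    move=> l; rewrite /E; case: eqVneq => [->|_].
      exact: path_sigma_counter.
    case: eqVneq => [->|_]; first exact: path_sigma_counter.
    exact: (@measurableT _ (g_sigma_algebraType _)).
  rewrite (bigD1 i)//= (bigD1 j)/=; last by rewrite eq_sym.
  rewrite big1 ?mule1; last first.
    move=> l /andP[li lj]; rewrite /E (negbTE li) (negbTE lj).
    exact: probability_setT.
  by rewrite /E eqxx eq_sym (negbTE ij) eqxx.
by rewrite !counter_first_moment// -EFinM.
Qed.

End counter_moments.

(** * Almost everywhere equality and square integrability *)

Import HBNNSimple.

(* No measurability is needed: changing a nonnegative simple minorant on a null
   set does not change its integral. *)
Lemma eq_integral_ae d (X : measurableType d) (R : realType)
    (m : {measure set X -> \bar R})
    (D : set X) (f g : X -> \bar R) :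
  {ae m, forall x, D x -> f x = g x} ->
  (\int[m]_(x in D) f x = \int[m]_(x in D) g x)%E.
Proof.
have H (f' g' : X -> \bar R) : (forall x, 0 <= f' x)%E -> (forall x, 0 <= g' x)%E ->
    {ae m, forall x, f' x = g' x} -> (\int[m]_x f' x <= \int[m]_x g' x)%E.
  move=> f0 g0 [N [mN N0 fg]].
  rewrite (ge0_integralTE _ f0) (ge0_integralTE _ g0).
  apply: ub_ereal_sup => _ [h hf <-]; pose h' := proj_nnsfun h (measurableC mN).
  have -> : sintegral m h = sintegral m h'.
    rewrite -!integralT_nnsfun; apply: ae_eq_integral => //.
    - exact/measurable_EFinP.
    - exact/measurable_EFinP.
    exists N; split=> // x /= /not_implyP[_ hh']; apply: contrapT => nN; apply: hh'.
    by rewrite /proj_nnsfun/= mindicE mem_set// mulr1.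
  apply: ereal_sup_ubound; exists h' => // x; rewrite /proj_nnsfun/= mindicE.
  case: (boolP (x \in ~` N)) => [/set_mem xN|_]; last by rewrite mulr0.
  rewrite mulr1 (le_trans (hf x))// (_ : f' x = g' x)//.
  by apply: contrapT => /= /fg.
move=> fg; rewrite integral_mkcond [RHS]integral_mkcond integralE [RHS]integralE.
have {}fg : {ae m, forall x, (f \_ D) x = (g \_ D) x}.
  apply: filterS fg => x fg; rewrite !patchE; case: ifPn => // /set_mem Dx.
  exact: fg.
by congr (_ - _)%E; apply/eqP; rewrite eq_le !H//; apply: filterS fg => x fg;
  rewrite ?funeposE ?funenegE fg.
Qed.

Section integrability_tools.
Context d (T : measurableType d) (R : realType) (m : {measure set T -> \bar R}).
Local Open Scope ereal_scope.

Lemma integrable_ae_eq (D : set T) (f g : T -> \bar R) : measurable D ->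
  m.-integrable D f -> measurable_fun D g -> ae_eq m D f g ->
  m.-integrable D g /\ \int[m]_(x in D) f x = \int[m]_(x in D) g x.
Proof.
move=> mD fi mg fg; have mf := measurable_int m fi.
split; last exact: ae_eq_integral.
apply/integrableP; split=> //; have /integrableP[_] := fi.
apply: le_lt_trans; rewrite le_eqVlt; apply/orP; left; apply/eqP.
apply: (ge0_ae_eq_integral (f := abse \o g)) => //.
- exact: measurableT_comp.
- exact: measurableT_comp.
- by move=> x _; exact: abse_ge0.
- exact/ae_eq_abse/ae_eq_sym.
Qed.

Lemma le_integrable_fin (D : set T) (f h : T -> R) : measurable D ->
  measurable_fun D f -> (forall x, D x -> `|f x| <= h x)%R ->
  m.-integrable D (EFin \o h) -> m.-integrable D (EFin \o f).
Proof.
move=> mD mf fh; apply: le_integrable => //; first exact/measurable_EFinP.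
by move=> x Dx /=; rewrite lee_fin (le_trans (fh _ Dx))// ler_norm.
Qed.

Lemma sqr_integrableM (D : set T) (f g : T -> R) : measurable D ->
  measurable_fun D f -> measurable_fun D g ->
  m.-integrable D (fun x => (f x ^+ 2)%:E) ->
  m.-integrable D (fun x => (g x ^+ 2)%:E) ->
  m.-integrable D (fun x => (f x * g x)%:E).
Proof.
move=> mD mf mg f2 g2.
apply: (@le_integrable_fin D _ (fun x => f x ^+ 2 + g x ^+ 2)%R) => //.
- exact: measurable_funM.
- move=> x _; rewrite ler_norml; apply/andP; split.
    by have := sqr_ge0 (f x + g x); have := sqr_ge0 (f x); have := sqr_ge0 (g x);
      nra.
  by have := sqr_ge0 (f x - g x); have := sqr_ge0 (f x); have := sqr_ge0 (g x);
    nra.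
- by apply: eq_integrable (integrableD mD f2 g2) => // x _; rewrite EFinD.
Qed.

Lemma sqr_integrable_integrable (D : set T) (f : T -> R) : measurable D ->
  m D < +oo -> measurable_fun D f -> m.-integrable D (fun x => (f x ^+ 2)%:E) ->
  m.-integrable D (EFin \o f).
Proof.
move=> mD Doo mf f2.
have i1 : m.-integrable D (fun x => (1 ^+ 2)%:E).
  rewrite expr1n; apply/integrableP; split; first exact: measurable_cst.
  by rewrite integral_cst//= normr1 mul1e.
have m1 : measurable_fun D (cst 1%R : T -> R) by exact: measurable_cst.
have := sqr_integrableM mD m1 mf i1 f2.
by apply: eq_integrable => // x _ /=; rewrite mul1r.
Qed.

End integrability_tools.

(** * First and second moments of integrals against Poisson counters *)

Section ito_isometry.
Context {R : realType} d (Xi : measurableType d) (P : probability Xi R).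
Context (k : nat) (N : 'I_k -> Xi -> cumulative R R) (T : R) (lambda : 'cV[R]_k).
Hypothesis hN : independent_poisson_counters P N T lambda.
Hypothesis T0 : 0 <= T.
Local Notation mu := (@lebesgue_measure R).
Local Notation mR := (measurableTypeR R).
Local Notation rate j := (lambda j ord0).
Local Notation I0T := (`]0%R, T]%classic : set mR).
Local Notation ls j xi := (lebesgue_stieltjes_measure (N j xi)).
Local Open Scope ereal_scope.

Let mI t : measurable (`]0%R, t]%classic : set mR).
Proof. exact: measurable_itv. Qed.

Let TT : (0 <= T <= T)%R. Proof. by rewrite T0 lexx. Qed.

Let mNj j s : (0 <= s <= T)%R -> measurable_fun setT ((N j) ^~ s).
Proof. exact: (counter_measurable hN). Qed.

Let integral_affine (t c e : R) (f : mR -> R) : (0 <= t)%R ->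
  (0 <= c)%R -> (0 <= e)%R -> measurable_fun setT f -> (forall x, 0 <= f x)%R ->
  \int[mu]_(x in `]0%R, t]) (c + e * f x)%:E =
  (c * t)%:E + e%:E * \int[mu]_(x in `]0%R, t]) (f x)%:E.
Proof.
move=> t0 c0 e0 mf f0.
have mEf : measurable_fun `]0%R, t]%classic (fun x => (f x)%:E).
  exact/measurable_funTS/measurable_EFinP.
under eq_integral do rewrite EFinD EFinM.
rewrite ge0_integralD//; last 2 first.
- by move=> x _; rewrite mule_ge0// lee_fin.
- exact: measurable_funeM.
rewrite (@integral_cst _ _ _ mu _ (mI t) c%:E)/= lebesgue_measure_itv_oc// subr0.
by rewrite -EFinM ge0_integralZl_EFin// => x _; rewrite lee_fin.
Qed.

Lemma campbell_mean j (g : mR -> \bar R) :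
  measurable_fun setT g -> (forall s, 0 <= g s) ->
  \int[P]_xi \int[ls j xi]_(s in I0T) g s = (rate j)%:E * \int[mu]_(s in I0T) g s.
Proof.
move=> mg g0.
have H : forall t, (0 <= t <= T)%R ->
    \int[P]_xi ((cst 1%R xi)%:E * (N j xi t - N j xi 0%R)%:E) =
    \int[mu]_(s in `]0%R, t]) (cst (rate j) s)%:E.
  move=> t t0T; have /andP[t0 tT] := t0T.
  rewrite (@integral_cst _ _ _ mu _ (mI t) (rate j)%:E)/=.
  rewrite lebesgue_measure_itv_oc// subr0 -EFinM -(counter_first_moment hN j t0T).
  by apply: eq_integral => xi _; rewrite mul1e (counter0 hN) subr0.
have r0 := rate_ge0 hN j.
transitivity (\int[P]_xi ((cst 1%R xi)%:E * \int[ls j xi]_(s in I0T) g s)).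
  by apply: eq_integral => xi _; rewrite mul1e.
rewrite (weighted_campbell T0 (mNj j) _ _ _ _ _ H)//.
- under eq_integral do rewrite muleC.
  by rewrite ge0_integralZl_EFin//; exact: measurable_funTS.
- rewrite (@integral_cst _ _ _ mu _ (mI T) (rate j)%:E)/=.
  by rewrite lebesgue_measure_itv_oc// -EFinM ltry.
Qed.

Lemma itv_oc_cap (t s : R) : (0 <= t)%R -> (0 <= s)%R ->
  `]0%R, t]%classic `&` `]-oo, s]%classic = `]0%R, Num.min s t]%classic :> set R.
Proof.
move=> t0 s0; apply/seteqP; split=> x /=; rewrite !in_itv/= le_min.
  by move=> [/andP[-> ->] ->].
by move=> /andP[-> /andP[-> ->]].
Qed.

(** [weighted_campbell] with the weight [N j s]. By [counter_product], the mean of [N j s * N i t]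
    is [rate i * rate j * s * t] plus, when [i = j], [rate i * min s t]: the primitive in [t] of a
    constant plus a multiple of the indicator of []-oo, s]], which is the density [h]. *)
Lemma campbell_counter i j (f : mR -> R) s : (0 <= s <= T)%R ->
  measurable_fun setT f -> (forall x, 0 <= f x)%R ->
  \int[P]_xi ((N j xi s)%:E * \int[ls i xi]_(x in I0T) (f x)%:E) =
  (rate i * rate j * s)%:E * \int[mu]_(x in I0T) (f x)%:E +
  ((i == j)%:R * rate i)%:E * \int[mu]_(x in `]0%R, s]) (f x)%:E.
Proof.
move=> s0T mf f0; have /andP[s0 sT] := s0T.
have ri0 := rate_ge0 hN i; have rj0 := rate_ge0 hN j.
have c0 : (0 <= rate i * rate j * s)%R by rewrite !mulr_ge0.
have e0 : (0 <= (i == j)%:R * rate i)%R by rewrite mulr_ge0.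
pose ind : mR -> R := \1_(`]-oo, s]%classic : set R).
have mind : measurable_fun setT ind.
  by apply: measurable_indic; exact: measurable_itv.
pose h (x : mR) := (rate i * rate j * s + (i == j)%:R * rate i * ind x)%R.
have mh : measurable_fun setT h.
  by apply: measurable_funD => //; exact: measurable_funM.
have h0 x : (0 <= h x)%R by rewrite addr_ge0// mulr_ge0// /ind indicE.
have intind t : (0 <= t)%R -> \int[mu]_(x in `]0%R, t]) (ind x)%:E = (Num.min s t)%:E.
  move=> t0; rewrite integral_indic// setIC itv_oc_cap//.
  by rewrite /= lebesgue_measure_itv_oc ?subr0// le_min s0.
have inth t : (0 <= t)%R -> \int[mu]_(x in `]0%R, t]) (h x)%:E =
    (rate i * rate j * s * t + (i == j)%:R * rate i * Num.min s t)%:E.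
  by move=> t0; rewrite integral_affine// intind// EFinD EFinM.
have H t : (0 <= t <= T)%R ->
    \int[P]_xi ((N j xi (Num.max 0%R s))%:E * (N i xi t - N i xi 0%R)%:E) =
    \int[mu]_(x in `]0%R, t]) (h x)%:E.
  move=> t0T; have /andP[t0 tT] := t0T; rewrite inth// (max_idPr s0).
  under eq_integral do rewrite (counter0 hN) subr0 -EFinM.
  rewrite (counter_product hN)//; congr EFin.
  by rewrite [j == i]eq_sym; case: eqVneq => [->|_] /=; rewrite ?mul1r ?mul0r; ring.
have := @weighted_campbell _ _ _ P (N i) T T0 (mNj i)
  (fun xi => N j xi (Num.max 0%R s)) h _ _ mh h0 _ H (EFin \o f) _ _.
rewrite (max_idPr s0) => -> //; last 4 first.
- exact: mNj.
- by move=> xi; exact: (counter_ge0 hN).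
- by rewrite inth// ltry.
- exact/measurable_EFinP.
transitivity (\int[mu]_(x in I0T) ((rate i * rate j * s)%:E * (f x)%:E +
    ((i == j)%:R * rate i)%:E * (f x * ind x)%:E)).
  by apply: eq_integral => x _; rewrite -!EFinM -EFinD /h; congr EFin; ring.
have find0 x : (0 <= f x * ind x)%R by rewrite mulr_ge0// /ind indicE.
have mfE : measurable_fun I0T (EFin \o f).
  exact/measurable_funTS/measurable_EFinP.
have mfind : measurable_fun I0T (fun x => (f x * ind x)%:E).
  exact/measurable_funTS/measurable_EFinP/measurable_funM.
rewrite ge0_integralD//; last 4 first.
- by move=> x _; rewrite mule_ge0// lee_fin.
- exact: measurable_funeM.
- by move=> x _; rewrite mule_ge0// lee_fin.
- exact: measurable_funeM.
rewrite !ge0_integralZl_EFin//; last 2 first.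
- by move=> x _; rewrite lee_fin.
- by move=> x _; rewrite lee_fin.
congr (_ + _ * _).
rewrite -[in RHS](min_idPl sT) -itv_oc_cap// integral_mkcondr.
apply: eq_integral => x _; rewrite patchE /ind indicE.
by case: ifPn => _; rewrite ?mulr1 ?mulr0.
Qed.

Definition counter_integral j (f : mR -> R) (xi : Xi) : R :=
  (\int[ls j xi]_(s in I0T) f s)%R.

Local Notation U := counter_integral.
Local Notation J f := (\int[mu]_(s in I0T) f s)%R.

Lemma measurable_counter_integral j f : measurable_fun setT f ->
  measurable_fun setT (U j f).
Proof.
move=> mf.
apply: (@measurable_stieltjes_Rintegral _ _ _ (N j) T T0 (mNj j) (f \o snd)).
exact: measurableT_comp.
Qed.

Let int_fin f : mu.-integrable I0T (EFin \o f) ->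
  \int[mu]_(x in I0T) (f x)%:E = (J f)%:E.
Proof. by move=> fi; rewrite /Rintegral fineK// integrable_fin_num. Qed.

(** By [campbell_mean], the integral of [|f|] along a random path has finite expectation, so it is
    almost surely finite. *)
Lemma counter_integrable_ae j (f : mR -> R) : measurable_fun setT f ->
  mu.-integrable I0T (EFin \o f) ->
  {ae P, forall xi, (ls j xi).-integrable I0T (EFin \o f)}.
Proof.
move=> mf fi.
have mfE : measurable_fun setT (EFin \o f) by exact/measurable_EFinP.
pose V xi := \int[ls j xi]_(s in I0T) `|(f s)%:E|.
have mV : measurable_fun setT V.
  apply: (@measurable_stieltjes_integral _ _ _ (N j) T T0 (mNj j)
    (fun z => `|(f z.2)%:E|)) => //.
  by do 2 apply: measurableT_comp => //; exact: measurableT_comp.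
have iV : P.-integrable setT V.
  apply/integrableP; split=> //.
  under eq_integral do rewrite gee0_abs ?integral_ge0//.
  rewrite (campbell_mean j (g := fun s => `|(f s)%:E|))//.
    by rewrite lte_mul_pinfty ?lee_fin ?(rate_ge0 hN)//; have /integrableP[] := fi.
  exact: measurableT_comp.
apply: filterS (integrable_ae measurableT iV) => xi /(_ I) Vfin.
apply/integrableP; split; first exact: measurable_funTS.
by rewrite -ge0_fin_numE ?integral_ge0.
Qed.

Let counter_integralE j f : measurable_fun setT f ->
  mu.-integrable I0T (EFin \o f) ->
  {ae P, forall xi, (U j f xi)%:E = \int[ls j xi]_(s in I0T) (f s)%:E}.
Proof.
move=> mf fi; apply: filterS (counter_integrable_ae j mf fi) => xi h.
by rewrite /U /Rintegral fineK// integrable_fin_num.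
Qed.

Let mint j (g : mR -> R) : measurable_fun setT g -> (forall s, 0 <= g s)%R ->
  measurable_fun setT (fun xi => \int[ls j xi]_(s in I0T) (g s)%:E).
Proof.
move=> mg g0; apply: (@measurable_stieltjes_integral _ _ _ (N j) T T0 (mNj j)
  (EFin \o (g \o snd))).
- by apply/measurable_EFinP; exact: measurableT_comp.
- by move=> z; rewrite lee_fin g0.
Qed.

Let U_ge0 j f : (forall s, 0 <= f s)%R -> forall xi, (0 <= U j f xi)%R.
Proof. by move=> f0 xi; apply: Rintegral_ge0. Qed.

Let mean_nonneg j (f : mR -> R) : measurable_fun setT f -> (forall s, 0 <= f s)%R ->
  mu.-integrable I0T (EFin \o f) ->
  \int[P]_xi (U j f xi)%:E = (rate j * J f)%:E.
Proof.
move=> mf f0 fi; rewrite EFinM -(int_fin fi).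
have mfE : measurable_fun setT (EFin \o f) by exact/measurable_EFinP.
have fE0 s : 0 <= (EFin \o f) s by rewrite lee_fin f0.
rewrite -(campbell_mean j mfE fE0).
by apply: eq_integral_ae; apply: filterS (counter_integralE j mf fi) => xi -> _.
Qed.

(** [weighted_campbell] once more, now with the random weight [U i f]. The values it needs on the
    intervals []0, t]] are exactly those given by [campbell_counter], and the density becomes a
    constant plus a multiple of [f]. *)
Let product_nonneg i j (f g : mR -> R) :
  measurable_fun setT f -> measurable_fun setT g ->
  (forall s, 0 <= f s)%R -> (forall s, 0 <= g s)%R ->
  mu.-integrable I0T (EFin \o f) -> mu.-integrable I0T (EFin \o g) ->
  mu.-integrable I0T (EFin \o (f \* g)%R) ->
  \int[P]_xi (U i f xi * U j g xi)%:E =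
  (rate i * rate j * (J f * J g) + (i == j)%:R * rate i * J (f \* g)%R)%:E.
Proof.
move=> mf mg f0 g0 fi gi fgi.
have ri0 := rate_ge0 hN i; have rj0 := rate_ge0 hN j.
have J0 : (0 <= J f)%R by exact: Rintegral_ge0.
have c0 : (0 <= rate i * rate j * J f)%R by rewrite !mulr_ge0.
have e0 : (0 <= (i == j)%:R * rate i)%R by rewrite mulr_ge0.
pose h x := (rate i * rate j * J f + (i == j)%:R * rate i * f x)%R.
have h0 x : (0 <= h x)%R by rewrite addr_ge0// mulr_ge0.
have mh : measurable_fun setT h.
  by apply: measurable_funD => //; exact: measurable_funM.
have mU : measurable_fun setT (U i f) by exact: measurable_counter_integral.
have H t : (0 <= t <= T)%R ->
    \int[P]_xi ((U i f xi)%:E * (N j xi t - N j xi 0%R)%:E) =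
    \int[mu]_(x in `]0%R, t]) (h x)%:E.
  move=> t0T; have /andP[t0 tT] := t0T; rewrite integral_affine//.
  transitivity (\int[P]_xi ((N j xi t)%:E * \int[ls i xi]_(x in I0T) (f x)%:E)).
    apply: eq_integral_ae; apply: filterS (counter_integralE i mf fi) => xi <- _.
    by rewrite (counter0 hN) subr0 muleC.
  rewrite campbell_counter// int_fin// -EFinM; congr (_%:E + _).
  by ring.
transitivity (\int[P]_xi ((U i f xi)%:E * \int[ls j xi]_(s in I0T) (g s)%:E)).
  apply: eq_integral_ae.
  by apply: filterS (counter_integralE j mg gi) => xi <- _; rewrite EFinM.
have hoo : \int[mu]_(s in I0T) (h s)%:E < +oo.
  by rewrite integral_affine// int_fin// -EFinM -EFinD ltry.
have mgE : measurable_fun setT (EFin \o g) by exact/measurable_EFinP.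
rewrite (weighted_campbell T0 (mNj j) mU (U_ge0 i f0) mh h0 hoo H mgE); last first.
  by move=> s; rewrite lee_fin g0.
transitivity (\int[mu]_(x in I0T) ((rate i * rate j * J f)%:E * (g x)%:E +
    ((i == j)%:R * rate i)%:E * (f x * g x)%:E)).
  by apply: eq_integral => x _; rewrite -!EFinM -EFinD /h; congr EFin; ring.
rewrite ge0_integralD//; last 4 first.
- by move=> x _; rewrite mule_ge0// lee_fin.
- exact/measurable_funeM/measurable_funTS/measurable_EFinP.
- by move=> x _; rewrite mule_ge0// lee_fin mulr_ge0.
- exact/measurable_funeM/measurable_funTS/measurable_EFinP/measurable_funM.
rewrite !ge0_integralZl_EFin//; last 4 first.
- by move=> x _; rewrite lee_fin mulr_ge0.
- exact/measurable_funTS/measurable_EFinP/measurable_funM.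
- by move=> x _; rewrite lee_fin.
- exact/measurable_funTS/measurable_EFinP.
by rewrite (int_fin gi) (int_fin fgi) -!EFinM -EFinD; congr EFin; ring.
Qed.

Let nonneg_integrable (Y : Xi -> R) (r : R) : measurable_fun setT Y ->
  (forall xi, 0 <= Y xi)%R -> \int[P]_xi (Y xi)%:E = r%:E ->
  P.-integrable setT (EFin \o Y).
Proof.
move=> mY Y0 Yr; apply/integrableP; split; first exact/measurable_EFinP.
under eq_integral do rewrite gee0_abs ?lee_fin//.
by rewrite Yr ltry.
Qed.

Let funrpos_ge0' (f : mR -> R) s : (0 <= (f^\+)%R s)%R.
Proof. exact: funrpos_ge0. Qed.

Let funrneg_ge0' (f : mR -> R) s : (0 <= (f^\-)%R s)%R.
Proof. exact: funrneg_ge0. Qed.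

Let U_posneg j (f : mR -> R) : measurable_fun setT f ->
  mu.-integrable I0T (EFin \o f) ->
  {ae P, forall xi, U j f xi = U j (f^\+)%R xi - U j (f^\-)%R xi}%R.
Proof.
move=> mf fi; apply: filterS (counter_integrable_ae j mf fi) => xi fxi.
rewrite /U -RintegralB//.
- by rewrite -[in LHS](funrposBneg f).
- exact: integrable_funrpos.
- exact: integrable_funrneg.
Qed.

Let ae_difference_product (a b c e u v : Xi -> R) :
  P.-integrable setT (EFin \o (a \* c)%R) ->
  P.-integrable setT (EFin \o (a \* e)%R) ->
  P.-integrable setT (EFin \o (b \* c)%R) ->
  P.-integrable setT (EFin \o (b \* e)%R) ->
  measurable_fun setT (u \* v)%R ->
  {ae P, forall xi, u xi = a xi - b xi}%R ->
  {ae P, forall xi, v xi = c xi - e xi}%R ->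
  P.-integrable setT (EFin \o (u \* v)%R) /\
  (\int[P]_xi (u xi * v xi) =
    \int[P]_xi (a xi * c xi) - \int[P]_xi (a xi * e xi) -
    (\int[P]_xi (b xi * c xi) - \int[P]_xi (b xi * e xi)))%R.
Proof.
move=> ac ae bc be muv uab vce.
have i1 := integrableB measurableT ac ae; have i2 := integrableB measurableT bc be.
have [| |iuv E] := integrable_ae_eq (g := EFin \o (u \* v)%R) measurableT
  (integrableB measurableT i1 i2).
- exact/measurable_EFinP.
- by apply: filterS2 uab vce => xi /= -> -> _; rewrite -!EFinB; congr EFin; ring.
split=> //; rewrite -RintegralB// -RintegralB// -RintegralB//.
by rewrite /Rintegral -E.
Qed.

Let J_posneg (f : mR -> R) : mu.-integrable I0T (EFin \o f) ->
  J f = (J (f^\+)%R - J (f^\-)%R)%R.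
Proof.
move=> fi; rewrite -RintegralB//.
- by rewrite -[in LHS](funrposBneg f).
- exact: integrable_funrpos.
- exact: integrable_funrneg.
Qed.

Lemma counter_integral_mean j (f : mR -> R) :
  measurable_fun setT f -> mu.-integrable I0T (EFin \o f) ->
  P.-integrable setT (EFin \o U j f) /\
  \int[P]_xi (U j f xi)%:E = (rate j * J f)%:E.
Proof.
move=> mf fi.
have mp : measurable_fun setT (f^\+)%R by exact: measurable_funrpos.
have mn : measurable_fun setT (f^\-)%R by exact: measurable_funrneg.
have ip := integrable_funrpos (mI T) fi; have in_ := integrable_funrneg (mI T) fi.
have Ep := mean_nonneg j mp (funrpos_ge0' f) ip.
have En := mean_nonneg j mn (funrneg_ge0' f) in_.
have Ip := nonneg_integrable (measurable_counter_integral j mp)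
  (U_ge0 j (funrpos_ge0' f)) Ep.
have In := nonneg_integrable (measurable_counter_integral j mn)
  (U_ge0 j (funrneg_ge0' f)) En.
have [| |iU <-] := integrable_ae_eq (g := EFin \o U j f) measurableT
  (integrableB measurableT Ip In).
- by apply/measurable_EFinP; exact: measurable_counter_integral.
- by apply: filterS (U_posneg j mf fi) => xi /= -> _; rewrite EFinB.
split=> //; rewrite integralB_EFin//= Ep En -EFinB -mulrBr.
by rewrite -J_posneg.
Qed.

Let product_nonneg_integrable i j (f g : mR -> R) :
  measurable_fun setT f -> measurable_fun setT g ->
  (forall s, 0 <= f s)%R -> (forall s, 0 <= g s)%R ->
  mu.-integrable I0T (EFin \o f) -> mu.-integrable I0T (EFin \o g) ->
  mu.-integrable I0T (EFin \o (f \* g)%R) ->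
  P.-integrable setT (EFin \o (U i f \* U j g)%R) /\
  (\int[P]_xi (U i f xi * U j g xi))%R =
  (rate i * rate j * (J f * J g) + (i == j)%:R * rate i * J (f \* g)%R)%R.
Proof.
move=> mf mg f0 g0 fi gi fgi; have H := product_nonneg i j mf mg f0 g0 fi gi fgi.
split; last by rewrite /Rintegral H.
apply: (nonneg_integrable _ _ H).
- by apply: measurable_funM; exact: measurable_counter_integral.
- by move=> xi; rewrite mulr_ge0// U_ge0.
Qed.

(** Signed integrands are split into positive and negative parts and the four nonnegative cases
    recombined. Square integrability on an interval of finite length supplies the integrability of
    each part and of each of the four products. *)
Lemma counter_integral_product i j (f g : mR -> R) :
  measurable_fun setT f -> measurable_fun setT g ->
  mu.-integrable I0T (fun s => (f s ^+ 2)%:E) ->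
  mu.-integrable I0T (fun s => (g s ^+ 2)%:E) ->
  P.-integrable setT (EFin \o (U i f \* U j g)%R) /\
  (\int[P]_xi (U i f xi * U j g xi))%R =
  (rate i * rate j * (J f * J g) + (i == j)%:R * rate i * J (f \* g)%R)%R.
Proof.
move=> mf mg f2 g2.
have muoo : mu I0T < +oo by rewrite /= lebesgue_measure_itv_oc// ltry.
have fi := sqr_integrable_integrable (mI T) muoo (measurable_funTS mf) f2.
have gi := sqr_integrable_integrable (mI T) muoo (measurable_funTS mg) g2.
have mfp : measurable_fun setT (f^\+)%R by exact: measurable_funrpos.
have mfn : measurable_fun setT (f^\-)%R by exact: measurable_funrneg.
have mgp : measurable_fun setT (g^\+)%R by exact: measurable_funrpos.
have mgn : measurable_fun setT (g^\-)%R by exact: measurable_funrneg.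
have ifp := integrable_funrpos (mI T) fi; have ifn := integrable_funrneg (mI T) fi.
have igp := integrable_funrpos (mI T) gi; have ign := integrable_funrneg (mI T) gi.
(* Since [|h|] is the sum of the two parts of [h], each part is at most [|h|] and inherits square
   integrability. *)
have sqle (a h : mR -> R) : (a = h^\+ \/ a = h^\-)%R ->
    mu.-integrable I0T (fun s => (h s ^+ 2)%:E) -> measurable_fun setT h ->
    mu.-integrable I0T (fun s => (a s ^+ 2)%:E).
  move=> ah h2 mh.
  apply: (le_integrable_fin (h := fun s => h s ^+ 2)%R (mI T) _ _ h2).
    by apply/measurable_funTS/measurable_funX; case: ah => ->;
      [exact: measurable_funrpos|exact: measurable_funrneg].
  move=> s _; rewrite ger0_norm ?sqr_ge0// -[leRHS]real_normK ?num_real//.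
  have -> : (`|h s| = h^\+ s + h^\- s)%R.
    by rewrite -[RHS]/((h^\+ + h^\-)%R s) funrposDneg.
  have hp := funrpos_ge0' h s; have hn := funrneg_ge0' h s.
  by rewrite ler_sqr ?nnegrE ?addr_ge0//; case: ah => ->; rewrite ?lerDl ?lerDr.
have fp2 := sqle _ f (or_introl erefl) f2 mf.
have fn2 := sqle _ f (or_intror erefl) f2 mf.
have gp2 := sqle _ g (or_introl erefl) g2 mg.
have gn2 := sqle _ g (or_intror erefl) g2 mg.
have Ipp := sqr_integrableM (mI T) (measurable_funTS mfp) (measurable_funTS mgp) fp2 gp2.
have Ipn := sqr_integrableM (mI T) (measurable_funTS mfp) (measurable_funTS mgn) fp2 gn2.
have Inp := sqr_integrableM (mI T) (measurable_funTS mfn) (measurable_funTS mgp) fn2 gp2.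
have Inn := sqr_integrableM (mI T) (measurable_funTS mfn) (measurable_funTS mgn) fn2 gn2.
have [Pp Epp] := product_nonneg_integrable i j mfp mgp (funrpos_ge0' f)
  (funrpos_ge0' g) ifp igp Ipp.
have [Pn Epn] := product_nonneg_integrable i j mfp mgn (funrpos_ge0' f)
  (funrneg_ge0' g) ifp ign Ipn.
have [Np Enp] := product_nonneg_integrable i j mfn mgp (funrneg_ge0' f)
  (funrpos_ge0' g) ifn igp Inp.
have [Nn Enn] := product_nonneg_integrable i j mfn mgn (funrneg_ge0' f)
  (funrneg_ge0' g) ifn ign Inn.
have mUU : measurable_fun setT (U i f \* U j g)%R.
  by apply: measurable_funM; exact: measurable_counter_integral.
have [iU ->] := ae_difference_product Pp Pn Np Nn mUU
  (U_posneg i mf fi) (U_posneg j mg gi).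
split; first exact: iU.
rewrite Epp Epn Enp Enn.
rewrite (J_posneg fi) (J_posneg gi).
have -> : J (f \* g)%R = (J (f^\+ \* g^\+) - J (f^\+ \* g^\-) -
    (J (f^\- \* g^\+) - J (f^\- \* g^\-)))%R.
  have I1 := integrableB (mI T) Ipp Ipn; have I2 := integrableB (mI T) Inp Inn.
  rewrite -!RintegralB//.
  apply: eq_Rintegral => s _ /=.
  have -> : f s = ((f^\+)%R s - (f^\-)%R s)%R by rewrite -[in LHS](funrposBneg f).
  have -> : g s = ((g^\+)%R s - (g^\-)%R s)%R by rewrite -[in LHS](funrposBneg g).
  by ring.
by ring.
Qed.
End ito_isometry.

Section expected_square.
Context {R : realType} d (Xi : measurableType d) (P : probability Xi R).
Context (k : nat) (N : 'I_k -> Xi -> cumulative R R) (T : R) (lambda : 'cV[R]_k).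
Hypothesis hN : independent_poisson_counters P N T lambda.
Hypothesis T0 : 0 <= T.
Local Notation mu := (@lebesgue_measure R).
Local Notation mR := (measurableTypeR R).
Local Notation rate j := (lambda j ord0).
Local Notation I0T := (`]0%R, T]%classic : set mR).
Local Notation U := (counter_integral N T).
Local Notation J f := (\int[mu]_(s in I0T) f s)%R.
Local Open Scope ereal_scope.

(** Squared mean plus variance. Distinct counters contribute to the double sum only through products
    of means, which rebuild the square; the diagonal adds the integrals of the squares. *)
Lemma expected_square (c : R) (f : 'I_k -> mR -> R) :
  (forall j, measurable_fun setT (f j)) ->
  (forall j, mu.-integrable I0T (fun s => (f j s ^+ 2)%:E)) ->
  \int[P]_xi ((c + \sum_j U j (f j) xi) ^+ 2)%:E =
  ((c + \sum_j rate j * J (f j)) ^+ 2 +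
   \sum_j rate j * J (fun s => f j s ^+ 2))%:E.
Proof.
move=> mf f2.
have mI : measurable I0T by exact: measurable_itv.
have muoo : mu I0T < +oo by rewrite /= lebesgue_measure_itv_oc// ltry.
have fi j := sqr_integrable_integrable mI muoo (measurable_funTS (mf j)) (f2 j).
have U1 j := counter_integral_mean hN T0 j (mf j) (fi j).
have U2 i j := counter_integral_product hN T0 i j (mf i) (mf j) (f2 i) (f2 j).
have I1 : P.-integrable setT (fun xi => \sum_j (U j (f j) xi)%:E).
  by apply: integrable_sum => //= j _; exact: (U1 j).1.
have I2 : P.-integrable setT
    (fun xi => \sum_i \sum_j (U i (f i) xi * U j (f j) xi)%:E).
  apply: integrable_sum => //= i _; apply: integrable_sum => //= j _.
  exact: (U2 i j).1.
have I0 : P.-integrable setT (cst (c ^+ 2)%:E).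
  exact: finite_measure_integrable_cst.
transitivity (\int[P]_xi ((cst (c ^+ 2)%:E xi +
   (c *+ 2)%:E * \sum_j (U j (f j) xi)%:E) +
   \sum_i \sum_j (U i (f i) xi * U j (f j) xi)%:E)).
  apply: eq_integral => xi _; under [X in _ + X]eq_bigr do rewrite sumEFin.
  rewrite !sumEFin -EFinM -!EFinD; congr EFin.
  rewrite sqrrD mulrnAl; congr (_ + _)%R.
  rewrite expr2 mulr_suml; apply: eq_bigr => i _.
  by rewrite mulr_sumr.
rewrite integralD//; last by apply: integrableD => //; exact: integrableZl.
rewrite integralD//; last exact: integrableZl.
rewrite integralZl// integral_sum//; last by move=> j; exact: (U1 j).1.
rewrite integral_sum//; last first.
  by move=> i; apply: integrable_sum => //= j _; exact: (U2 i j).1.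
rewrite [X in _ + X](_ : _ = (\sum_i \sum_j
    (rate i * rate j * (J (f i) * J (f j)) +
     (i == j)%:R * rate i * J (fun s => f i s * f j s)))%:E)%R; last first.
  rewrite -sumEFin; apply: eq_bigr => i _.
  rewrite integral_sum//; last by move=> j; exact: (U2 i j).1.
  rewrite -sumEFin; apply: eq_bigr => j _.
  rewrite -[LHS]fineK; last exact: (integrable_fin_num measurableT (U2 i j).1).
  by congr EFin; exact: (U2 i j).2.
rewrite (eq_bigr (fun j => (rate j * J (f j))%:E)); last by move=> j _; exact: (U1 j).2.
rewrite sumEFin integral_cst//= probability_setT mule1 -EFinM -!EFinD.
congr EFin; rewrite sqrrD mulrnAl -[RHS]addrA; congr (_ + _)%R.
under eq_bigr do rewrite big_split/=.
rewrite big_split/= expr2 mulr_suml; congr (_ + _)%R.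
  apply: eq_bigr => i _; rewrite mulr_sumr; apply: eq_bigr => j _; ring.
apply: eq_bigr => i _; rewrite (bigD1 i)//= eqxx mul1r big1 ?addr0.
  by congr (_ * _)%R; apply: eq_Rintegral => s _; rewrite expr2.
by move=> j ji; rewrite eq_sym (negbTE ji) !mul0r.
Qed.

End expected_square.

(** * Fubini on a triangle *)

Section triangle_fubini.
Context {R : realType}.
Local Notation mu := (@lebesgue_measure R).
Local Notation mR := (measurableTypeR R).
(** [nu] is later Lebesgue measure for the control term and the Stieltjes measure of a counter for
    the jump terms; the other variable is always integrated against Lebesgue measure. *)
Variable nu : {sigma_finite_measure set mR -> \bar R}.
Variables (t c : R) (q : R -> R -> R) (g : R -> R).
Hypotheses (c0 : 0 <= c) (t0 : 0 <= t).
Hypothesis mq : measurable_fun setT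
  (fun z : mR * mR => q z.1 z.2).
Hypothesis qg : forall r s, `|q r s| <= c * g s.
Hypothesis gi : nu.-integrable `]0, t]%classic (EFin \o g).

Let mq1 r : measurable_fun setT (q r : mR -> R).
Proof. exact: (measurableT_comp mq (measurable_pair1 r)). Qed.

Let mq2 s : measurable_fun setT (q ^~ s : mR -> R).
Proof. exact: (measurableT_comp mq (measurable_pair2 s)). Qed.

Let moc (a b : R) : measurable (`]a, b]%classic : set mR).
Proof. exact: measurable_itv. Qed.

Let mcc (a b : R) : measurable (`[a, b]%classic : set mR).
Proof. exact: measurable_itv. Qed.

(** The triangle is open at [s = 0], because the Stieltjes measure of a counter may charge the point
    0 while the jump integral starts just after it. *)
Let tri (z : mR * mR) : bool :=
  [&& 0 < z.2, z.2 <= z.1 & z.1 <= t].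

Let H (z : mR * mR) : R :=
  if tri z then q z.1 z.2 else 0.

Let mH : measurable_fun setT H.
Proof.
apply: measurable_fun_ifT => //.
apply: measurable_and.
  by apply: measurable_fun_ltr => //; exact: measurable_snd.
apply: measurable_and.
  by apply: measurable_fun_ler; [exact: measurable_snd|exact: measurable_fst].
by apply: measurable_fun_ler => //; exact: measurable_fst.
Qed.

Lemma section_integrable r : r <= t ->
  nu.-integrable `]0, r]%classic (EFin \o q r).
Proof.
move=> rt; have gr : nu.-integrable `]0, r]%classic (EFin \o (fun s => c * g s)).
  apply: (integrableS (moc 0 t)) => //.
    by move=> x /=; rewrite !in_itv/= => /andP[-> /le_trans->].
  by apply: eq_integrable (integrableZl (moc 0 t) c gi) => // x _; rewrite EFinM.
apply: (le_integrable_fin (moc 0 r) _ _ gr); first exact: measurable_funTS.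
by move=> s _; exact: qg.
Qed.

Let HE1 r : ((fun s => H (r, s)) = if 0 <= r <= t then (q r) \_ `]0, r]%classic else cst 0).
Proof.
apply/funext => s; rewrite /H /tri /=; have [rt|rt] := boolP (0 <= r <= t); case: ifPn => /=.
- move=> /and3P[s0 sr _]; rewrite patchE mem_set//=.
  by rewrite in_itv/= s0 sr.
- move=> h; rewrite patchE memNset//= in_itv/= => /andP[s0 sr].
  by move: h; rewrite s0 sr; case/andP: rt => _ ->.
- move=> /and3P[s0 sr rt']; move: rt; rewrite rt' andbT -ltNge => r0.
  by move: (lt_le_trans s0 sr); rewrite ltNge (ltW r0).
- by [].
Qed.

Let HE2 s : ((fun r => H (r, s)) = if 0 < s then (q ^~ s) \_ `[s, t]%classic else cst 0).
Proof.
apply/funext => r; rewrite /H /tri /=; have [s0|] := boolP (0 < s) => //=.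
by rewrite patchE mem_setE/= in_itv.
Qed.

Let inner1 r : (\int[nu]_s (H (r, s))%:E =
  ((fun r => (\int[nu]_(s in `]0%R, r]) q r s)%R%:E) \_ `[0%R, t]%classic) r)%E.
Proof.
rewrite patchE mem_setE/= in_itv/=.
have -> : (fun s => (H (r, s))%:E) = (EFin \o (fun s => H (r, s))) by [].
rewrite HE1; case: ifPn => [/andP[r0 rt]|_]; last by rewrite integral0.
rewrite /Rintegral fineK; last exact: integrable_fin_num (section_integrable rt).
by rewrite [RHS]integral_mkcond; apply: eq_integral => s _; rewrite /= restrict_EFin.
Qed.

Let qint s : 0 < s -> mu.-integrable `[s, t]%classic (EFin \o (q ^~ s)).
Proof.
move=> s0; apply: measurable_bounded_integrable => //.
- by rewrite /= lebesgue_measure_itv/=; case: ifP; rewrite ?ltry.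
- exact: measurable_funTS.
- exists (c * g s); split; first exact: num_real.
  by move=> x cx y _; exact: le_trans (qg _ _) (ltW cx).
Qed.

Let inner2 s : (\int[mu]_r (H (r, s))%:E =
  (if (0 < s)%R then (\int[mu]_(r in `[s, t]) q r s)%R%:E else 0))%E.
Proof.
have -> : (fun r => (H (r, s))%:E) = (EFin \o (fun r => H (r, s))) by [].
rewrite HE2; case: ifPn => s0; last by rewrite integral0.
rewrite /Rintegral fineK; last exact: integrable_fin_num (qint s0).
by rewrite [RHS]integral_mkcond; apply: eq_integral => r _; rewrite /= restrict_EFin.
Qed.

(** On the strip [0 <= r <= t] the integrand is dominated by [c * g s], and it vanishes off the
    strip; its inner integral is thus bounded uniformly in [r]. *)
Let iH : (mu \x nu)%E.-integrable setT (EFin \o H).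
Proof.
apply/integrable12ltyP; first exact/measurable_EFinP.
have bnd r : (\int[nu]_s `|(EFin \o H) (r, s)| <=
    ((cst (c%:E * \int[nu]_(s in `]0%R, t]) (g s)%:E)) \_ `[0%R, t]%classic) r)%E.
  rewrite patchE mem_setE/= in_itv/=; case: ifPn => [/andP[r0 rt]|rt]; last first.
    rewrite integral0_eq// => s _ /=.
    by rewrite -[H _]/((fun s => H (r, s)) s) HE1 (negbTE rt)/= normr0.
  have gr : nu.-integrable `]0, t]%classic (EFin \o (fun s => c * g s)).
    by apply: eq_integrable (integrableZl (moc 0 t) c gi) => // x _; rewrite EFinM.
  rewrite -integralZl// [leRHS]integral_mkcond; apply: ge0_le_integral => //.
  - have mHr : measurable_fun setT (fun s => H (r, s)).
      exact: (measurableT_comp mH (measurable_pair1 r)).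
    by apply/measurable_EFinP; exact: measurableT_comp mHr.
  - apply/(measurable_restrictT _ (moc 0 t)).
    by have := measurable_int nu gr; apply: eq_measurable_fun => x _; rewrite /= EFinM.
  - move=> s _; rewrite patchE mem_setE/= in_itv/= /H /tri/=.
    case: ifPn => [/and3P[-> sr _]|_]; last first.
      rewrite normr0; case: ifPn => // _; rewrite -EFinM lee_fin.
      by rewrite (le_trans _ (qg r s)).
    by rewrite (le_trans sr rt)/= -EFinM lee_fin qg.
apply: (@le_lt_trans _ _ (\int[mu]_r
    ((cst (c%:E * \int[nu]_(s in `]0%R, t]) (g s)%:E)) \_ `[0%R, t]%classic) r)%E).
  apply: ge0_le_integral => //.
  - by move=> r _; exact: integral_ge0.
  - apply: (measurable_fun_fubini_tonelli_F (abse \o (EFin \o H))) => //=.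
    by apply/measurable_EFinP; exact: measurableT_comp mH.
  - by apply/(measurable_restrictT _ (mcc 0 t)); exact: measurable_cst.
rewrite -integral_mkcond integral_cst//=.
rewrite (_ : c%:E * _ = (c * \int[nu]_(s in `]0%R, t]) g s)%R%:E)%E; last first.
  by rewrite EFinM /Rintegral fineK//; exact: integrable_fin_num gi.
rewrite lebesgue_measure_itv/=; case: ifP => _; first by rewrite -EFinM ltry.
by rewrite mule0.
Qed.

Lemma triangle_integrable :
  mu.-integrable `[0, t]%classic (fun r => (\int[nu]_(s in `]0, r]) q r s)%:E).
Proof.
apply/(integrable_mkcond _ (mcc 0 t)).
by apply: eq_integrable (integrable_fubini_F iH) => // r _; exact: inner1.
Qed.

Lemma triangle_fubini :
  \int[mu]_(r in `[0, t]) (\int[nu]_(s in `]0, r]) q r s) =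
  \int[nu]_(s in `]0, t]) (\int[mu]_(r in `[s, t]) q r s).
Proof.
rewrite /Rintegral; congr fine.
have := Fubini iH.
under [in LHS]eq_integral do rewrite inner1.
under [in RHS]eq_integral do rewrite inner2.
rewrite -integral_mkcond => ->.
rewrite [RHS]integral_mkcond; apply: eq_integral => s _.
rewrite patchE mem_setE/= in_itv/=; case: ifPn => //= s0; case: ifPn => // st.
by rewrite /Rintegral set_itv_ge ?integral_set0.
Qed.

End triangle_fubini.

(** * Matrix integrals *)

Section matrix_l1.
Context {R : realType}.

(** The entrywise l1 norm: submultiplicative, and such that measurability and integrability reduce
    at once to the entries. *)
Definition mxl1 (a b : nat) (M : 'M[R]_(a, b)) : R := \sum_i \sum_j `|M i j|.

Lemma mxl1_ge0 a b (M : 'M[R]_(a, b)) : 0 <= mxl1 M.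
Proof. by rewrite sumr_ge0// => i _; exact: sumr_ge0. Qed.

Lemma entry_le_mxl1 a b (M : 'M[R]_(a, b)) i j : `|M i j| <= mxl1 M.
Proof.
rewrite /mxl1 (bigD1 i)//= (bigD1 j)//= -addrA lerDl addr_ge0//.
  exact: sumr_ge0.
by rewrite sumr_ge0// => l _; exact: sumr_ge0.
Qed.

Lemma mxl1_eq0 a b (M : 'M[R]_(a, b)) : mxl1 M <= 0 -> M = 0.
Proof.
move=> M0; apply/matrixP => i j; rewrite mxE; apply/eqP.
by rewrite -normr_le0 (le_trans (entry_le_mxl1 _ _ _)).
Qed.

Lemma mxl1D a b (M M' : 'M[R]_(a, b)) : mxl1 (M + M') <= mxl1 M + mxl1 M'.
Proof.
rewrite /mxl1 -big_split/=; apply: ler_sum => i _.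
by rewrite -big_split/=; apply: ler_sum => j _; rewrite mxE ler_normD.
Qed.

Lemma mxl1N a b (M : 'M[R]_(a, b)) : mxl1 (- M) = mxl1 M.
Proof.
by apply: eq_bigr => i _; apply: eq_bigr => j _; rewrite mxE normrN.
Qed.

Lemma mxl1M a b c (M : 'M[R]_(a, b)) (M' : 'M[R]_(b, c)) :
  mxl1 (M *m M') <= mxl1 M * mxl1 M'.
Proof.
rewrite /mxl1 mulr_suml; apply: ler_sum => i _.
apply: (@le_trans _ _ (\sum_j \sum_l `|M i l| * `|M' l j|)).
  apply: ler_sum => j _; rewrite mxE (le_trans (ler_norm_sum _ _ _))//.
  by apply: ler_sum => l _; rewrite normrM.
rewrite exchange_big mulr_suml; apply: ler_sum => l _.
rewrite -mulr_sumr ler_wpM2l// (bigD1 l)//= lerDl.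
by rewrite sumr_ge0// => i' _; exact: sumr_ge0.
Qed.

Lemma measurable_mxl1 d (X : measurableType d) (D : set X) a b
    (F : X -> 'M[R]_(a, b)) : measurable D ->
  (forall i j, measurable_fun D (fun x => F x i j)) ->
  measurable_fun D (fun x => mxl1 (F x)).
Proof.
move=> mD mF; apply: measurable_sum => i; apply: measurable_sum => j.
exact: measurableT_comp.
Qed.

Lemma measurable_mulmx d (X : measurableType d) (D : set X) a b c
    (F : X -> 'M[R]_(a, b)) (F' : X -> 'M[R]_(b, c)) :
  (forall i j, measurable_fun D (fun x => F x i j)) ->
  (forall i j, measurable_fun D (fun x => F' x i j)) ->
  forall i j, measurable_fun D (fun x => (F x *m F' x) i j).
Proof.
move=> mF mF' i j.
under eq_fun do rewrite mxE.
by apply: measurable_sum => l; exact: measurable_funM.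
Qed.

End matrix_l1.

Section matrix_integrals.
Context d (X : measurableType d) (R : realType) (m : {measure set X -> \bar R}).
Variable D : set X.
Hypothesis mD : measurable D.
Local Notation int F := (mxintegral m D F).
Local Notation intble F := (mxintegrable m D F).

Lemma mxintegrable_measurable a b (F : X -> 'M[R]_(a, b)) : intble F ->
  forall i j, measurable_fun D (fun x => F x i j).
Proof.
by move=> iF i j; have := measurable_int m (iF i j); move/measurable_EFinP.
Qed.

Lemma eq_mxintegral a b (F F' : X -> 'M[R]_(a, b)) :
  (forall x, D x -> F x = F' x) -> int F = int F'.
Proof.
move=> FF'; apply/matrixP => i j; rewrite !mxE.
by apply: eq_Rintegral => x /set_mem Dx; rewrite FF'.
Qed.

Lemma eq_mxintegrable a b (F F' : X -> 'M[R]_(a, b)) :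
  (forall x, D x -> F x = F' x) -> intble F -> intble F'.
Proof.
move=> FF' iF i j; apply: eq_integrable (iF i j) => // x /set_mem Dx.
by rewrite FF'.
Qed.

Lemma mxintegrableD a b (F F' : X -> 'M[R]_(a, b)) : intble F -> intble F' ->
  intble (fun x => F x + F' x).
Proof.
move=> iF iF' i j; apply: eq_integrable (integrableD mD (iF i j) (iF' i j)) => //.
by move=> x _; rewrite mxE EFinD.
Qed.

Lemma mxintegralD a b (F F' : X -> 'M[R]_(a, b)) : intble F -> intble F' ->
  int (fun x => F x + F' x) = int F + int F'.
Proof.
move=> iF iF'; apply/matrixP => i j; rewrite !mxE -(RintegralD mD (iF i j) (iF' i j)).
by apply: eq_Rintegral => x _; rewrite mxE.
Qed.

Lemma mxintegrableN a b (F : X -> 'M[R]_(a, b)) : intble F ->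
  intble (fun x => - F x).
Proof.
move=> iF i j; apply: eq_integrable (integrableN (iF i j)) => // x _.
by rewrite mxE EFinN.
Qed.

Lemma mxintegralB a b (F F' : X -> 'M[R]_(a, b)) : intble F -> intble F' ->
  int (fun x => F x - F' x) = int F - int F'.
Proof.
move=> iF iF'; apply/matrixP => i j; rewrite !mxE -(RintegralB mD (iF i j) (iF' i j)).
by apply: eq_Rintegral => x _; rewrite !mxE.
Qed.

Lemma mxintegrableMr a b c (F : X -> 'M[R]_(a, b)) (M : 'M[R]_(b, c)) :
  intble F -> intble (fun x => F x *m M).
Proof.
move=> iF i j.
have : m.-integrable D (fun x => \sum_l (M l j)%:E * (F x i l)%:E)%E.
  by apply: integrable_sum => // l _; exact: integrableZl.
apply: eq_integrable => // x _; rewrite mxE -sumEFin.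
by apply: eq_bigr => l _; rewrite EFinM muleC.
Qed.

Lemma Rintegral_sum (I : Type) (s : seq I) (f : I -> X -> R) :
  (forall i, m.-integrable D (EFin \o f i)) ->
  \int[m]_(x in D) (\sum_(i <- s) f i x) =
  \sum_(i <- s) \int[m]_(x in D) f i x.
Proof.
move=> fi; rewrite /Rintegral.
under eq_integral do rewrite -sumEFin.
rewrite integral_sum//.
rewrite (eq_bigr (fun i => (fine (\int[m]_(x in D) (f i x)%:E))%:E)%E).
  by rewrite sumEFin.
by move=> i _; rewrite fineK//; exact: integrable_fin_num (fi i).
Qed.

Lemma mxintegralMl a b c (M : 'M[R]_(a, b)) (F : X -> 'M[R]_(b, c)) :
  intble F -> int (fun x => M *m F x) = M *m int F.
Proof.
move=> iF; apply/matrixP => i j; rewrite !mxE.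
under eq_Rintegral do rewrite mxE.
rewrite Rintegral_sum; last first.
  move=> l; apply: eq_integrable (integrableZl mD (M i l) (iF l j)) => // x _.
by apply: eq_bigr => l _; rewrite mxE (RintegralZl _ mD (iF l j)).
Qed.

Lemma mxintegralMr a b c (F : X -> 'M[R]_(a, b)) (M : 'M[R]_(b, c)) :
  intble F -> int (fun x => F x *m M) = int F *m M.
Proof.
move=> iF; apply/matrixP => i j; rewrite !mxE.
under eq_Rintegral do rewrite mxE.
rewrite Rintegral_sum; last first.
  move=> l; apply: eq_integrable (integrableZr mD (M l j) (iF i l)) => // x _.
by apply: eq_bigr => l _; rewrite mxE (RintegralZr _ mD (iF i l)).
Qed.

Lemma integrable_mxl1 a b (F : X -> 'M[R]_(a, b)) : intble F ->
  m.-integrable D (fun x => (mxl1 (F x))%:E).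
Proof.
move=> iF.
have : m.-integrable D (fun x => \sum_i \sum_j `|(F x i j)%:E|)%E.
  apply: integrable_sum => // i _; apply: integrable_sum => // j _.
  exact: integrable_abse (iF i j).
apply: eq_integrable => // x _; rewrite -sumEFin; apply: eq_bigr => i _.
by rewrite -sumEFin.
Qed.

Lemma mxl1_mxintegral a b (F : X -> 'M[R]_(a, b)) : intble F ->
  mxl1 (int F) <= \int[m]_(x in D) mxl1 (F x).
Proof.
move=> iF.
have iFn i j : m.-integrable D (EFin \o (fun x => `|F x i j|)).
  exact: integrable_abse (iF i j).
rewrite /mxl1 Rintegral_sum; last first.
  move=> i; have : m.-integrable D (fun x => \sum_j `|(F x i j)%:E|)%E.
    by apply: integrable_sum => // j _; exact: iFn.
  by apply: eq_integrable => // x _; rewrite /= -sumEFin.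
apply: ler_sum => i _; rewrite Rintegral_sum//; apply: ler_sum => j _.
by rewrite mxE; exact: (le_normr_Rintegral mD (iF i j)).
Qed.

Lemma mxintegrable_le a b (F : X -> 'M[R]_(a, b)) (h : X -> R) :
  (forall i j, measurable_fun D (fun x => F x i j)) ->
  (forall x, D x -> mxl1 (F x) <= h x) ->
  m.-integrable D (EFin \o h) -> intble F.
Proof.
move=> mF Fh hi i j; apply: (le_integrable_fin mD _ _ hi) => //.
by move=> x Dx; rewrite (le_trans (entry_le_mxl1 _ _ _)) ?Fh.
Qed.

Lemma mxintegrable_bounded_mul a b c (A : X -> 'M[R]_(a, b)) (K : R)
    (F : X -> 'M[R]_(b, c)) :
  (forall i j, measurable_fun D (fun x => A x i j)) ->
  (forall x, D x -> mxl1 (A x) <= K) -> intble F ->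
  intble (fun x => A x *m F x).
Proof.
move=> mA AK iF.
apply: (@mxintegrable_le _ _ _ (fun x => K * mxl1 (F x))).
- exact: measurable_mulmx mA (mxintegrable_measurable iF).
- move=> x Dx; rewrite (le_trans (mxl1M _ _))// ler_wpM2r ?mxl1_ge0//.
  exact: AK.
- by apply: eq_integrable (integrableZl mD K (integrable_mxl1 iF)) => // x _.
Qed.

End matrix_integrals.

Lemma mxintegrable_sub d (X : measurableType d) (R : realType)
    (m : {measure set X -> \bar R}) (p q : nat) (D E : set X)
    (F : X -> 'M[R]_(p, q)) :
  measurable D -> measurable E -> E `<=` D ->
  mxintegrable m D F -> mxintegrable m E F.
Proof. by move=> mD mE ED iF i j; exact: integrableS (iF i j). Qed.

(** * Linear differential equations *)

Section gronwall.
Context {R : realType}.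
Local Notation mu := (@lebesgue_measure R).
Local Notation mR := (measurableTypeR R).

Lemma is_derive_expR_affine (b e x : R) :
  is_derive x 1 (fun r : R => expR (b * r + e)) (b * expR (b * x + e)).
Proof.
have h : is_derive x 1 (fun r : R => b * r + e) b.
  by apply: is_derive_eq; rewrite addr0 /GRing.scale/= mulr1.
by apply: is_derive_eq (is_derive1_comp (is_derive_expR _) h) _; rewrite mulrC.
Qed.

Lemma continuous_expR_affine (b e : R) :
  continuous (fun r : R => expR (b * r + e)).
Proof.
move=> x; apply/differentiable_continuous/derivable1_diffP.
by case: (is_derive_expR_affine b e x).
Qed.

Lemma integrable_expR_affine (b e x y : R) :
  mu.-integrable `[x, y]%classic (EFin \o (fun r => expR (b * r + e))).
Proof.
apply: continuous_compact_integrable; first exact: segment_compact.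
by apply: continuous_subspaceT => z; exact: continuous_expR_affine.
Qed.

Lemma Rintegral_expR_affine (b e x y : R) : x <= y ->
  b * \int[mu]_(r in `[x, y]) expR (b * r + e) =
  expR (b * y + e) - expR (b * x + e).
Proof.
rewrite le_eqVlt => /predU1P[<-|xy].
  by rewrite set_itv1 Rintegral_set1 mulr0 subrr.
rewrite -RintegralZl//; last exact: integrable_expR_affine.
rewrite /Rintegral (continuous_FTC2 (F := fun r => expR (b * r + e)) xy)//.
- apply: continuous_subspaceT => z.
  by apply: cvgM; [exact: cvg_cst|exact: continuous_expR_affine].
- split=> [z _| |].
  + by case: (is_derive_expR_affine b e z).
  + exact/cvg_at_right_filter/continuous_expR_affine.
  + exact/cvg_at_left_filter/continuous_expR_affine.
- move=> z _; rewrite derive1E.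
  by case: (is_derive_expR_affine b e z).
Qed.

(* The weight [w] plays the role of an exponential: the supremum [M] of [y / w] on
   [S] satisfies [M <= c + M / 2]. *)
Lemma gronwall (S : set R) (I_ : R -> set R) (w y : R -> R) (a c : R) :
  0 <= a -> 0 <= c ->
  (forall t, S t -> measurable (I_ t : set mR) /\ I_ t `<=` S) ->
  (forall t, S t -> mu.-integrable (I_ t) (EFin \o y)) ->
  (forall t, S t -> mu.-integrable (I_ t) (EFin \o w)) ->
  (exists Mb, forall t, S t -> y t <= Mb) ->
  (forall t, S t -> 0 <= y t) -> (forall t, S t -> 1 <= w t) ->
  (forall t, S t -> a * \int[mu]_(r in I_ t) w r <= w t / 2) ->
  (forall t, S t -> y t <= c + a * \int[mu]_(r in I_ t) y r) ->
  forall t, S t -> y t <= 2 * c * w t.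
Proof.
move=> a0 c0 IS yi wi [Mb yMb] y0 w1 aw ya t St.
have w0 r : S r -> 0 < w r by move=> Sr; rewrite (lt_le_trans _ (w1 _ Sr)).
pose E := [set y r / w r | r in S].
have supE : has_sup E.
  split; first by exists (y t / w t), t.
  exists Mb => _ [r Sr <-]; rewrite ler_pdivrMr ?w0//.
  rewrite (le_trans (yMb _ Sr))// ler_peMr ?w1//.
  exact: le_trans (y0 _ Sr) (yMb _ Sr).
pose M := sup E.
have yM r : S r -> y r <= M * w r.
  move=> Sr; rewrite -ler_pdivrMr ?w0//.
  by apply: sup_upper_bound => //; exists r.
have M2c : M <= c + M / 2.
  apply: ge_sup; first by case: supE.
  move=> _ [r Sr <-]; rewrite ler_pdivrMr ?w0//.
  rewrite (le_trans (ya _ Sr))// mulrDl lerD//.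
    by rewrite ler_peMr// w1.
  have [mI sI] := IS _ Sr.
  apply: (@le_trans _ _ (a * (M * \int[mu]_(x in I_ r) w x))).
    rewrite ler_wpM2l// -RintegralZl//; last exact: wi.
    apply: le_Rintegral => //; first exact: yi.
    - by apply: eq_integrable (integrableZl mI M (wi _ Sr)) => // x _; rewrite /= EFinM.
    - by move=> x Ix; apply/yM/sI.
  have M0 : 0 <= M.
    apply: (@le_trans _ _ (y t / w t)).
      by rewrite divr_ge0 ?y0// ltW// w0.
    by apply: (sup_upper_bound supE); exists t.
  rewrite mulrCA -mulrA (mulrC _ (w r)); exact: ler_wpM2l (aw _ Sr).
apply: (le_trans (yM _ St)); apply: ler_wpM2r; first exact/ltW/w0.
by move: M2c; lra.
Qed.

End gronwall.

Section linear_ode.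
Context {R : realType}.
Local Notation mu := (@lebesgue_measure R).
Local Notation mR := (measurableTypeR R).
Variables (T a : R) (n : nat) (A : R -> 'M[R]_n).
Hypotheses (T0 : 0 <= T) (a0 : 0 <= a).
Hypothesis mA : forall i j, measurable_fun setT (fun t : mR => A t i j).
Hypothesis Aa : forall t, mxl1 (A t) <= a.

Let mcc (x y : R) : measurable (`[x, y]%classic : set mR).
Proof. exact: measurable_itv. Qed.

Lemma mxintegral_point (p q : nat) (x y : R) (F : R -> 'M[R]_(p, q)) : y <= x ->
  mxintegral mu `[x, y]%classic F = 0.
Proof.
move=> yx; apply/matrixP => i j; rewrite !mxE.
move: yx; rewrite le_eqVlt => /predU1P[->|yx].
  by rewrite set_itv1 Rintegral_set1.
by rewrite set_itv_ge ?Rintegral_set0// bnd_simp -ltNge.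
Qed.

Lemma oriented_integral_le (p q : nat) (s t : R) (F : R -> 'M[R]_(p, q)) :
  s <= t -> oriented_integral s t F = mxintegral mu `[s, t]%classic F.
Proof. by move=> st; rewrite /oriented_integral (mxintegral_point _ st) subr0. Qed.

Lemma oriented_integral_ge (p q : nat) (s t : R) (F : R -> 'M[R]_(p, q)) :
  t <= s -> oriented_integral s t F = - mxintegral mu `[t, s]%classic F.
Proof.
by move=> st; rewrite /oriented_integral (mxintegral_point _ st) sub0r.
Qed.

(** The initial time [s] may lie anywhere in [[0, T]], whence the oriented integral. Integrability
    is part of the notion because the integral of a non-integrable function is only a default
    value. *)
Definition ode_solution (p : nat) (s : R) (C : 'M[R]_(n, p))
    (Y : R -> 'M[R]_(n, p)) :=
  mxintegrable mu `[0, T]%classic Y /\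
  forall t, 0 <= t <= T -> Y t = C + oriented_integral s t (fun r => A r *m Y r).

Lemma sub_cc (x y : R) : 0 <= x -> y <= T ->
  `[x, y]%classic `<=` (`[0, T]%classic : set R).
Proof.
move=> x0 yT z /=; rewrite !in_itv/= => /andP[xz zy].
by rewrite (le_trans x0 xz) (le_trans zy yT).
Qed.

Lemma mxintegrable_AM (p : nat) (Y : R -> 'M[R]_(n, p)) (D : set mR) :
  measurable D ->
  mxintegrable mu D Y -> mxintegrable mu D (fun r => A r *m Y r).
Proof.
move=> mD; apply: (mxintegrable_bounded_mul mD (K := a)) => //.
by move=> i j; exact: measurable_funTS.
Qed.

Let le_integral_AM (p : nat) (Y : R -> 'M[R]_(n, p)) x y : 0 <= x -> y <= T ->
  mxintegrable mu `[0, T]%classic Y ->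
  mxl1 (mxintegral mu `[x, y]%classic (fun r => A r *m Y r)) <=
  a * \int[mu]_(r in `[x, y]) mxl1 (Y r).
Proof.
move=> x0 yT iY.
have iYxy : mxintegrable mu `[x, y]%classic Y.
  by apply: (mxintegrable_sub _ _ _ iY) => //; exact: sub_cc.
rewrite (le_trans (mxl1_mxintegral _ (mxintegrable_AM _ iYxy)))//.
rewrite -RintegralZl//; last exact: integrable_mxl1.
apply: le_Rintegral => //.
- exact/integrable_mxl1/mxintegrable_AM.
- apply: eq_integrable (integrableZl (mcc x y) a (integrable_mxl1 (mcc x y) iYxy)) => //.
- by move=> r _; rewrite (le_trans (mxl1M _ _))// ler_wpM2r ?mxl1_ge0.
Qed.

(** Gronwall with the weight [exp (2 a |r - s|)]: [a] times its integral between [s] and [r] is at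
    most half its value at [r]. This is the origin of both factors 2. It is applied forward on
    [[s, T]] and backward on [[0, s]]. *)
Lemma ode_bound (p : nat) (s : R) (C : 'M[R]_(n, p)) (Y : R -> 'M[R]_(n, p)) :
  0 <= s <= T -> ode_solution s C Y ->
  forall t, 0 <= t <= T -> mxl1 (Y t) <= 2 * mxl1 C * expR (2 * a * T).
Proof.
move=> /andP[s0 sT] [iY YE] t /andP[t0 tT].
pose y r := mxl1 (Y r).
have yi x z : 0 <= x -> z <= T -> mu.-integrable `[x, z]%classic (EFin \o y).
  move=> x0 zT; apply: integrable_mxl1 => //.
  by apply: (mxintegrable_sub _ _ _ iY) => //; exact: sub_cc.
have ybnd x z : 0 <= x -> z <= T ->
    mxl1 (C + mxintegral mu `[x, z]%classic (fun r => A r *m Y r)) <=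
    mxl1 C + a * \int[mu]_(r in `[x, z]) y r /\
    mxl1 (C - mxintegral mu `[x, z]%classic (fun r => A r *m Y r)) <=
    mxl1 C + a * \int[mu]_(r in `[x, z]) y r.
  move=> x0 zT; split.
    by rewrite (le_trans (mxl1D _ _))// lerD2l le_integral_AM.
  by rewrite (le_trans (mxl1D _ _))// lerD2l mxl1N le_integral_AM.
have ymax x z : 0 <= x -> z <= T ->
    \int[mu]_(r in `[x, z]) y r <= \int[mu]_(r in `[0, T]) y r.
  move=> x0 zT; rewrite /Rintegral fine_le//.
  - exact: (integrable_fin_num _ (yi _ _ x0 zT)).
  - exact: (integrable_fin_num _ (yi _ _ (lexx 0) (lexx T))).
  - apply: ge0_subset_integral => //; last exact: sub_cc.
    + exact: measurable_int (yi _ _ (lexx 0) (lexx T)).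
    + by move=> r _; rewrite lee_fin mxl1_ge0.
have expT b : b <= T -> expR (2 * a * b) <= expR (2 * a * T).
  by move=> bT; rewrite ler_expR ler_wpM2l// mulr_ge0.
have [st|/ltW ts] := leP s t.
- pose w r : R := expR (2 * a * r + - (2 * a * s)).
  have := @gronwall R `[s, T]%classic (fun t => `[s, t]%classic) w y a (mxl1 C)
    a0 (mxl1_ge0 C).
  move=> /(_ _ _ _ _ _ _ _ _ t) H.
  apply: (@le_trans _ _ (2 * mxl1 C * w t)); last first.
    rewrite ler_wpM2l ?mulr_ge0 ?mxl1_ge0// /w -mulrBr expT//.
    by rewrite lerBlDr (le_trans tT)// lerDl.
  apply: H.
  + move=> r /=; rewrite in_itv/= => /andP[sr rT]; split; first exact: mcc.
    by move=> z /=; rewrite !in_itv/= => /andP[-> /le_trans->].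
  + by move=> r /=; rewrite in_itv/= => /andP[sr rT]; exact: yi.
  + by move=> r _; exact: integrable_expR_affine.
  (* The a priori bound that Gronwall needs comes from the equation itself, since [y] is integrable
     on [[0, T]]. *)
  + exists (mxl1 C + a * \int[mu]_(r in `[0, T]) y r) => r /=.
    rewrite in_itv/= => /andP[sr rT]; rewrite /y YE ?rT ?(le_trans s0)//.
    rewrite oriented_integral_le// (le_trans (ybnd _ _ s0 rT).1)//.
    by rewrite lerD2l ler_wpM2l// ymax.
  + by move=> r _; exact: mxl1_ge0.
  + move=> r /=; rewrite in_itv/= => /andP[sr rT].
    rewrite /w -mulrBr -expR0 ler_expR.
    by rewrite mulr_ge0 ?mulr_ge0// subr_ge0.
  + move=> r /=; rewrite in_itv/= => /andP[sr rT].
    have := Rintegral_expR_affine (2 * a) (- (2 * a * s)) sr.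
    rewrite subrr expR0 /w => h; rewrite ler_pdivlMr// mulrC mulrA h.
    by rewrite lerBlDr lerDl.
  + move=> r /=; rewrite in_itv/= => /andP[sr rT].
    rewrite /y YE ?rT ?(le_trans s0)// oriented_integral_le//.
    exact: (ybnd _ _ s0 rT).1.
  + by rewrite /= in_itv/= st.
- pose w r : R := expR (- (2 * a) * r + (2 * a * s)).
  have wE r : w r = expR (2 * a * (s - r)) by rewrite /w; congr expR; ring.
  have := @gronwall R `[0, s]%classic (fun t => `[t, s]%classic) w y a (mxl1 C)
    a0 (mxl1_ge0 C).
  move=> /(_ _ _ _ _ _ _ _ _ t) H.
  apply: (@le_trans _ _ (2 * mxl1 C * w t)); last first.
    rewrite ler_wpM2l ?mulr_ge0 ?mxl1_ge0// wE expT//.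
    by rewrite lerBlDr (le_trans sT)// lerDl.
  apply: H.
  + move=> r /=; rewrite in_itv/= => /andP[r0 rs]; split; first exact: mcc.
    by move=> z /=; rewrite !in_itv/= => /andP[/(le_trans r0) -> ->].
  + by move=> r /=; rewrite in_itv/= => /andP[r0 rs]; exact: yi.
  + by move=> r _; exact: integrable_expR_affine.
  + exists (mxl1 C + a * \int[mu]_(r in `[0, T]) y r) => r /=.
    rewrite in_itv/= => /andP[r0 rs]; rewrite /y YE ?r0 ?(le_trans rs)//.
    rewrite oriented_integral_ge// (le_trans (ybnd _ _ r0 sT).2)//.
    by rewrite lerD2l ler_wpM2l// ymax.
  + by move=> r _; exact: mxl1_ge0.
  + move=> r /=; rewrite in_itv/= => /andP[r0 rs].
    by rewrite wE -expR0 ler_expR mulr_ge0 ?mulr_ge0// subr_ge0.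
  + move=> r /=; rewrite in_itv/= => /andP[r0 rs].
    have := Rintegral_expR_affine (- (2 * a)) (2 * a * s) rs.
    rewrite mulNr mulNr addNr expR0 -/w => /eqP; rewrite eqr_oppLR opprB => /eqP h.
    rewrite ler_pdivlMr// mulrC mulrA h /w mulNr.
    by rewrite lerBlDr lerDl.
  + move=> r /=; rewrite in_itv/= => /andP[r0 rs].
    rewrite /y YE ?r0 ?(le_trans rs)// oriented_integral_ge//.
    exact: (ybnd _ _ r0 sT).2.
  + by rewrite /= in_itv/= t0.
Qed.

Lemma ode_unique (p : nat) (s : R) (Y : R -> 'M[R]_(n, p)) :
  0 <= s <= T -> ode_solution s 0 Y -> forall t, 0 <= t <= T -> Y t = 0.
Proof.
move=> sT Ysol t tT; apply: mxl1_eq0.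
rewrite (le_trans (ode_bound sT Ysol tT))//.
rewrite (_ : mxl1 0 = 0) ?mulr0 ?mul0r//.
by rewrite /mxl1 big1// => i _; rewrite big1// => j _; rewrite mxE normr0.
Qed.

End linear_ode.

(** * Transition matrices and variation of constants *)

Section fundamental_matrix.
Context {R : realType}.
Local Notation mu := (@lebesgue_measure R).
Local Notation mR := (measurableTypeR R).
Variables (T a b : R) (n : nat) (A : R -> 'M[R]_n) (Phi : R -> R -> 'M[R]_n).
Hypotheses (T0 : 0 <= T) (a0 : 0 <= a).
Hypothesis mA : forall i j, measurable_fun setT (fun t : mR => A t i j).
Hypothesis Aa : forall t, mxl1 (A t) <= a.
Hypothesis mPhi : forall i j, measurable_fun setT
  (fun z : mR * mR => Phi z.1 z.2 i j).
Hypothesis Phib : forall t s, mxl1 (Phi t s) <= b.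
Hypothesis hPhi : forall s, 0 <= s <= T -> ode_solution T A s 1%:M (Phi ^~ s).

Let mcc (x y : R) : measurable (`[x, y]%classic : set mR).
Proof. exact: measurable_itv. Qed.

Let moc (x y : R) : measurable (`]x, y]%classic : set mR).
Proof. exact: measurable_itv. Qed.

Let b0 : 0 <= b. Proof. exact: le_trans (mxl1_ge0 _) (Phib 0 0). Qed.

Let T0T : (0 : R) <= 0 <= T. Proof. by rewrite lexx T0. Qed.

Lemma oriented_integral_diff (p q : nat) (s t : R) (F : R -> 'M[R]_(p, q)) :
  0 <= s <= T -> 0 <= t <= T -> mxintegrable mu `[0, T]%classic F ->
  oriented_integral s t F =
  mxintegral mu `[0, t]%classic F - mxintegral mu `[0, s]%classic F.
Proof.
have H (x y : R) : 0 <= x -> x <= y -> y <= T -> mxintegrable mu `[0, T]%classic F ->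
    mxintegral mu `[0, y]%classic F - mxintegral mu `[0, x]%classic F =
    mxintegral mu `[x, y]%classic F.
  move=> x0 xy yT iF; apply/matrixP => i j; rewrite !mxE.
  have iF0y : mu.-integrable `[0, y]%classic (EFin \o (fun r => F r i j)).
    by apply: integrableS (iF i j) => //; exact: sub_cc.
  rewrite Rintegral_itvB ?bnd_simp//.
  rewrite Rintegral_itv_obnd_cbnd//.
  apply: integrableS iF0y => // z /=; rewrite !in_itv/= => /andP[xz ->].
  by rewrite (le_trans x0 (ltW xz)).
move=> /andP[s0 sT] /andP[t0 tT] iF; have [st|/ltW ts] := leP s t.
  by rewrite oriented_integral_le// H.
by rewrite oriented_integral_ge// -opprB H.
Qed.

Lemma Phi_diag s : 0 <= s <= T -> Phi s s = 1%:M.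
Proof.
move=> sT; have [_ ->//] := hPhi sT.
by rewrite oriented_integral_le// mxintegral_point// addr0.
Qed.

Let iAPhi s : 0 <= s <= T -> mxintegrable mu `[0, T]%classic (fun r => A r *m Phi r s).
Proof. by move=> /hPhi[iP _]; exact: mxintegrable_AM iP. Qed.

(** As functions of [t], both sides solve the same linear equation and take the value [Phi 0 s] at
    time 0, so their difference vanishes by uniqueness. Composition through time 0 is all that
    pulling states back requires. *)
Lemma Phi_split s t : 0 <= s <= T -> 0 <= t <= T -> Phi t s = Phi t 0 *m Phi 0 s.
Proof.
move=> sT tT; apply/eqP; rewrite -subr_eq0; apply/eqP.
pose D r := Phi r s - Phi r 0 *m Phi 0 s.
have [iPs Ps] := hPhi sT; have [iP0 P0] := hPhi T0T.
have iM : mxintegrable mu `[0, T]%classic (fun r => Phi r 0 *m Phi 0 s).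
  exact: mxintegrableMr.
suff : ode_solution T A 0 0 D by move=> /(ode_unique a0 mA Aa T0T); apply.
split.
  by apply: eq_mxintegrable (mxintegrableD (mcc 0 T) iPs (mxintegrableN (mcc 0 T) iM)) => //.
move=> {}t {}tT; rewrite add0r.
have [t0 tT'] := andP tT.
have sub : `[0, t]%classic `<=` (`[0, T]%classic : set R) by exact: sub_cc.
have iAPs : mxintegrable mu `[0, t]%classic (fun r => A r *m Phi r s).
  exact: mxintegrable_sub (mcc 0 T) (mcc 0 t) sub (iAPhi sT).
have iAP0 : mxintegrable mu `[0, t]%classic (fun r => A r *m Phi r 0).
  exact: mxintegrable_sub (mcc 0 T) (mcc 0 t) sub (iAPhi T0T).
rewrite oriented_integral_le// /D.
rewrite (eq_mxintegral mu (F' := fun r => A r *m Phi r s - (A r *m Phi r 0) *m Phi 0 s)); last first.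
  by move=> r _; rewrite mulmxBr mulmxA.
rewrite mxintegralB//; last exact: mxintegrableMr.
rewrite mxintegralMr// Ps// [Phi t 0]P0// [Phi 0 s]Ps//.
rewrite (oriented_integral_le _ t0) (oriented_integral_diff sT tT (iAPhi sT)).
rewrite (oriented_integral_diff sT T0T (iAPhi sT)) [mxintegral mu `[0, 0] _]mxintegral_point//.
rewrite sub0r mulmxDl mul1mx.
set X := mxintegral _ _ _; set Y := mxintegral _ _ _; set Z := _ *m _.
rewrite opprD addrA; congr (_ - _).
by rewrite opprB (addrC 1%:M) -addrA (addrC 1%:M (_ - _)) !subrK.
Qed.

Lemma Phi_invr s : 0 <= s <= T -> Phi s 0 *m Phi 0 s = 1%:M.
Proof. by move=> sT; rewrite -Phi_split// Phi_diag. Qed.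

Lemma Phi_invl s : 0 <= s <= T -> Phi 0 s *m Phi s 0 = 1%:M.
Proof. by move=> sT; apply: mulmx1C; exact: Phi_invr. Qed.

Section duhamel.
Variable nu : {sigma_finite_measure set mR -> \bar R}.
Variable g : R -> 'cV[R]_n.
Hypothesis mg : forall i j, measurable_fun setT (fun t : mR => g t i j).
Hypothesis ig : mxintegrable nu `]0, T]%classic g.

(** The variation of constants term of a forcing [g] with respect to [nu]. With [nu] general and the
    interval open at 0, one definition serves the drift and every counter. *)
Definition duhamel (t : R) : 'cV[R]_n :=
  mxintegral nu `]0, t]%classic (fun s => Phi t s *m g s).

Let mPhi1 t i j : measurable_fun setT (fun s : mR => Phi t s i j).
Proof. exact: (measurableT_comp (mPhi i j) (measurable_pair1 t)). Qed.

Let ig_sub t : t <= T -> mxintegrable nu `]0, t]%classic g.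
Proof.
move=> tT; apply: (mxintegrable_sub _ _ _ ig) => // x /=; rewrite !in_itv/=.
by move=> /andP[-> /le_trans->].
Qed.

Lemma mxintegrable_Phi t : t <= T ->
  mxintegrable nu `]0, t]%classic (fun s => Phi t s *m g s).
Proof.
move=> tT; apply: (mxintegrable_bounded_mul (moc 0 t) (K := b)) => //.
- by move=> i j; exact: measurable_funTS.
- exact: ig_sub.
Qed.

Let mPhig (i : 'I_n) : measurable_fun setT (fun z : mR * mR =>
  (Phi z.1 z.2 *m g z.2) i ord0).
Proof.
apply: (measurable_mulmx (F := fun z : mR * mR => Phi z.1 z.2)
  (F' := fun z : mR * mR => g z.2)) => // l j.
exact: (measurableT_comp (mg l j) measurable_snd).
Qed.

Lemma duhamel_integrable t : 0 <= t <= T -> mxintegrable mu `[0, t]%classic duhamel.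
Proof.
move=> /andP[t0 tT] i j; rewrite [j]ord1.
have bnd r s : `|(Phi r s *m g s) i ord0| <= b * mxl1 (g s).
  rewrite (le_trans (entry_le_mxl1 _ _ _))// (le_trans (mxl1M _ _))//.
  by rewrite ler_wpM2r ?mxl1_ge0.
have := triangle_integrable (q := fun r s => (Phi r s *m g s) i ord0) (mPhig i) bnd
  (integrable_mxl1 (moc 0 t) (ig_sub tT)).
by apply: eq_integrable => // r _; rewrite /duhamel mxE.
Qed.

(** Exchanging the integrals over the triangle leaves, for each [s], the integral of
    [A r *m Phi r s] over [[s, t]], which is [Phi t s - 1] by the equation of the transition
    matrix. *)
Lemma duhamel_eq t : 0 <= t <= T ->
  duhamel t = mxintegral mu `[0, t]%classic (fun r => A r *m duhamel r)
    + mxintegral nu `]0, t]%classic g.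
Proof.
move=> /andP[t0 tT]; apply/matrixP => i j; rewrite [j]ord1 {j}.
pose q r s := (A r *m (Phi r s *m g s)) i ord0.
have mq : measurable_fun setT (fun z : mR * mR => q z.1 z.2).
  apply: (measurable_mulmx (F := fun z : mR * mR => A z.1)
    (F' := fun z : mR * mR => Phi z.1 z.2 *m g z.2)).
    by move=> l j; exact: (measurableT_comp (mA l j) measurable_fst).
  by move=> l j; rewrite [j]ord1; exact: mPhig.
have qg r s : `|q r s| <= (a * b) * mxl1 (g s).
  rewrite (le_trans (entry_le_mxl1 _ _ _))// (le_trans (mxl1M _ _))//.
  rewrite -mulrA ler_pM ?mxl1_ge0// (le_trans (mxl1M _ _))//.
  by rewrite ler_wpM2r ?mxl1_ge0.
have := triangle_fubini mq qg (integrable_mxl1 (moc 0 t) (ig_sub tT)).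
rewrite (_ : \int[mu]_(r in _) _ =
    (mxintegral mu `[0, t]%classic (fun r => A r *m duhamel r)) i ord0); last first.
  rewrite mxE; apply: eq_Rintegral => r /set_mem/=; rewrite in_itv/= => /andP[r0 rt].
  have irt := mxintegrable_Phi (le_trans rt tT).
  by rewrite /duhamel -mxintegralMl// mxE.
rewrite (_ : \int[nu]_(s in _) _ =
    (mxintegral nu `]0, t]%classic (fun s => Phi t s *m g s - g s)) i ord0); last first.
  rewrite mxE; apply: eq_Rintegral => s /set_mem/=; rewrite in_itv/= => /andP[s0 st].
  have sT : 0 <= s <= T by rewrite ltW// (le_trans st).
  have tT' : 0 <= t <= T by rewrite t0.
  have [iPs Ps] := hPhi sT.
  have : Phi t s - 1%:M = mxintegral mu `[s, t]%classic (fun r => A r *m Phi r s).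
    by rewrite Ps// oriented_integral_le// addrC addKr.
  have iAs : mxintegrable mu `[s, t]%classic (fun r => A r *m Phi r s).
    apply: (mxintegrable_sub _ _ _ (iAPhi sT)) => //.
    by apply: sub_cc => //; exact: ltW.
  move=> E; rewrite -[X in _ - X]mul1mx -mulmxBl E -mxintegralMr// mxE.
  by apply: eq_Rintegral => r _; rewrite /q mulmxA.
move=> E; rewrite [RHS]mxE E mxintegralB ?mxE ?subrK//.
- exact: mxintegrable_Phi.
- exact: ig_sub.
Qed.

End duhamel.
End fundamental_matrix.

Section linear_jump_equation.
Context {R : realType}.
Local Notation mu := (@lebesgue_measure R).
Local Notation mR := (measurableTypeR R).
Variables (T a b : R) (n k : nat) (A : R -> 'M[R]_n) (Phi : R -> R -> 'M[R]_n).
Hypotheses (T0 : 0 <= T) (a0 : 0 <= a).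
Hypothesis mA : forall i j, measurable_fun setT (fun t : mR => A t i j).
Hypothesis Aa : forall t, mxl1 (A t) <= a.
Hypothesis mPhi : forall i j, measurable_fun setT
  (fun z : mR * mR => Phi z.1 z.2 i j).
Hypothesis Phib : forall t s, mxl1 (Phi t s) <= b.
Hypothesis hPhi : forall s, 0 <= s <= T -> ode_solution T A s 1%:M (Phi ^~ s).
Variable nu : 'I_k -> {sigma_finite_measure set mR -> \bar R}.
Variables (x0 : 'cV[R]_n) (f : R -> 'cV[R]_n) (G : R -> 'M[R]_(n, k)).
Hypothesis mf : forall i j, measurable_fun setT (fun t : mR => f t i j).
Hypothesis mG : forall i j, measurable_fun setT (fun t : mR => G t i j).
Hypothesis fi : mxintegrable mu `[0, T]%classic f.
Hypothesis Gi : forall j, mxintegrable (nu j) `]0, T]%classic (fun s => col j (G s)).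

Let mcc (x y : R) : measurable (`[x, y]%classic : set mR).
Proof. exact: measurable_itv. Qed.

Let moc (x y : R) : measurable (`]x, y]%classic : set mR).
Proof. exact: measurable_itv. Qed.

Definition jump_solution (t : R) : 'cV[R]_n :=
  Phi t 0 *m x0 + duhamel Phi mu f t
  + \sum_j duhamel Phi (nu j) (fun s => col j (G s)) t.

(** The state equation for a fixed [beta] and a fixed path, as a deterministic equation driven by
    the measures [nu j]. The horizon [tau] is separate from [T] because steering may stop
    earlier. *)
Definition jump_equation (tau : R) (X : R -> 'cV[R]_n) : Prop :=
  mxintegrable mu `[0, tau]%classic X /\
  forall t, 0 <= t <= tau ->
    X t = x0 + mxintegral mu `[0, t]%classic (fun s => A s *m X s + f s)
      + \sum_j mxintegral (nu j) `]0, t]%classic (fun s => col j (G s)).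

Let mGcol j i l : measurable_fun setT (fun t : mR => col j (G t) i l).
Proof. by under eq_fun do rewrite mxE; exact: mG. Qed.

Let sub_oc_cc (t : R) : `]0, t]%classic `<=` (`[0, t]%classic : set R).
Proof. by move=> x /=; rewrite !in_itv/= => /andP[/ltW -> ->]. Qed.

Let fi' : mxintegrable mu `]0, T]%classic f.
Proof. by apply: (mxintegrable_sub _ _ _ fi) => //; exact: sub_oc_cc. Qed.

Let sub_0 (t : R) : t <= T -> `[0, t]%classic `<=` (`[0, T]%classic : set R).
Proof. by move=> tT; exact: sub_cc. Qed.

Lemma mxintegral_oc_cc (p q : nat) (F : R -> 'M[R]_(p, q)) (t : R) :
  mxintegrable mu `[0, t]%classic F ->
  mxintegral mu `]0, t]%classic F = mxintegral mu `[0, t]%classic F.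
Proof.
move=> iF; apply/matrixP => i j; rewrite !mxE Rintegral_itv_obnd_cbnd//.
by apply: integrableS (iF i j) => //; exact: sub_oc_cc.
Qed.

Let mxintegrable_sum (p q : nat) (D : set mR) (I : finType)
    (F : I -> R -> 'M[R]_(p, q)) : measurable D ->
  (forall i, mxintegrable mu D (F i)) ->
  mxintegrable mu D (fun s => \sum_i F i s).
Proof.
move=> mD iF r c.
have : mu.-integrable D (fun x => \sum_i (F i x r c)%:E)%E.
  by apply: integrable_sum => // i _; exact: iF.
by apply: eq_integrable => // x _; rewrite summxE sumEFin.
Qed.

Let mxintegral_sum (p q : nat) (D : set mR) (I : finType)
    (F : I -> R -> 'M[R]_(p, q)) : measurable D ->
  (forall i, mxintegrable mu D (F i)) ->
  mxintegral mu D (fun s => \sum_i F i s) = \sum_i mxintegral mu D (F i).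
Proof.
move=> mD iF; apply/matrixP => r c; rewrite summxE mxE.
under eq_Rintegral do rewrite summxE.
rewrite Rintegral_sum//; first by apply: eq_bigr => i _; rewrite mxE.
by move=> i; exact: iF.
Qed.

Let T0T : (0 : R) <= 0 <= T. Proof. by rewrite lexx T0. Qed.

Let iP t : 0 <= t <= T -> mxintegrable mu `[0, t]%classic (fun r => Phi r 0 *m x0).
Proof.
move=> /andP[t0 tT]; apply: mxintegrableMr => //.
by have [iP _] := hPhi T0T; apply: (mxintegrable_sub _ _ _ iP) => //; exact: sub_0.
Qed.

Let iVf t : 0 <= t <= T -> mxintegrable mu `[0, t]%classic (duhamel Phi mu f).
Proof. by move=> tT; apply: (duhamel_integrable mPhi Phib mf fi'). Qed.

Let iVG t j : 0 <= t <= T ->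
  mxintegrable mu `[0, t]%classic (duhamel Phi (nu j) (fun s => col j (G s))).
Proof.
by move=> tT; apply: (duhamel_integrable mPhi Phib (mGcol j) (Gi j)).
Qed.

Lemma jump_solution_integrable t : 0 <= t <= T ->
  mxintegrable mu `[0, t]%classic jump_solution.
Proof.
move=> tT; apply: mxintegrableD => //.
  by apply: mxintegrableD => //; [exact: iP|exact: iVf].
by apply: mxintegrable_sum => // j; exact: iVG.
Qed.

Lemma jump_solution_equation : jump_equation T jump_solution.
Proof.
split; first by apply: jump_solution_integrable; rewrite T0 lexx.
move=> t tT; have /andP[t0 tT'] := tT.
have i1 := mxintegrable_AM mA Aa (mcc 0 t) (iP tT).
have i2 := mxintegrable_AM mA Aa (mcc 0 t) (iVf tT).
have i3 j := mxintegrable_AM mA Aa (mcc 0 t) (iVG j tT).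
have ft : mxintegrable mu `[0, t]%classic f.
  by apply: (mxintegrable_sub _ _ _ fi) => //; exact: sub_0.
have i12 := mxintegrableD (mcc 0 t) i1 i2.
have i4 := mxintegrable_sum (mcc 0 t) i3.
have i123 := mxintegrableD (mcc 0 t) i12 i4.
rewrite (eq_mxintegral mu (F' := fun s => (A s *m (Phi s 0 *m x0) +
    A s *m duhamel Phi mu f s +
    \sum_j A s *m duhamel Phi (nu j) (fun s => col j (G s)) s) + f s)); last first.
  by move=> s _; rewrite /jump_solution !mulmxDr mulmx_sumr.
rewrite (mxintegralD (mcc 0 t) i123 ft) (mxintegralD (mcc 0 t) i12 i4).
rewrite (mxintegralD (mcc 0 t) i1 i2) (mxintegral_sum (mcc 0 t) i3).
rewrite /jump_solution (duhamel_eq mA Aa mPhi Phib hPhi mf fi' tT).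
under eq_bigr do rewrite (duhamel_eq mA Aa mPhi Phib hPhi (mGcol _) (Gi _) tT).
rewrite big_split/= mxintegral_oc_cc//.
have [iP0 P0] := hPhi T0T.
rewrite P0// oriented_integral_le// mulmxDl mul1mx -mxintegralMr//; last first.
  apply: mxintegrable_AM => //; apply: (mxintegrable_sub _ _ _ iP0) => //.
  exact: sub_0.
rewrite (eq_mxintegral mu (F' := fun r => A r *m (Phi r 0 *m x0))); last first.
  by move=> r _; rewrite mulmxA.
rewrite -!addrA; congr (_ + (_ + (_ + _))).
by rewrite [LHS]addrCA; congr (_ + _).
Qed.

(** The forcing and the jump terms cancel in the difference with [jump_solution], which is left with
    the homogeneous linear equation and initial value 0. *)
Lemma jump_equation_unique tau X : 0 <= tau <= T -> jump_equation tau X ->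
  forall t, 0 <= t <= tau -> X t = jump_solution t.
Proof.
move=> tauT [iX XE] t ttau; apply/eqP; rewrite -subr_eq0; apply/eqP.
have /andP[tau0 tauT'] := tauT.
have [_ ZE] := jump_solution_equation.
have iZ := jump_solution_integrable tauT.
have z0 : (0 : R) <= 0 <= tau by rewrite lexx.
suff : ode_solution tau A 0 0 (fun r => X r - jump_solution r).
  by move=> /(ode_unique a0 mA Aa z0); apply.
split.
  have h := mxintegrableD (mcc 0 tau) iX (mxintegrableN (mcc 0 tau) iZ).
  exact: h.
move=> {}t {}ttau; have /andP[t0 tt] := ttau.
have tT : 0 <= t <= T by rewrite t0 (le_trans tt).
rewrite add0r oriented_integral_le//.
have sub : `[0, t]%classic `<=` (`[0, tau]%classic : set R) by exact: sub_cc.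
have iXt := mxintegrable_sub (mcc 0 tau) (mcc 0 t) sub iX.
have iZt := jump_solution_integrable tT.
have iAX := mxintegrable_AM mA Aa (mcc 0 t) iXt.
have iAZ := mxintegrable_AM mA Aa (mcc 0 t) iZt.
have ft : mxintegrable mu `[0, t]%classic f.
  by apply: (mxintegrable_sub _ _ _ fi) => //; apply: sub_0; case/andP: tT.
rewrite XE// [jump_solution t]ZE//.
rewrite (mxintegralD (mcc 0 t) iAX ft) (mxintegralD (mcc 0 t) iAZ ft).
rewrite [RHS](eq_mxintegral mu (F' := fun r => A r *m X r - A r *m jump_solution r)); last first.
  by move=> r _; rewrite mulmxBr.
rewrite (mxintegralB (mcc 0 t) iAX iAZ).
rewrite opprD addrACA subrr addr0 opprD addrACA subrr add0r.
by rewrite opprD addrACA subrr addr0.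
Qed.

End linear_jump_equation.

(** * Regular versions of the coefficients *)

Section parameter_tools.
Context {R : realType}.
Local Notation mu := (@lebesgue_measure R).
Local Notation mR := (measurableTypeR R).

Lemma measurable_Rintegral_param d (X : measurableType d) (D : set mR)
    (q : X * mR -> R) : measurable D -> measurable_fun setT q ->
  measurable_fun setT (fun x => \int[mu]_(s in D) q (x, s)).
Proof.
move=> mD mq; apply: measurableT_comp => //.
pose Q (z : X * mR) := ((EFin \o q) \_ (setT `*` D)) z.
have mXD : measurable (setT `*` D : set (X * mR)) by exact: measurableX.
have mQ : measurable_fun setT Q.
  by apply/(measurable_restrictT _ mXD)/measurable_funTS/measurable_EFinP.
have QE x : (\int[mu]_(s in D) (q (x, s))%:E = \int[mu]_s Q (x, s))%E.
  rewrite integral_mkcond; apply: eq_integral => s _; rewrite /Q !patchE.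
  congr (if _ then _ else _).
  by apply/idP/idP => /set_mem h; apply/mem_set => //; case: h.
under eq_fun do rewrite QE.
under eq_fun do rewrite integralE.
apply: emeasurable_funB.
- rewrite (_ : (fun x => _) = fubini_F mu (Q^\+)%E); last first.
    by apply/funext => x; apply: eq_integral => s _; rewrite !funeposE.
  by apply: measurable_fun_fubini_tonelli_F => //; exact: measurable_funepos.
- rewrite (_ : (fun x => _) = fubini_F mu (Q^\-)%E); last first.
    by apply/funext => x; apply: eq_integral => s _; rewrite !funenegE.
  by apply: measurable_fun_fubini_tonelli_F => //; exact: measurable_funeneg.
Qed.

(** By Tonelli, the measures of the sections of a null set integrate to 0. The second coordinate is
    the one fixed, as it will be the parameter [beta]. *)
Lemma ae_product_section (Q : mR * mR -> Prop) :
  {ae (mu \x mu)%E, forall z, Q z} ->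
  {ae mu, forall y, {ae mu, forall x, Q (x, y)}}.
Proof.
move=> [N [mN N0 QN]].
have mind : measurable_fun setT (fun z => (\1_N z)%:E : \bar R).
  by apply/measurable_EFinP; exact: measurable_indic.
have ind0 z : (0 <= (\1_N z)%:E :> \bar R)%E by rewrite lee_fin.
have := fubini_tonelli2 (m1 := mu) (m2 := mu) (fun z => (\1_N z)%:E) mind ind0.
rewrite integral_indic// setIT.
have mG := measurable_fun_fubini_tonelli_G (m1 := mu) (fun z => (\1_N z)%:E) mind ind0.
rewrite [X in X = _](_ : _ = 0%E); last exact: N0.
move=> /esym G0.
have : ae_eq mu setT (fubini_G mu (fun z => (\1_N z)%:E)) (cst 0%E).
  apply/ae_eq_integral_abs => //.
  rewrite -[RHS]G0; apply: eq_integral => y _; rewrite gee0_abs//.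
  exact: integral_ge0.
apply: filterS => y /(_ I); rewrite /fubini_G /= => Gy.
exists (ysection N y); split.
- exact: measurable_ysection.
- rewrite -[RHS]Gy -[LHS]mul1e -integral_cst//; last exact: measurable_ysection.
  rewrite integral_mkcond; apply: eq_integral => x _ /=.
  by rewrite patchE mem_ysection indicE; case: ifPn.
- by move=> x /= nQ; apply/ysectionP; exact: QN.
Qed.

Lemma Lfun_oo_bounded d (X : measurableType d) (m : {measure set X -> \bar R})
    (f : X -> R) : f \in Lfun m +oo%E -> exists M, {ae m, forall x, `|f x| <= M}.
Proof.
move=> /andP[_ h].
have : finite_norm m +oo%E f by have : f \in [set g | finite_norm m +oo%E g] := h; move/set_mem.
rewrite /finite_norm unlock.
case: ifPn => [_ foo|]; last first.
  (* When the total mass is 0, the whole space is an exceptional set and any bound will do. *)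
  rewrite lt0e measure_ge0 andbT negbK => /eqP m0 _; exists 0.
  by exists setT; split.
have [M Mlt] : exists M : R, (ess_sup m (abse \o (EFin \o f)) <= M%:E)%E.
  case: (ess_sup _ _) foo => [r _|//|_]; first by exists r.
  by exists 0; rewrite leNye.
exists M; move/ess_supP : Mlt; apply: filterS => x /=.
by rewrite lee_fin.
Qed.

Lemma eq_mxintegral_ae (D : set mR) (p q : nat) (F F' : R -> 'M[R]_(p, q)) :
  {ae mu, forall t, D t -> F t = F' t} ->
  mxintegral mu D F = mxintegral mu D F'.
Proof.
move=> FF'; apply/matrixP => i j; rewrite !mxE /Rintegral; congr fine.
by apply: eq_integral_ae; apply: filterS FF' => t h Dt /=; rewrite h.
Qed.

(* Versions of the coefficients that are Borel on the whole plane and satisfy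
   pointwise the bounds that the data only satisfy almost everywhere; [K0] has
   full measure in [K]. *)
Record regular_data (T a b : R) (n m k : nat) (K0 : set R)
  (A : R -> R -> 'M[R]_n) (B : R -> R -> 'M[R]_(n, m))
  (G : R -> R -> 'M[R]_(n, k)) (Phi : R -> R -> R -> 'M[R]_n) : Prop := {
  rd_K0 : measurable (K0 : set mR) ;
  rd_a : 0 <= a ;
  rd_A i j : measurable_fun setT (fun z : mR * mR => A z.1 z.2 i j) ;
  rd_Aa t beta : mxl1 (A t beta) <= a ;
  rd_B i j : measurable_fun setT (fun z : mR * mR => B z.1 z.2 i j) ;
  rd_G i j : measurable_fun setT (fun z : mR * mR => G z.1 z.2 i j) ;
  rd_Phi i j : measurable_fun setT
    (fun z : (mR * mR) * mR => Phi z.1.1 z.1.2 z.2 i j) ;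
  rd_Phib t s beta : mxl1 (Phi t s beta) <= b ;
  rd_ode beta : K0 beta -> forall s, 0 <= s <= T ->
    ode_solution T (A ^~ beta) s 1%:M (fun t => Phi t s beta) ;
  rd_B2 beta i j :
    mu.-integrable `[0, T]%classic (fun s => (B s beta i j ^+ 2)%:E) ;
  rd_G2 beta i j :
    mu.-integrable `[0, T]%classic (fun s => (G s beta i j ^+ 2)%:E) ;
  rd_G2K i j : (\int[mu]_beta \int[mu]_(s in `[0%R, T]) (G s beta i j ^+ 2)%:E
    < +oo)%E }.

Section regular_sections.
Variables (T a b : R) (n m k : nat) (K0 : set R).
Variables (A : R -> R -> 'M[R]_n) (B : R -> R -> 'M[R]_(n, m))
  (G : R -> R -> 'M[R]_(n, k)) (Phi : R -> R -> R -> 'M[R]_n).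
Hypothesis rd : regular_data T a b K0 A B G Phi.

Let swap_measurable p q (F : R -> R -> 'M[R]_(p, q)) i j :
  measurable_fun setT (fun z : mR * mR => F z.1 z.2 i j) ->
  measurable_fun setT (fun z : mR * mR => F z.2 z.1 i j).
Proof.
move=> mF; have h : measurable_fun setT (fun z : mR * mR => (z.2, z.1)).
  by apply: measurable_fun_pair; [exact: measurable_snd|exact: measurable_fst].
exact: (measurableT_comp mF h).
Qed.

Lemma rd_A_section beta i j : measurable_fun setT (fun t : mR => A t beta i j).
Proof. exact: (measurableT_comp (rd_A rd i j) (measurable_pair2 beta)). Qed.

Lemma rd_B_section beta i j : measurable_fun setT (fun t : mR => B t beta i j).
Proof. exact: (measurableT_comp (rd_B rd i j) (measurable_pair2 beta)). Qed.

Lemma rd_B_swap i j : measurable_fun setT (fun z : mR * mR => B z.2 z.1 i j).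
Proof. exact: swap_measurable (rd_B rd i j). Qed.

Lemma rd_G_section beta i j : measurable_fun setT (fun t : mR => G t beta i j).
Proof. exact: (measurableT_comp (rd_G rd i j) (measurable_pair2 beta)). Qed.

Lemma rd_G_swap i j : measurable_fun setT (fun z : mR * mR => G z.2 z.1 i j).
Proof. exact: swap_measurable (rd_G rd i j). Qed.

Lemma rd_Phi_times beta i j :
  measurable_fun setT (fun z : mR * mR => Phi z.1 z.2 beta i j).
Proof. exact: (measurableT_comp (rd_Phi rd i j) (measurable_pair2 beta)). Qed.

Lemma rd_Phi_section t beta i j : measurable_fun setT (fun s : mR => Phi t s beta i j).
Proof. exact: (measurableT_comp (rd_Phi_times beta i j) (measurable_pair1 t)). Qed.

Lemma rd_Phi_swap t i j : measurable_fun setT (fun z : mR * mR => Phi t z.2 z.1 i j).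
Proof.
have h : measurable_fun setT (fun z : mR * mR => ((t : mR, z.2), z.1)).
  apply: measurable_fun_pair; last exact: measurable_fst.
  by apply: measurable_fun_pair => //; exact: measurable_snd.
exact: (measurableT_comp (rd_Phi rd i j) h).
Qed.

Lemma rd_b_ge0 : 0 <= b.
Proof. exact: le_trans (mxl1_ge0 _) (rd_Phib rd 0 0 0). Qed.

End regular_sections.

End parameter_tools.

Section regularization.
Context {R : realType}.
Local Notation mu := (@lebesgue_measure R).
Local Notation mR := (measurableTypeR R).
Variables (T : R) (K : set R).
Hypotheses (T0 : 0 <= T) (mK : measurable (K : set mR)).

Let D : set (mR * mR) := `[0, T]%classic `*` K.

Let m0T : measurable (`[0, T]%classic : set mR).
Proof. exact: measurable_itv. Qed.

Let mD : measurable D.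
Proof. by apply: measurableX => //; exact: measurable_itv. Qed.

(** The data are known to be measurable only on [[0, T]] times [K]; the value 0 elsewhere yields
    Borel functions on the whole plane. *)
Definition restrict_data (K0 : set R) (p q : nat) (F : R -> R -> 'M[R]_(p, q))
    (t beta : R) : 'M[R]_(p, q) :=
  if (0 <= t <= T) && (beta \in K0) then F t beta else 0.

Let mD0 (K0 : set R) : measurable (K0 : set mR) ->
  measurable_fun setT (fun z : mR * mR => (0 <= z.1 <= T) && (z.2 \in K0)).
Proof.
move=> mK0; apply: measurable_and; first apply: measurable_and.
- by apply: measurable_fun_ler => //; exact: measurable_fst.
- by apply: measurable_fun_ler => //; exact: measurable_fst.
- apply: (measurable_fun_bool true); rewrite setTI.
  rewrite (_ : _ @^-1` _ = setT `*` K0); first exact: measurableX.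
  apply/seteqP; split=> z /=; first by move/set_mem.
  by move=> [_ ?]; exact/mem_set.
Qed.

Lemma restrict_data_measurable K0 p q (F : R -> R -> 'M[R]_(p, q)) i j :
  measurable (K0 : set mR) -> K0 `<=` K ->
  measurable_fun setT ((fun z : mR * mR => F z.1 z.2 i j) \_ D) ->
  measurable_fun setT (fun z : mR * mR => restrict_data K0 F z.1 z.2 i j).
Proof.
move=> mK0 K0K mF.
rewrite (_ : (fun z => _) = fun z : mR * mR =>
  if (0 <= z.1 <= T) && (z.2 \in K0)
  then ((fun z : mR * mR => F z.1 z.2 i j) \_ D) z else 0).
  by apply: measurable_fun_ifT => //; exact: mD0.
apply/funext => z; rewrite /restrict_data; case: ifPn => [/andP[z1 /set_mem z2]|_].
  by rewrite patchE mem_set//; split=> //=; exact: K0K.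
by rewrite mxE.
Qed.

Lemma restrict_dataE K0 p q (F : R -> R -> 'M[R]_(p, q)) t beta :
  0 <= t <= T -> K0 beta -> restrict_data K0 F t beta = F t beta.
Proof. by move=> tT Kb; rewrite /restrict_data tT mem_set. Qed.

Lemma in_LpD_measurable r p q (F : R -> R -> 'M[R]_(p, q)) i j :
  in_LpD r T K F ->
  measurable_fun setT ((fun z : mR * mR => F z.1 z.2 i j) \_ D).
Proof. by move=> /(_ i j)/andP[/set_mem + _]. Qed.

Lemma in_L2D_section p q (F : R -> R -> 'M[R]_(p, q)) i j : in_LpD 2%:E T K F ->
  {ae mu, forall beta, K beta ->
    mu.-integrable `[0, T]%classic (fun t => (F t beta i j ^+ 2)%:E)}.
Proof.
move=> hF; have := ae_integrable2 (Lfun2_integrable_sqr (hF i j)).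
apply: filterS => beta h Kb.
have := integrableS (@measurableT _ mR)
  m0T (@subsetT _ _) h.
apply: eq_integrable; first exact: m0T.
move=> t tT; have Dtb : D (t, beta) by split; [exact: set_mem tT|exact: Kb].
by rewrite /= patchE (mem_set Dtb).
Qed.

(** Square integrability of almost every section says nothing about the dependence on [beta]. The
    finite double integral is what later makes the noise terms integrable over [K]. *)
Lemma in_L2D_total K0 p q (F : R -> R -> 'M[R]_(p, q)) i j : in_LpD 2%:E T K F ->
  measurable (K0 : set mR) -> K0 `<=` K ->
  (\int[mu]_beta \int[mu]_(t in `[0%R, T]) (restrict_data K0 F t beta i j ^+ 2)%:E
    < +oo)%E.
Proof.
move=> hF mK0 K0K.
have mF := in_LpD_measurable i j hF.
have mrF := restrict_data_measurable mK0 K0K mF.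
pose f := (fun z : mR * mR => F z.1 z.2 i j) \_ D.
have mf2 : measurable_fun setT (fun z => (f z ^+ 2)%:E).
  by apply/measurable_EFinP; exact: measurable_funX.
have := (integrable21ltyP mu mu mf2).1 (Lfun2_integrable_sqr (hF i j)).
have mrF2 : measurable_fun setT
    (fun z : mR * mR => (restrict_data K0 F z.1 z.2 i j ^+ 2)%:E).
  by apply/measurable_EFinP; exact: measurable_funX.
apply: le_lt_trans.
have H beta t : (((fun t => (restrict_data K0 F t beta i j ^+ 2)%:E) \_ `[0%R, T]%classic) t
    <= `|(f (t, beta) ^+ 2)%:E|)%E.
  rewrite patchE; case: ifPn => // tT; rewrite lee_fin ger0_norm ?sqr_ge0//.
  rewrite /restrict_data; case: ifPn => [/andP[_ /set_mem b0]|_]; last first.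
    by rewrite mxE expr0n sqr_ge0.
  have Dtb : D (t, beta).
    by split; [exact: set_mem tT|exact: K0K].
  by rewrite /f patchE (mem_set Dtb).
have mF1 : measurable_fun setT (fun z : mR * mR =>
    ((fun t => (restrict_data K0 F t z.2 i j ^+ 2)%:E) \_ `[0%R, T]%classic) z.1 : \bar R).
  rewrite (_ : (fun z => _) = (fun z : mR * mR => (restrict_data K0 F z.1 z.2 i j ^+ 2)%:E)
    \_ (`[0%R, T]%classic `*` setT)).
    apply/(measurable_restrictT _ (measurableX m0T measurableT)).
    exact: measurable_funTS.
  apply/funext => z; rewrite !patchE; congr (if _ then _ else _).
  by apply/idP/idP => /set_mem h; apply/mem_set => //; case: h.
have ge0 (z : mR * mR) : (0 <= ((fun t => (restrict_data K0 F t z.2 i j ^+ 2)%:E) \_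
    `[0%R, T]%classic) z.1 :> \bar R)%E.
  by rewrite patchE; case: ifPn => // _; rewrite lee_fin sqr_ge0.
under eq_integral do rewrite integral_mkcond.
apply: ge0_le_integral => //.
- by move=> beta _; apply: integral_ge0 => t _; exact: (ge0 (t, beta)).
- exact: (measurable_fun_fubini_tonelli_G (m1 := mu) _ mF1 ge0).
- apply: (measurable_fun_fubini_tonelli_G (m1 := mu) (fun z => `|(f z ^+ 2)%:E|%E)) => //.
  exact: measurableT_comp.
move=> beta _; apply: ge0_le_integral => //.
- by move=> t _; exact: (ge0 (t, beta)).
- exact: (measurableT_comp mF1 (measurable_pair2 beta)).
- apply: measurableT_comp => //.
  exact: (measurableT_comp mf2 (measurable_pair2 beta)).
Qed.

End regularization.

Lemma ae_and d (X : measurableType d) (R : realType)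
    (m : {measure set X -> \bar R}) (P Q : X -> Prop) :
  {ae m, forall x, P x} -> {ae m, forall x, Q x} ->
  {ae m, forall x, P x /\ Q x}.
Proof.
move=> [N1 [mN1 N10 PN]] [N2 [mN2 N20 QN]].
exists (N1 `|` N2); split; [exact: measurableU|by rewrite measureU0|].
move=> x /= /not_andP[nP|nQ]; [left; exact: PN|right; exact: QN].
Qed.

Lemma ae_mono d (X : measurableType d) (R : realType)
    (m : {measure set X -> \bar R}) (P Q : X -> Prop) :
  {ae m, forall x, P x} -> (forall x, P x -> Q x) -> {ae m, forall x, Q x}.
Proof.
move=> [N [mN N0 PN]] PQ; exists N; split=> // x /= nQ.
by apply: PN => /= /PQ.
Qed.

Section regularize.
Context {R : realType}.
Local Notation mu := (@lebesgue_measure R).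
Local Notation mR := (measurableTypeR R).
Variables (T : R) (K : set R) (n m k : nat).
Variables (A : R -> R -> 'M[R]_n) (B : R -> R -> 'M[R]_(n, m))
  (G : R -> R -> 'M[R]_(n, k)) (Phi : R -> R -> R -> 'M[R]_n).
Hypotheses (T0 : 0 <= T) (mK : measurable (K : set mR)).
Hypotheses (hA : in_LpD +oo%E T K A) (hB : in_LpD 2%:E T K B)
  (hG : in_LpD 2%:E T K G) (hPhi : transition_matrix T K A Phi).

Let D : set (mR * mR) := `[0, T]%classic `*` K.

Let m0T : measurable (`[0, T]%classic : set mR).
Proof. exact: measurable_itv. Qed.

Let mcc (x y : R) : measurable (`[x, y]%classic : set mR).
Proof. exact: measurable_itv. Qed.

(** [A] is matched only at almost every time, since its bound fails on a null set of times; this is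
    harmless because [A] enters only under integrals in time. *)
Definition data_agree (beta : R) (A' : R -> R -> 'M[R]_n)
    (B' : R -> R -> 'M[R]_(n, m)) (G' : R -> R -> 'M[R]_(n, k))
    (Phi' : R -> R -> R -> 'M[R]_n) : Prop :=
  [/\ forall t, 0 <= t <= T -> B' t beta = B t beta,
      forall t, 0 <= t <= T -> G' t beta = G t beta,
      forall t s, 0 <= t <= T -> 0 <= s <= T -> Phi' t s beta = Phi t s beta &
      {ae mu, forall t, 0 <= t <= T -> A t beta = A' t beta}].

Lemma A_bound : exists2 a, 0 <= a & {ae mu, forall beta, {ae mu, forall t,
  K beta -> 0 <= t <= T -> mxl1 (A t beta) <= a}}.
Proof.
have /choice[M HM] : forall ij : 'I_n * 'I_n, exists M,
    {ae (mu \x mu)%E, forall z, `|((fun z : mR * mR => A z.1 z.2 ij.1 ij.2) \_ D) z| <= M}.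
  by move=> ij; exact: (Lfun_oo_bounded (hA ij.1 ij.2)).
exists (\sum_i \sum_j `|M (i, j)|).
  by apply: sumr_ge0 => i _; exact: sumr_ge0.
have : {ae (mu \x mu)%E, forall z, forall ij : 'I_n * 'I_n,
    `|((fun z : mR * mR => A z.1 z.2 ij.1 ij.2) \_ D) z| <= M ij}.
  exact: filter_forall.
move=> /ae_product_section; apply: filterS => beta; apply: filterS => t H Kb tT.
have Dtb : D (t, beta) by split => //=; rewrite in_itv.
apply: ler_sum => i _; apply: ler_sum => j _.
have := H (i, j); rewrite patchE (mem_set Dtb)/= => /le_trans; apply.
exact: ler_norm.
Qed.

(** [K0] is [K] minus a Borel null set containing every [beta] where a section is not square
    integrable, [A] is not essentially bounded by [a], or the equation of [Phi] fails. *)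
Lemma regularize : exists a b K0 A' B' G' Phi',
  [/\ regular_data T a b K0 A' B' G' Phi', K0 `<=` K,
      {ae mu, forall beta, K beta -> K0 beta} &
      forall beta, K0 beta -> data_agree beta A' B' G' Phi'].
Proof.
have [a a0 Aa] := A_bound.
have B2 : {ae mu, forall beta, forall ij : 'I_n * 'I_m, K beta ->
    mu.-integrable `[0, T]%classic (fun t => (B t beta ij.1 ij.2 ^+ 2)%:E)}.
  by apply: filter_forall => ij; exact: in_L2D_section.
have G2 : {ae mu, forall beta, forall ij : 'I_n * 'I_k, K beta ->
    mu.-integrable `[0, T]%classic (fun t => (G t beta ij.1 ij.2 ^+ 2)%:E)}.
  by apply: filter_forall => ij; exact: in_L2D_section.
have [mPhi PhiE] := hPhi.
pose Q1 beta := {ae mu, forall t, K beta -> 0 <= t <= T -> mxl1 (A t beta) <= a}.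
pose Q2 beta := forall ij : 'I_n * 'I_m, K beta ->
  mu.-integrable `[0, T]%classic (fun t => (B t beta ij.1 ij.2 ^+ 2)%:E).
pose Q3 beta := forall ij : 'I_n * 'I_k, K beta ->
  mu.-integrable `[0, T]%classic (fun t => (G t beta ij.1 ij.2 ^+ 2)%:E).
pose Q4 beta := K beta -> forall s, 0 <= s <= T ->
  mxintegrable mu `[0, T]%classic (fun r => Phi r s beta) /\
  forall t, 0 <= t <= T -> Phi t s beta =
    1%:M + oriented_integral s t (fun r => A r beta *m Phi r s beta).
have Q12 : {ae mu, forall beta, Q1 beta /\ Q2 beta}.
  exact: ae_and.
have Q34 : {ae mu, forall beta, Q3 beta /\ Q4 beta}.
  exact: ae_and.
have [N [mN N0 goodN]] :
    {ae mu, forall beta, (Q1 beta /\ Q2 beta) /\ (Q3 beta /\ Q4 beta)}.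
  exact: ae_and.
pose K0 := K `\` N.
have mK0 : measurable (K0 : set mR) by exact: measurableD.
have K0K : K0 `<=` K by move=> x [].
have good beta : K0 beta -> [/\ {ae mu, forall t, 0 <= t <= T -> mxl1 (A t beta) <= a},
    forall i j, mu.-integrable `[0, T]%classic (fun t => (B t beta i j ^+ 2)%:E),
    forall i j, mu.-integrable `[0, T]%classic (fun t => (G t beta i j ^+ 2)%:E) &
    forall s, 0 <= s <= T ->
     mxintegrable mu `[0, T]%classic (fun r => Phi r s beta) /\
     forall t, 0 <= t <= T -> Phi t s beta =
       1%:M + oriented_integral s t (fun r => A r beta *m Phi r s beta)].
  move=> [Kb Nb].
  have [[h1 h2] [h3 h4]] := contrapT (fun nb => Nb (goodN beta nb)).
  split.
  - by apply: (ae_mono h1) => t; apply.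
  - by move=> i j; exact: (h2 (i, j) Kb).
  - by move=> i j; exact: (h3 (i, j) Kb).
  - exact: h4 Kb.
(* For [beta] in [K0], replacing [A] by 0 where its bound fails affects a null set of times only, so
   [Phi] still solves the equation with [A']. *)
pose A' t beta := if mxl1 (restrict_data T K0 A t beta) <= a
  then restrict_data T K0 A t beta else 0.
pose B' := restrict_data T K0 B; pose G' := restrict_data T K0 G.
pose Phi' t s beta : 'M[R]_n := if [&& 0 <= t <= T, 0 <= s <= T & beta \in K0]
  then Phi t s beta else 0.
(* The constant of [ode_bound] for the identity as initial value. *)
pose b := 2 * mxl1 (1%:M : 'M[R]_n) * expR (2 * a * T).
have mrA i j := restrict_data_measurable mK0 K0K (in_LpD_measurable i j hA).
have mA' i j : measurable_fun setT (fun z : mR * mR => A' z.1 z.2 i j).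
  rewrite (_ : (fun z => _) = fun z : mR * mR => if mxl1 (restrict_data T K0 A z.1 z.2) <= a
      then restrict_data T K0 A z.1 z.2 i j else 0); last first.
    by apply/funext => z; rewrite /A'; case: ifPn => //; rewrite mxE.
  have mle : measurable_fun setT (fun z : mR * mR => mxl1 (restrict_data T K0 A z.1 z.2) <= a).
    by apply: measurable_fun_ler => //; apply: measurable_mxl1 => // i' j'; exact: (mrA i' j').
  exact: (measurable_fun_ifT mle (mrA i j) (measurable_cst _)).
have A'a t beta : mxl1 (A' t beta) <= a.
  rewrite /A'; case: ifPn => // _.
  by rewrite /mxl1 big1// => i _; rewrite big1// => j _; rewrite mxE normr0.
have b0 : 0 <= b by rewrite !mulr_ge0 ?mxl1_ge0 ?expR_ge0.
have mA'1 beta i j : measurable_fun setT (fun t : mR => A' t beta i j).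
  exact: (measurableT_comp (mA' i j) (measurable_pair2 beta)).
have AA' beta : K0 beta -> {ae mu, forall t, 0 <= t <= T -> A t beta = A' t beta}.
  move=> Kb; have [h _ _ _] := good _ Kb; apply: (ae_mono h) => t {}h tT.
  by rewrite /A' restrict_dataE// h.
have ode beta : K0 beta -> forall s, 0 <= s <= T ->
    ode_solution T (A' ^~ beta) s 1%:M (fun t => Phi' t s beta).
  move=> Kb s sT; have [_ _ _ /(_ _ sT)[iP PE]] := good _ Kb.
  have PP' t : 0 <= t <= T -> Phi' t s beta = Phi t s beta.
    by move=> tT; rewrite /Phi' tT sT mem_set.
  split.
    apply: (eq_mxintegrable m0T _ iP) => t /=; rewrite in_itv/= => tT.
    by rewrite PP'.
  move=> t tT; rewrite PP'// PE//; congr (_ + _).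
  have /andP[s0 sT'] := sT; have /andP[t0 tT'] := tT.
  have H x y : 0 <= x -> y <= T -> mxintegral mu `[x, y]%classic (fun r => A r beta *m Phi r s beta) =
      mxintegral mu `[x, y]%classic (fun r => A' r beta *m Phi' r s beta).
    move=> x0 yT; have sub : `[x, y]%classic `<=` (`[0, T]%classic : set R) by exact: sub_cc.
    apply: eq_mxintegral_ae.
    apply: (ae_mono (AA' _ Kb)) => r rA /sub/=; rewrite in_itv/= => rT.
    by rewrite rA// PP'.
  by rewrite /oriented_integral !H.
exists a, b, K0, A', B', G', Phi'; split=> //.
- split=> //.
  + by move=> i j; exact: (restrict_data_measurable mK0 K0K (in_LpD_measurable i j hB)).
  + by move=> i j; exact: (restrict_data_measurable mK0 K0K (in_LpD_measurable i j hG)).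
  + move=> i j.
    pose D3 : set ((mR * mR) * mR) := (`[0, T]%classic `*` `[0, T]%classic) `*` K0.
    have mD3 : measurable D3 by apply: measurableX => //; exact: measurableX.
    rewrite (_ : (fun z => _) = (fun z : (mR * mR) * mR => Phi z.1.1 z.1.2 z.2 i j) \_ D3).
      apply/(measurable_restrictT _ mD3).
      apply: measurable_funS (mPhi i j); last first.
        by move=> z [h1 h2]; split => //; exact: K0K.
      by apply: measurableX => //; exact: measurableX.
    apply/funext => z; rewrite patchE /Phi'; case: ifPn => [/and3P[h1 h2 /set_mem h3]|h].
      have D3z : D3 z by split => //; split; rewrite /= in_itv.
      by rewrite (mem_set D3z).
    rewrite mxE memNset// => -[[/= h1 h2] h3]; move: h; apply/negP; rewrite negbK.
    by move: h1 h2; rewrite !in_itv/= => -> ->; exact/mem_set.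
  + move=> t s beta; have [|h] := boolP [&& 0 <= t <= T, 0 <= s <= T & beta \in K0].
      move=> /and3P[tT sT /set_mem Kb].
      have mAb i j : measurable_fun setT (fun t : mR => (A' ^~ beta) t i j) by exact: mA'1.
      exact: (ode_bound a0 mAb (A'a ^~ beta) sT (ode _ Kb _ sT) tT).
    rewrite /Phi' (negbTE h) (_ : mxl1 0 = 0)//.
    by rewrite /mxl1 big1// => i _; rewrite big1// => j _; rewrite mxE normr0.
  + move=> beta i j; have [/set_mem Kb|h] := boolP (beta \in K0).
      have [_ h _ _] := good _ Kb; apply: eq_integrable (h i j) => // t /set_mem/=.
      by rewrite in_itv/= => tT; rewrite /B' restrict_dataE.
    apply: eq_integrable (integrable0 _ _) => // t _.
    by rewrite /B' /restrict_data (negbTE h) andbF mxE expr0n.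
  + move=> beta i j; have [/set_mem Kb|h] := boolP (beta \in K0).
      have [_ _ h _] := good _ Kb; apply: eq_integrable (h i j) => // t /set_mem/=.
      by rewrite in_itv/= => tT; rewrite /G' restrict_dataE.
    apply: eq_integrable (integrable0 _ _) => // t _.
    by rewrite /G' /restrict_data (negbTE h) andbF mxE expr0n.
  + by move=> i j; exact: in_L2D_total hG mK0 K0K.
- exists N; split=> // beta /= /not_implyP[Kb nK0].
  by apply: contrapT => nN; apply: nK0.
- move=> beta Kb; split.
  + by move=> t tT; rewrite /B' restrict_dataE.
  + by move=> t tT; rewrite /G' restrict_dataE.
  + by move=> t s tT sT; rewrite /Phi' tT sT mem_set.
  + exact: AA'.
Qed.

End regularize.

(** * Solutions of the stochastic ensemble *)

(** The moment formulas are stated at the horizon; shortening it gives them at the intermediate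
    times where the mean state is needed. *)
Lemma independent_poisson_countersW (R : realType) (k : nat) d
    (Xi : measurableType d) (P : probability Xi R)
    (N : 'I_k -> Xi -> cumulative R R) (T t : R) (lambda : 'cV[R]_k) :
  t <= T -> independent_poisson_counters P N T lambda ->
  independent_poisson_counters P N t lambda.
Proof.
move=> tT [hc hi]; split.
  move=> j; have [l0 [h1 h2 h3 h4 h5]] := hc j; split=> //; split=> //.
  - by move=> s /andP[s0 st]; apply: h1; rewrite s0 (le_trans st).
  - by move=> s xi /andP[s0 st]; apply: h3; rewrite s0 (le_trans st).
  - by move=> r s q r0 rs st; apply: h4 => //; exact: le_trans tT.
  - by move=> r s E B r0 rs st; apply: h5 => //; exact: le_trans tT.
move=> E hE; apply: hi => j.
apply: sub_smallest2r (hE j); first exact: smallest_sigma_algebra.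
move=> F [i [r [B [ji /andP[r0 rt] mB ->]]]]; exists i, r, B; split=> //.
by rewrite r0 (le_trans rt).
Qed.

Lemma sqr_mxl1_integrable d (X : measurableType d) (R : realType)
    (m : {measure set X -> \bar R}) (D : set X) (p q : nat)
    (F : X -> 'M[R]_(p, q)) : measurable D ->
  (forall i j, measurable_fun D (fun x => F x i j)) ->
  (forall i j, m.-integrable D (fun x => (F x i j ^+ 2)%:E)) ->
  m.-integrable D (fun x => (mxl1 (F x) ^+ 2)%:E).
Proof.
move=> mD mF F2.
have : m.-integrable D (fun x => \sum_i \sum_j \sum_i' \sum_j'
    (`|F x i j| * `|F x i' j'|)%:E)%E.
  apply: integrable_sum => // i _; apply: integrable_sum => // j _.
  apply: integrable_sum => // i' _; apply: integrable_sum => // j' _.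
  apply: sqr_integrableM => //.
  - exact: measurableT_comp.
  - exact: measurableT_comp.
  - by apply: eq_integrable (F2 i j) => // x _; rewrite real_normK ?num_real.
  - by apply: eq_integrable (F2 i' j') => // x _; rewrite real_normK ?num_real.
apply: eq_integrable => // x _; rewrite expr2 /mxl1 mulr_suml -sumEFin.
apply: eq_bigr => i _; rewrite mulr_suml -sumEFin; apply: eq_bigr => j _.
rewrite mulr_sumr -sumEFin; apply: eq_bigr => i' _.
by rewrite mulr_sumr -sumEFin.
Qed.

Section ensemble_solution.
Context {R : realType} d (Xi : measurableType d) (P : probability Xi R).
Variables (n m k : nat) (T a b : R) (K0 : set R).
Variables (A : R -> R -> 'M[R]_n) (B : R -> R -> 'M[R]_(n, m))
  (G : R -> R -> 'M[R]_(n, k)) (Phi : R -> R -> R -> 'M[R]_n).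
Variables (N : 'I_k -> Xi -> cumulative R R) (lambda : 'cV[R]_k).
Hypothesis T0 : 0 <= T.
Hypothesis hN : independent_poisson_counters P N T lambda.
Hypothesis rd : regular_data T a b K0 A B G Phi.
Local Notation mu := (@lebesgue_measure R).
Local Notation mR := (measurableTypeR R).
Local Notation rate j := (lambda j ord0).
Variables (X0 : R -> 'cV[R]_n) (u : R -> 'cV[R]_m).
Hypothesis mX0 : forall i j, measurable_fun setT (fun beta : mR => X0 beta i j).
Hypothesis mu_u : forall i j, measurable_fun setT (fun t : mR => u t i j).
Hypothesis u2 : forall i j,
  mu.-integrable `[0, T]%classic (fun t => (u t i j ^+ 2)%:E).

Let mcc (x y : R) : measurable (`[x, y]%classic : set mR).
Proof. exact: measurable_itv. Qed.

Let moc (x y : R) : measurable (`]x, y]%classic : set mR).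
Proof. exact: measurable_itv. Qed.

Let mA1 := rd_A_section rd.
Let mB1 := rd_B_section rd.
Let mG1 := rd_G_section rd.
Let mPhi2 := rd_Phi_times rd.
Let mPhi1 := rd_Phi_section rd.
Let mPhi_st := rd_Phi_swap rd.

Let sub_0 (t : R) : t <= T -> `[0, t]%classic `<=` (`[0, T]%classic : set R).
Proof. by move=> tT; exact: sub_cc. Qed.

Let sub_oc (t : R) : t <= T -> `]0, t]%classic `<=` (`[0, T]%classic : set R).
Proof.
move=> tT x /=; rewrite !in_itv/= => /andP[x0 xt].
by rewrite ltW//= (le_trans xt).
Qed.

Definition drift (beta s : R) : 'cV[R]_n := B s beta *m u s.

Lemma drift_measurable beta i j : measurable_fun setT (fun s : mR => drift beta s i j).
Proof. exact: measurable_mulmx. Qed.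

Lemma drift_integrable beta : mxintegrable mu `[0, T]%classic (drift beta).
Proof.
move=> i j.
have : mu.-integrable `[0, T]%classic (fun s => \sum_l (B s beta i l * u s l j)%:E)%E.
  apply: integrable_sum => // l _; apply: sqr_integrableM => //.
  - exact: measurable_funTS.
  - exact: measurable_funTS.
  - exact: rd_B2 rd beta i l.
apply: eq_integrable => // s _; rewrite /= mxE sumEFin.
by congr EFin.
Qed.

Let muoo (D : set mR) : measurable D -> D `<=` (`[0, T]%classic : set R) -> (mu D < +oo)%E.
Proof.
move=> mD DT; apply: (@le_lt_trans _ _ (mu `[0, T]%classic)).
  by apply: le_measure => //; exact: mem_set.
by rewrite /= lebesgue_measure_itv/=; case: ifP; rewrite ?ltry.
Qed.

Let G_integrable beta : mxintegrable mu `[0, T]%classic (fun s => G s beta).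
Proof.
move=> i j; apply: sqr_integrable_integrable => //.
- exact: muoo.
- exact: measurable_funTS.
- exact: (rd_G2 rd beta i j).
Qed.

(** Defined for every [beta] and [xi], whether or not the equation holds there, so that joint
    measurability can be proved on the whole product. Solutions are compared with it almost
    everywhere. *)
Definition ensemble_solution (t beta : R) (xi : Xi) : 'cV[R]_n :=
  jump_solution (fun t s => Phi t s beta)
    (fun j => lebesgue_stieltjes_measure (N j xi) : {sigma_finite_measure set mR -> \bar R})
    (X0 beta) (drift beta) (fun s => G s beta) t.

Lemma counters_integrable_ae beta : {ae P, forall xi, forall j : 'I_k,
  mxintegrable (lebesgue_stieltjes_measure (N j xi)) `]0, T]%classic
    (fun s => col j (G s beta))}.
Proof.
have H : {ae P, forall xi, forall ij : 'I_n * 'I_k,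
    (lebesgue_stieltjes_measure (N ij.2 xi)).-integrable `]0, T]%classic
      (EFin \o (fun s => G s beta ij.1 ij.2))}.
  apply: filter_forall => ij; apply: (counter_integrable_ae hN T0) => //.
  exact: (integrableS (mcc 0 T) (moc 0 T) (sub_oc (lexx T)) (G_integrable beta ij.1 ij.2)).
apply: filterS H => xi H j i l.
by apply: eq_integrable (H (i, j)) => // s _; rewrite /= mxE.
Qed.

Lemma ensemble_solution_equation beta : K0 beta -> {ae P, forall xi,
  jump_equation (A ^~ beta)
    (fun j => lebesgue_stieltjes_measure (N j xi) : {sigma_finite_measure set mR -> \bar R})
    (X0 beta) (drift beta) (fun s => G s beta) T
    (fun t => ensemble_solution t beta xi)}.
Proof.
move=> Kb; apply: filterS (counters_integrable_ae beta) => xi H.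
exact: (jump_solution_equation T0 (mA1 beta) ((rd_Aa rd) ^~ beta) (mPhi2 beta)
  (fun t s => rd_Phib rd t s beta) (rd_ode rd Kb)
  (nu := fun j => lebesgue_stieltjes_measure (N j xi)) (X0 beta)
  (drift_measurable beta) (mG1 beta) (drift_integrable beta) H).
Qed.

(** The exceptional set of paths comes only from the integrability of [G] along the counters, so it
    is common to all horizons and all candidate solutions. *)
Lemma ensemble_solution_unique beta : K0 beta -> {ae P, forall xi,
  forall tau X, 0 <= tau <= T ->
  jump_equation (A ^~ beta)
    (fun j => lebesgue_stieltjes_measure (N j xi) : {sigma_finite_measure set mR -> \bar R})
    (X0 beta) (drift beta) (fun s => G s beta) tau X ->
  forall t, 0 <= t <= tau -> X t = ensemble_solution t beta xi}.
Proof.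
move=> Kb; apply: filterS (counters_integrable_ae beta) => xi H tau X tauT.
exact: (jump_equation_unique T0 (rd_a rd) (mA1 beta) ((rd_Aa rd) ^~ beta) (mPhi2 beta)
  (fun t s => rd_Phib rd t s beta) (rd_ode rd Kb)
  (nu := fun j => lebesgue_stieltjes_measure (N j xi)) (x0 := X0 beta)
  (drift_measurable beta) (mG1 beta) (drift_integrable beta) H tauT).
Qed.

Definition deterministic_part (t beta : R) : 'cV[R]_n :=
  Phi t 0 beta *m X0 beta + duhamel (fun t s => Phi t s beta) mu (drift beta) t.

Definition noise_gain (t beta : R) (i : 'I_n) (j : 'I_k) (s : R) : R :=
  (Phi t s beta *m G s beta) i j.

Lemma ensemble_solutionE t beta xi i : ensemble_solution t beta xi i ord0 =
  deterministic_part t beta i ord0 +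
  \sum_j counter_integral N t j (noise_gain t beta i j) xi.
Proof.
rewrite /ensemble_solution /jump_solution mxE summxE; congr (_ + _).
apply: eq_bigr => j _; rewrite /duhamel mxE /counter_integral.
apply: eq_Rintegral => s _; rewrite /noise_gain !mxE.
by apply: eq_bigr => l _; rewrite mxE.
Qed.

Lemma deterministic_part_measurable t i :
  measurable_fun setT (fun beta : mR => deterministic_part t beta i ord0).
Proof.
rewrite (_ : (fun beta => _) = fun beta : mR => (Phi t 0 beta *m X0 beta) i ord0 +
    \int[mu]_(s in `]0, t]) (Phi t s beta *m drift beta s) i ord0); last first.
  by apply/funext => beta; rewrite !mxE.
apply: measurable_funD.
  apply: (measurable_mulmx (F := fun beta : mR => Phi t 0 beta)) => //= i' j'.
  exact: (measurableT_comp (mPhi_st t i' j') (measurable_pair2 (0 : mR))).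
apply: (@measurable_Rintegral_param _ _ _ _ (fun z : mR * mR =>
  (Phi t z.2 z.1 *m drift z.1 z.2) i ord0)) => //.
apply: (measurable_mulmx (F := fun z : mR * mR => Phi t z.2 z.1)
  (F' := fun z : mR * mR => drift z.1 z.2)) => // i' j'.
apply: (measurable_mulmx (F := fun z : mR * mR => B z.2 z.1)
  (F' := fun z : mR * mR => u z.2)) => // i2 j2.
- exact: (rd_B_swap rd i2 j2).
- exact: (measurableT_comp (mu_u i2 j2) measurable_snd).
Qed.

Lemma noise_gain_measurable2 t i j : measurable_fun setT
  (fun z : mR * mR => noise_gain t z.1 i j z.2).
Proof.
apply: (measurable_mulmx (F := fun z : mR * mR => Phi t z.2 z.1)
  (F' := fun z : mR * mR => G z.2 z.1)) => // i2 j2.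
exact: (rd_G_swap rd i2 j2).
Qed.

Lemma noise_gain_measurable t beta i j :
  measurable_fun setT (noise_gain t beta i j : mR -> R).
Proof. exact: measurable_mulmx. Qed.

Lemma ensemble_solution_measurable t i : 0 <= t <= T ->
  measurable_fun setT (fun z : mR * Xi => ensemble_solution t z.1 z.2 i ord0).
Proof.
move=> /andP[t0 tT].
under eq_fun do rewrite ensemble_solutionE.
apply: measurable_funD.
  exact: (measurableT_comp (deterministic_part_measurable t i) measurable_fst).
apply: measurable_sum => j.
apply: (@measurable_stieltjes_Rintegral _ _ _ (fun z : mR * Xi => N j z.2) t t0 _
  (fun z : (mR * Xi) * mR => noise_gain t z.1.1 i j z.2)).
  move=> s /andP[s0 st].
  have sT : 0 <= s <= T by rewrite s0 (le_trans st).
  exact: (measurableT_comp (counter_measurable hN j sT) measurable_snd).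
have h : measurable_fun setT (fun z : (mR * Xi) * mR => (z.1.1, z.2)).
  apply: measurable_fun_pair; last exact: measurable_snd.
  exact: (measurableT_comp measurable_fst measurable_fst).
exact: (measurableT_comp (noise_gain_measurable2 t i j) h).
Qed.

(** The measurability theorem for Stieltjes integrals is applied again, with [Xi] carrying the
    sigma-algebra generated by the counters up to time [t]: it only uses their values on
    [[0, t]]. *)
Lemma ensemble_solution_adapted t beta i (E : set R) : 0 <= t <= T ->
  measurable E ->
  natural_filtration N t [set xi | E (ensemble_solution t beta xi i ord0)].
Proof.
move=> /andP[t0 tT] mE.
rewrite /natural_filtration /path_sigma; set Gen := (X in <<s X >>).
pose Xi' := g_sigma_algebraType Gen.
suff h : measurable_fun setT (fun xi : Xi' => ensemble_solution t beta xi i ord0).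
  by have := h measurableT E mE; rewrite setTI.
under eq_fun do rewrite ensemble_solutionE.
apply: measurable_funD => //; apply: measurable_sum => j.
apply: (@measurable_stieltjes_Rintegral _ _ Xi' (N j) t t0 _
  (fun z : Xi' * mR => noise_gain t beta i j z.2)).
  move=> s st _ F mF; rewrite setTI; apply: sub_sigma_algebra.
  by exists j, s, F; split.
exact: (measurableT_comp (noise_gain_measurable t beta i j) measurable_snd).
Qed.

Lemma noise_gain_bound t beta i j s : noise_gain t beta i j s ^+ 2 <=
  b ^+ 2 * mxl1 (G s beta) ^+ 2.
Proof.
rewrite -exprMn -[leLHS]real_normK ?num_real// ler_sqr ?nnegrE//; last first.
  by rewrite mulr_ge0 ?mxl1_ge0// (rd_b_ge0 rd).
rewrite (le_trans (entry_le_mxl1 _ _ _))// (le_trans (mxl1M _ _))//.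
by rewrite ler_wpM2r ?mxl1_ge0// (rd_Phib rd).
Qed.

Lemma noise_gain_sqr t beta i j : mu.-integrable `[0, T]%classic
  (fun s => (noise_gain t beta i j s ^+ 2)%:E).
Proof.
have G2 := sqr_mxl1_integrable (mcc 0 T)
  (fun i j => measurable_funTS (mG1 beta i j)) (rd_G2 rd beta).
have mg := noise_gain_measurable t beta i j.
apply: (@le_integrable_fin _ mR R mu _ (fun s => noise_gain t beta i j s ^+ 2)
  (fun s => b ^+ 2 * mxl1 (G s beta) ^+ 2) (mcc 0 T)).
- by apply: measurable_funX; exact: measurable_funTS.
- by move=> s _; rewrite ger0_norm ?sqr_ge0// noise_gain_bound.
- by apply: eq_integrable (integrableZl (mcc 0 T) (b ^+ 2) G2) => // s _.
Qed.

Let noise_gain_sqr_oc t beta i j : t <= T -> mu.-integrable `]0, t]%classic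
  (fun s => (noise_gain t beta i j s ^+ 2)%:E).
Proof.
by move=> tT; apply: integrableS (noise_gain_sqr t beta i j) => //; exact: sub_oc.
Qed.

Lemma noise_gain_integrable t beta i j : t <= T -> mu.-integrable `]0, t]%classic
  (EFin \o noise_gain t beta i j).
Proof.
move=> tT; apply: sqr_integrable_integrable => //.
- by apply: muoo => //; exact: sub_oc.
- by apply: measurable_funTS; exact: noise_gain_measurable.
- exact: noise_gain_sqr_oc.
Qed.

(** A closed formula in place of an expectation: it makes sense and is measurable for every [beta],
    and it agrees with the mean state of any solution for almost every [beta]. *)
Definition ensemble_mean (t beta : R) : 'cV[R]_n :=
  \col_i (deterministic_part t beta i ord0 +
    \sum_j rate j * \int[mu]_(s in `]0, t]) noise_gain t beta i j s).

Lemma ensemble_solution_mean t beta i : 0 <= t <= T ->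
  (\int[P]_xi (ensemble_solution t beta xi i ord0)%:E =
   (ensemble_mean t beta i ord0)%:E)%E.
Proof.
move=> /andP[t0 tT]; have hNt := independent_poisson_countersW tT hN.
have H j := counter_integral_mean hNt t0 j (noise_gain_measurable t beta i j)
  (noise_gain_integrable beta i j tT).
transitivity (\int[P]_xi ((cst (deterministic_part t beta i ord0)%:E) xi +
    \sum_j (counter_integral N t j (noise_gain t beta i j) xi)%:E))%E.
  by apply: eq_integral => xi _; rewrite ensemble_solutionE EFinD sumEFin.
rewrite integralD//; last 2 first.
- exact: finite_measure_integrable_cst.
- by apply: integrable_sum => // j _; exact: (H j).1.
rewrite integral_cst//= probability_setT mule1 integral_sum//; last first.
  by move=> j; exact: (H j).1.
rewrite (eq_bigr (fun j => (rate j * \int[mu]_(s in `]0, t]) noise_gain t beta i j s)%:E)).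
  by rewrite [ensemble_mean _ _ _ _]mxE EFinD -sumEFin.
by move=> j _; exact: (H j).2.
Qed.

Lemma ensemble_solution_square beta i c :
  (\int[P]_xi ((ensemble_solution T beta xi i ord0 - c) ^+ 2)%:E =
   ((ensemble_mean T beta i ord0 - c) ^+ 2 +
    \sum_j rate j * \int[mu]_(s in `]0, T]) (noise_gain T beta i j s ^+ 2))%:E)%E.
Proof.
have := expected_square hN T0 (deterministic_part T beta i ord0 - c)
  (fun j => noise_gain_measurable T beta i j)
  (fun j => noise_gain_sqr_oc beta i j (lexx T)).
rewrite [ensemble_mean _ _ _ _]mxE [in RHS]addrAC => <-.
apply: eq_integral => xi _.
by rewrite ensemble_solutionE addrAC.
Qed.

End ensemble_solution.

(** * Bounds on the mean and on the noise *)

(** Cauchy-Schwarz against the constant 1: the right side is the double sum of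
    [(x i ^ 2 + x j ^ 2) / 2], which dominates [x i * x j] term by term. *)
Lemma sqr_sum_le (R : realFieldType) (I : finType) (x : I -> R) :
  (\sum_i x i) ^+ 2 <= #|I|%:R * \sum_i x i ^+ 2.
Proof.
have -> : #|I|%:R * \sum_i x i ^+ 2 = \sum_i \sum_j (x i ^+ 2 + x j ^+ 2) / 2.
  under [RHS]eq_bigr do rewrite -mulr_suml big_split/= sumr_const.
    rewrite -mulr_suml big_split/= sumr_const sumrMnl mulr_natl.
  by field.
rewrite expr2 mulr_suml; apply: ler_sum => i _; rewrite mulr_sumr.
apply: ler_sum => j _; by rewrite ler_pdivlMr// -subr_ge0 (_ : _ - _ = (x i - x j) ^+ 2) ?sqr_ge0//; ring.
Qed.

Lemma mxl1_sqr_le (R : realType) (p q : nat) (M : 'M[R]_(p, q)) :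
  mxl1 M ^+ 2 <= (p * q)%:R * \sum_i \sum_j M i j ^+ 2.
Proof.
rewrite /mxl1 !pair_bigA/= (le_trans (sqr_sum_le _))//.
rewrite card_prod !card_ord ler_wpM2l// ler_sum// => ij _.
by rewrite real_normK ?num_real.
Qed.

Section interval_bounds.
Context {R : realType}.
Local Notation mu := (@lebesgue_measure R).
Local Notation mR := (measurableTypeR R).

(** Cauchy-Schwarz on an interval of length [T]: with [I] the integral of [f] and [J] that of
    [f ^ 2], the integral of [(T f - I) ^ 2] is nonnegative and equals [T (T J - I ^ 2)]. *)
Lemma sqr_Rintegral_le (T : R) (f : R -> R) : 0 < T ->
  measurable_fun setT (f : mR -> R) ->
  mu.-integrable `[0, T]%classic (fun s => (f s ^+ 2)%:E) ->
  (\int[mu]_(s in `[0, T]) f s) ^+ 2 <= T * \int[mu]_(s in `[0, T]) (f s ^+ 2).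
Proof.
move=> T0 mf f2.
have mI : measurable (`[0, T]%classic : set mR) by exact: measurable_itv.
have muI : mu `[0, T]%classic = T%:E.
  by rewrite /= lebesgue_measure_itv/= lte_fin T0 sube0.
have muoo : (mu `[0%R, T]%classic < +oo)%E by rewrite muI ltry.
have fi : mu.-integrable `[0, T]%classic (EFin \o f).
  by apply: sqr_integrable_integrable => //; exact: measurable_funTS.
set I := \int[mu]_(s in _) f s; set J := \int[mu]_(s in _) (f s ^+ 2).
have i1 : mu.-integrable `[0, T]%classic (EFin \o (fun s => T ^+ 2 * f s ^+ 2)).
  by apply: eq_integrable (integrableZl mI (T ^+ 2) f2) => // s _.
have i2 : mu.-integrable `[0, T]%classic (EFin \o (fun s => 2 * T * I * f s)).
  by apply: eq_integrable (integrableZl mI (2 * T * I) fi) => // s _.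
have i3 : mu.-integrable `[0, T]%classic (EFin \o (fun=> I ^+ 2)).
  apply/integrableP; split; first exact: measurable_cst.
  under eq_integral do rewrite /= ger0_norm ?sqr_ge0//.
  by rewrite integral_cst// [X in (_ * X)%E]muI -EFinM ltry.
have i12 : mu.-integrable `[0, T]%classic
    (EFin \o (fun s => T ^+ 2 * f s ^+ 2 - 2 * T * I * f s)).
  by apply: eq_integrable (integrableB mI i1 i2) => // s _.
have : 0 <= \int[mu]_(s in `[0, T]) (T ^+ 2 * f s ^+ 2 - 2 * T * I * f s + I ^+ 2).
  apply: Rintegral_ge0 => s _; rewrite (_ : _ + _ = (T * f s - I) ^+ 2) ?sqr_ge0//; ring.
rewrite (RintegralD mI i12 i3) (RintegralB mI i1 i2).
rewrite (RintegralZl _ mI f2) (RintegralZl _ mI fi) (Rintegral_cst _ mI) -/I -/J.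
rewrite [X in fine X](_ : _ = T%:E)//=.
rewrite (_ : _ - _ + _ = T * (T * J - I ^+ 2)); last by ring.
by rewrite pmulr_rge0// subr_ge0.
Qed.

End interval_bounds.

Section mean_dynamics.
Context {R : realType}.
Variables (n m k : nat) (T a b : R) (K0 : set R).
Variables (A : R -> R -> 'M[R]_n) (B : R -> R -> 'M[R]_(n, m))
  (G : R -> R -> 'M[R]_(n, k)) (Phi : R -> R -> R -> 'M[R]_n).
Variable lambda : 'cV[R]_k.
Hypothesis T0 : 0 < T.
Hypothesis rd : regular_data T a b K0 A B G Phi.
Local Notation mu := (@lebesgue_measure R).
Local Notation mR := (measurableTypeR R).
Local Notation rate j := (lambda j ord0).

Let mcc (x y : R) : measurable (`[x, y]%classic : set mR).
Proof. exact: measurable_itv. Qed.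

Let moc (x y : R) : measurable (`]x, y]%classic : set mR).
Proof. exact: measurable_itv. Qed.

Let mA1 := rd_A_section rd.
Let mG1 := rd_G_section rd.
Let mPhi1 := rd_Phi_section rd.
Let mPhi_st := rd_Phi_swap rd.

Let b0 := rd_b_ge0 rd.

Let sub_0 (t : R) : t <= T -> `[0, t]%classic `<=` (`[0, T]%classic : set R).
Proof. by move=> tT; exact: sub_cc. Qed.

Let T0T : (0 : R) <= 0 <= T. Proof. by rewrite lexx ltW. Qed.

Let muT : (mu `[0%R, T]%classic < +oo)%E.
Proof. by rewrite /= lebesgue_measure_itv/=; case: ifP; rewrite ?ltry. Qed.

Let G_integrable beta : mxintegrable mu `[0, T]%classic (fun s => G s beta).
Proof.
move=> i j; apply: sqr_integrable_integrable => //.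
- exact: measurable_funTS.
- exact: (rd_G2 rd beta i j).
Qed.

Definition noise_part (t beta : R) : 'cV[R]_n :=
  mxintegral mu `[0, t]%classic (fun s => Phi 0 s beta *m (G s beta *m lambda)).

Definition noise_energy (beta : R) : R :=
  \sum_i \sum_j rate j *
    \int[mu]_(s in `]0, T]) (noise_gain G Phi T beta i j s ^+ 2).

(** It involves [G] alone and is integrable in [beta]. Up to constants it dominates both the noise
    energy and the square of the noise part. *)
Definition coefficient_energy (beta : R) : R :=
  \sum_i \sum_j \int[mu]_(s in `[0, T]) (G s beta i j ^+ 2).

Lemma coefficient_energy_integrable :
  mu.-integrable setT (EFin \o coefficient_energy).
Proof.
have mg i j : measurable_fun setT
    (fun beta : mR => \int[mu]_(s in `[0, T]) (G s beta i j ^+ 2)).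
  apply: (@measurable_Rintegral_param _ _ _ _ (fun z : mR * mR =>
    G z.2 z.1 i j ^+ 2)) => //; apply: measurable_funX.
  exact: (rd_G_swap rd i j).
have ig : mu.-integrable setT (fun beta => \sum_i \sum_j
    (\int[mu]_(s in `[0, T]) (G s beta i j ^+ 2))%:E)%E.
  apply: integrable_sum => // i _; apply: integrable_sum => // j _.
  apply/integrableP; split; first exact/measurable_EFinP.
  apply: le_lt_trans (rd_G2K rd i j); rewrite le_eqVlt; apply/orP; left; apply/eqP.
  apply: eq_integral => beta _; rewrite gee0_abs; last first.
    by rewrite lee_fin; apply: Rintegral_ge0 => s _; exact: sqr_ge0.
  rewrite /Rintegral fineK//; apply: integrable_fin_num => //.
  exact: (rd_G2 rd).
apply: eq_integrable ig => // beta _.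
by rewrite /coefficient_energy/= -sumEFin; apply: eq_bigr => i _; rewrite -sumEFin.
Qed.

Lemma coefficient_energy_ge0 beta : 0 <= coefficient_energy beta.
Proof.
apply: sumr_ge0 => i _; apply: sumr_ge0 => j _.
by apply: Rintegral_ge0 => s _; exact: sqr_ge0.
Qed.

Let mxl1_G2 beta : mu.-integrable `[0, T]%classic (fun s => (mxl1 (G s beta) ^+ 2)%:E).
Proof.
exact: (sqr_mxl1_integrable (mcc 0 T) (fun i j => measurable_funTS (mG1 beta i j))
  (rd_G2 rd beta)).
Qed.

Lemma coefficient_energy_bound beta :
  \int[mu]_(s in `[0, T]) (mxl1 (G s beta) ^+ 2) <=
  (n * k)%:R * coefficient_energy beta.
Proof.
have iG := rd_G2 rd beta.
have iS i : mu.-integrable `[0, T]%classic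
    (EFin \o (fun s => \sum_j G s beta i j ^+ 2)).
  have : mu.-integrable `[0, T]%classic (fun s => \sum_j (G s beta i j ^+ 2)%:E)%E.
    by apply: integrable_sum => // j _; exact: iG.
  by apply: eq_integrable => // s _ /=; rewrite sumEFin.
have iSS : mu.-integrable `[0, T]%classic
    (EFin \o (fun s => \sum_i \sum_j G s beta i j ^+ 2)).
  have : mu.-integrable `[0, T]%classic (fun s => \sum_i (\sum_j G s beta i j ^+ 2)%:E)%E.
    by apply: integrable_sum => // i _; exact: iS.
  by apply: eq_integrable => // s _ /=; rewrite sumEFin.
have -> : coefficient_energy beta =
    \int[mu]_(s in `[0, T]) \sum_i \sum_j G s beta i j ^+ 2.
  rewrite (Rintegral_sum (mcc 0 T) _ iS); apply: eq_bigr => i _.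
  by rewrite (Rintegral_sum (mcc 0 T) _ (iG i)).
rewrite -(RintegralZl _ (mcc 0 T) iSS); apply: le_Rintegral => //.
- exact: mxl1_G2.
- by apply: eq_integrable (integrableZl (mcc 0 T) (n * k)%:R iSS) => // s _.
- by move=> s _; exact: mxl1_sqr_le.
Qed.

Lemma noise_energy_ge0 beta : (forall j, 0 <= rate j) -> 0 <= noise_energy beta.
Proof.
move=> l0; apply: sumr_ge0 => i _; apply: sumr_ge0 => j _.
by rewrite mulr_ge0//; apply: Rintegral_ge0 => s _; exact: sqr_ge0.
Qed.

Lemma noise_energy_measurable : measurable_fun setT (noise_energy : mR -> R).
Proof.
apply: measurable_sum => i; apply: measurable_sum => j; apply: measurable_funM => //.
apply: (@measurable_Rintegral_param _ _ _ _ (fun z : mR * mR =>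
  noise_gain G Phi T z.1 i j z.2 ^+ 2)) => //; apply: measurable_funX.
exact: (noise_gain_measurable2 rd).
Qed.

Lemma noise_energy_bound beta : (forall j, 0 <= rate j) -> noise_energy beta <=
  (\sum_(i < n) \sum_j rate j) * b ^+ 2 * (n * k)%:R * coefficient_energy beta.
Proof.
move=> l0; rewrite -2!mulrA mulr_suml; apply: ler_sum => i _.
rewrite mulr_suml; apply: ler_sum => j _; rewrite ler_wpM2l//.
have sub : `]0, T]%classic `<=` (`[0, T]%classic : set R).
  by move=> x /=; rewrite !in_itv/= => /andP[/ltW -> ->].
have G2 := integrableS (mcc 0 T) (moc 0 T) sub (mxl1_G2 beta).
apply: (@le_trans _ _ (\int[mu]_(s in `]0, T]) (b ^+ 2 * mxl1 (G s beta) ^+ 2))).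
  apply: le_Rintegral => //.
  - apply: (integrableS (mcc 0 T) (moc 0 T) sub); exact: (noise_gain_sqr rd).
  - by apply: eq_integrable (integrableZl (moc 0 T) (b ^+ 2) G2) => // s _.
  - by move=> s _; exact: (noise_gain_bound rd).
rewrite (RintegralZl _ (moc 0 T) G2) ler_wpM2l ?sqr_ge0//.
apply: le_trans (coefficient_energy_bound beta).
by rewrite Rintegral_itv_obnd_cbnd.
Qed.

Lemma noise_integrable t beta : t <= T -> mxintegrable mu `[0, t]%classic
  (fun s => Phi 0 s beta *m (G s beta *m lambda)).
Proof.
move=> tT; apply: (mxintegrable_bounded_mul (mcc 0 t) (K := b)).
- by move=> i j; apply: measurable_funTS; exact: mPhi1.
- by move=> s _; exact: (rd_Phib rd).
- apply: (mxintegrable_sub (mcc 0 T) (mcc 0 t) (sub_0 tT)).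
  by apply: mxintegrableMr => //; exact: G_integrable.
Qed.

Lemma noise_part_measurable t i : measurable_fun setT
  (fun beta : mR => noise_part t beta i ord0).
Proof.
under eq_fun do rewrite mxE.
apply: (@measurable_Rintegral_param _ _ _ _ (fun z : mR * mR =>
  (Phi 0 z.2 z.1 *m (G z.2 z.1 *m lambda)) i ord0)) => //.
apply: (measurable_mulmx (F := fun z : mR * mR => Phi 0 z.2 z.1)
  (F' := fun z : mR * mR => G z.2 z.1 *m lambda)) => // i' j'.
apply: (measurable_mulmx (F := fun z : mR * mR => G z.2 z.1)
  (F' := fun z : mR * mR => lambda)) => // i2 j2.
exact: (rd_G_swap rd i2 j2).
Qed.

(** The bound does not depend on [t], which matters because the steering time is not under control.
    The factor [T] comes from Cauchy-Schwarz in time, and [n * k] from comparing the l1 norm with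
    the sum of squares. *)
Lemma noise_part_bound t beta : 0 <= t <= T -> mxl1 (noise_part t beta) ^+ 2 <=
  (b * mxl1 lambda) ^+ 2 * T * (n * k)%:R * coefficient_energy beta.
Proof.
move=> /andP[t0 tT].
have nI := noise_integrable beta tT.
have G1 := integrable_mxl1 (mcc 0 T) (G_integrable beta).
have G1t := integrableS (mcc 0 T) (mcc 0 t) (sub_0 tT) G1.
set c := b * mxl1 lambda; have c0 : 0 <= c by rewrite mulr_ge0 ?mxl1_ge0.
have h : mxl1 (noise_part t beta) <= c * \int[mu]_(s in `[0, T]) mxl1 (G s beta).
  apply: le_trans (mxl1_mxintegral (mcc 0 t) nI) _.
  apply: (@le_trans _ _ (\int[mu]_(s in `[0, t]) (c * mxl1 (G s beta)))).
    apply: le_Rintegral => //; first exact: integrable_mxl1.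
      by apply: eq_integrable (integrableZl (mcc 0 t) c G1t) => // s _.
    move=> s _; rewrite (le_trans (mxl1M _ _))// /c -mulrA.
    rewrite ler_pM ?mxl1_ge0 ?(rd_Phib rd)// mulrC.
    exact: mxl1M.
  rewrite (RintegralZl _ (mcc 0 t) G1t) ler_wpM2l// /Rintegral fine_le//.
  - exact: integrable_fin_num.
  - exact: integrable_fin_num.
  - apply: ge0_subset_integral => //.
    + exact: measurable_int G1.
    + by move=> s _; rewrite lee_fin mxl1_ge0.
    + exact: sub_0.
apply: (@le_trans _ _ ((c * \int[mu]_(s in `[0, T]) mxl1 (G s beta)) ^+ 2)).
  by rewrite ler_sqr ?nnegrE ?mxl1_ge0// mulr_ge0//; apply: Rintegral_ge0 => s _; exact: mxl1_ge0.
rewrite exprMn -2!mulrA ler_wpM2l ?sqr_ge0//.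
have mG : measurable_fun setT (fun s : mR => mxl1 (G s beta)) by exact: measurable_mxl1.
apply: le_trans (sqr_Rintegral_le T0 mG (mxl1_G2 beta)) _.
by rewrite ler_wpM2l ?(ltW T0)// coefficient_energy_bound.
Qed.

Section control.
Variables (X0 : R -> 'cV[R]_n) (u : R -> 'cV[R]_m).
Hypothesis mX0 : forall i j, measurable_fun setT (fun beta : mR => X0 beta i j).
Hypothesis mu_u : forall i j, measurable_fun setT (fun t : mR => u t i j).
Hypothesis u2 : forall i j,
  mu.-integrable `[0, T]%classic (fun t => (u t i j ^+ 2)%:E).

Definition control_part (t beta : R) : 'cV[R]_n :=
  mxintegral mu `[0, t]%classic (fun s => Phi 0 s beta *m (B s beta *m u s)).

Lemma control_integrable t beta : t <= T -> mxintegrable mu `[0, t]%classic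
  (fun s => Phi 0 s beta *m (B s beta *m u s)).
Proof.
move=> tT; apply: (mxintegrable_bounded_mul (mcc 0 t) (K := b)).
- by move=> i j; apply: measurable_funTS; exact: mPhi1.
- by move=> s _; exact: (rd_Phib rd).
- apply: (mxintegrable_sub (mcc 0 T) (mcc 0 t) (sub_0 tT)).
  exact: (drift_integrable rd).
Qed.

Lemma control_noise_part t beta : t <= T ->
  mxintegral mu `[0, t]%classic (fun s =>
    Phi 0 s beta *m (B s beta *m u s + G s beta *m lambda)) =
  control_part t beta + noise_part t beta.
Proof.
move=> tT; rewrite -mxintegralD//; first by apply: eq_mxintegral => s _; rewrite mulmxDr.
- exact: control_integrable.
- exact: noise_integrable.
Qed.

(** Factoring [Phi t s] through time 0 inside every integral isolates an expression where the
    control enters linearly and the noise as a separate summand. *)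
Lemma ensemble_mean_pullback t beta : K0 beta -> 0 <= t <= T ->
  ensemble_mean B G Phi lambda X0 u t beta =
  Phi t 0 beta *m (X0 beta + control_part t beta + noise_part t beta).
Proof.
move=> Kb tT; have /andP[t0 tT'] := tT.
have split_t s : `[0, t]%classic s -> Phi t 0 beta *m Phi 0 s beta = Phi t s beta.
  rewrite /= in_itv/= => /andP[s0 st].
  have sT : 0 <= s <= T by rewrite s0 (le_trans st).
  by rewrite (Phi_split (ltW T0) (rd_a rd) (mA1 beta) (fun t => rd_Aa rd t beta)
    (rd_ode rd Kb) sT tT).
have iG : mxintegrable mu `[0, t]%classic (fun s => Phi t s beta *m G s beta).
  apply: (mxintegrable_bounded_mul (mcc 0 t) (K := b)).
  - by move=> i j; apply: measurable_funTS; exact: mPhi1.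
  - by move=> s _; exact: (rd_Phib rd).
  - exact: (mxintegrable_sub (mcc 0 T) (mcc 0 t) (sub_0 tT')).
have iB : mxintegrable mu `[0, t]%classic (fun s => Phi t s beta *m drift B u beta s).
  apply: (mxintegrable_bounded_mul (mcc 0 t) (K := b)).
  - by move=> i j; apply: measurable_funTS; exact: mPhi1.
  - by move=> s _; exact: (rd_Phib rd).
  - apply: (mxintegrable_sub (mcc 0 T) (mcc 0 t) (sub_0 tT')).
    exact: (drift_integrable rd).
have -> : Phi t 0 beta *m (X0 beta + control_part t beta + noise_part t beta) =
    deterministic_part B Phi X0 u t beta +
    mxintegral mu `]0, t]%classic (fun s => Phi t s beta *m G s beta) *m lambda.
  rewrite !mulmxDr -!mxintegralMl//; last 2 first.
  - exact: (noise_integrable beta tT').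
  - exact: (control_integrable beta tT').
  rewrite (mxintegral_oc_cc iG) -mxintegralMr// /deterministic_part /duhamel.
  rewrite (mxintegral_oc_cc iB); congr (_ + _ + _); apply: eq_mxintegral => s st.
    by rewrite mulmxA split_t.
  by rewrite mulmxA split_t// mulmxA.
apply/matrixP => i j; rewrite [j]ord1 [LHS]mxE [RHS]mxE; congr (_ + _).
rewrite mxE; apply: eq_bigr => l _.
by rewrite mulrC mxE.
Qed.

End control.
End mean_dynamics.

Section square_integrable_columns.
Context {R : realType}.
Local Notation mu := (@lebesgue_measure R).
Local Notation mR := (measurableTypeR R).

Lemma Lfun2_intro d (X : measurableType d) (m : {measure set X -> \bar R})
    (f : X -> R) : measurable_fun setT f ->
  m.-integrable setT (fun x => (f x ^+ 2)%:E) -> f \in Lfun m 2%:E.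
Proof.
move=> mf f2; apply/andP; split; apply/mem_set; rewrite //= /finite_norm unlock.
apply: poweR_lty; have /integrableP[_] := f2; apply: le_lt_trans.
rewrite le_eqVlt; apply/orP; left; apply/eqP; apply: eq_integral => x _ /=.
by rewrite powR_mulrn// normrX.
Qed.

(** The extension by 0 provides a version that is Borel on the whole line; for a control given on
    [[0, tau]] it also continues it by 0 up to [T]. *)
Definition extend0 (q : nat) (D : set R) (F : R -> 'cV[R]_q) (x : R) : 'cV[R]_q :=
  if x \in D then F x else 0.

Lemma extend0E q (D : set R) (F : R -> 'cV[R]_q) x : D x -> extend0 D F x = F x.
Proof. by move=> Dx; rewrite /extend0 mem_set. Qed.

Let extend0_entry q (D : set R) (F : R -> 'cV[R]_q) i j :
  (fun x => extend0 D F x i j) = (fun x => F x i j) \_ D.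
Proof.
by apply/funext => x; rewrite /extend0 patchE; case: ifPn => //; rewrite mxE.
Qed.

Lemma extend0_measurable q (D : set R) (F : R -> 'cV[R]_q) i j :
  mxLp mu 2%:E D F -> measurable_fun setT (fun x : mR => extend0 D F x i j).
Proof. by move=> /(_ i j)/andP[/set_mem + _]; rewrite -extend0_entry. Qed.

Lemma extend0_sqr_integrable q (D : set R) (F : R -> 'cV[R]_q) i j :
  mxLp mu 2%:E D F -> mu.-integrable setT (fun x => (extend0 D F x i j ^+ 2)%:E).
Proof.
move=> /(_ i j)/Lfun2_integrable_sqr; rewrite -extend0_entry.
by apply: eq_integrable.
Qed.

Lemma mxL2_intro q (D : set mR) (F : R -> 'cV[R]_q) : measurable D ->
  (forall i j, measurable_fun setT (fun x : mR => F x i j)) ->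
  (forall i j, mu.-integrable D (fun x => (F x i j ^+ 2)%:E)) ->
  mxLp mu 2%:E D F.
Proof.
move=> mD mF F2 i j; apply: Lfun2_intro.
  by apply/(measurable_restrictT _ mD); exact: measurable_funTS.
apply: eq_integrable ((integrable_mkcond _ mD).1 (F2 i j)) => // x _.
by rewrite !patchE; case: ifPn => // _; rewrite expr0n.
Qed.

Lemma measurable_sqnorm2 q (D : set mR) (F : R -> 'cV[R]_q) :
  (forall i, measurable_fun D (fun x : mR => F x i ord0)) ->
  measurable_fun D (fun x : mR => sqnorm2 (F x)).
Proof.
move=> mF; under eq_fun do rewrite sqnorm2E.
by apply: measurable_sum => i; apply: measurable_funX.
Qed.

End square_integrable_columns.

Lemma sqnorm2_ge0 (R : realType) (q : nat) (v : 'cV[R]_q) : 0 <= sqnorm2 v.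
Proof. by rewrite sqnorm2E; apply: sumr_ge0 => i _; exact: sqr_ge0. Qed.

Lemma sqnorm2_eq0 (R : realType) (q : nat) (v : 'cV[R]_q) : sqnorm2 v = 0 -> v = 0.
Proof.
rewrite sqnorm2E => /psumr_eq0P v0; apply/matrixP => i j; rewrite [j]ord1 mxE.
by apply/eqP; rewrite -sqrf_eq0 v0// => l _; exact: sqr_ge0.
Qed.

Lemma sqnorm2_le_mxl1 (R : realType) (q : nat) (v : 'cV[R]_q) :
  sqnorm2 v <= mxl1 v ^+ 2.
Proof.
have -> : mxl1 v = \sum_i `|v i ord0| by apply: eq_bigr => i _; rewrite big_ord1.
rewrite sqnorm2E.
rewrite expr2 mulr_suml; apply: ler_sum => i _.
rewrite -real_normK ?num_real// expr2 ler_wpM2l//.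
by rewrite (bigD1 i)//= lerDl; exact: sumr_ge0.
Qed.

Lemma mxl1_sqr_le_sqnorm2 (R : realType) (q : nat) (v : 'cV[R]_q) :
  mxl1 v ^+ 2 <= q%:R * sqnorm2 v.
Proof.
rewrite (le_trans (mxl1_sqr_le _))// muln1 sqnorm2E.
by rewrite ler_wpM2l// ler_sum// => i _; rewrite big_ord1.
Qed.

(** * Steering *)

(* The target uses the measurable structure of R itself, the hypothesis the one of
   [measurableTypeR R]. *)
Lemma measurable_fun_realX d (Xi : measurableType d) (R : realType) (K : set R)
    (f : measurableTypeR R * Xi -> R) :
  measurable_fun setT f -> measurable_fun (K `*` [set: Xi]) f.
Proof. by move=> mf; apply: measurable_funTS; exact: mf. Qed.

Section steered_ensemble.
Context {R : realType} d (Xi : measurableType d) (P : probability Xi R).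
Variables (n m k : nat) (T a b : R) (K K0 : set R).
Variables (A A' : R -> R -> 'M[R]_n) (B B' : R -> R -> 'M[R]_(n, m))
  (G G' : R -> R -> 'M[R]_(n, k)) (Phi Phi' : R -> R -> R -> 'M[R]_n).
Variables (N : 'I_k -> Xi -> cumulative R R) (lambda : 'cV[R]_k).
Local Notation mu := (@lebesgue_measure R).
Local Notation mR := (measurableTypeR R).
Local Notation rate j := (lambda j ord0).
Hypothesis T0 : 0 < T.
Hypothesis K_compact : compact K.
Hypothesis hN : independent_poisson_counters P N T lambda.
Hypothesis rd : regular_data T a b K0 A' B' G' Phi'.
Hypothesis K0K : K0 `<=` K.
Hypothesis aeK0 : {ae mu, forall beta, K beta -> K0 beta}.
Hypothesis agree : forall beta, K0 beta ->
  data_agree T A B G Phi beta A' B' G' Phi'.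

Let mK : measurable (K : set mR).
Proof. exact: compact_measurable. Qed.

Let mcc (x y : R) : measurable (`[x, y]%classic : set mR).
Proof. exact: measurable_itv. Qed.

Let sub_0 (t : R) : t <= T -> `[0, t]%classic `<=` (`[0, T]%classic : set R).
Proof. by move=> tT; exact: sub_cc. Qed.

Let drift_agree beta tau (u : R -> 'cV[R]_m) (Y : R -> 'cV[R]_n) t : K0 beta ->
  0 <= tau <= T -> 0 <= t <= tau ->
  mxintegral mu `[0, t]%classic (fun s => A s beta *m Y s + B s beta *m u s) =
  mxintegral mu `[0, t]%classic
    (fun s => A' s beta *m Y s + drift B' (extend0 `[0, tau]%classic u) beta s).
Proof.
move=> Kb /andP[tau0 tauT] /andP[t0 ttau]; have [hB _ _ hA] := agree Kb.
apply: eq_mxintegral_ae; apply: (ae_mono hA) => s sA /=; rewrite in_itv/= => /andP[s0 st].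
have stau := le_trans st ttau.
have sT : 0 <= s <= T by rewrite s0 (le_trans stau).
by rewrite sA// /drift hB// extend0E//= in_itv/= s0.
Qed.

Let jump_agree beta t xi : K0 beta -> 0 <= t <= T ->
  jump_integral G N t beta xi =
  \sum_j mxintegral (lebesgue_stieltjes_measure (N j xi)) `]0, t]%classic
    (fun s => col j (G' s beta)).
Proof.
move=> Kb /andP[t0 tT]; have [_ hG _ _] := agree Kb.
apply/matrixP => i j; rewrite mxE summxE; apply: eq_bigr => l _; rewrite mxE.
apply: eq_Rintegral => s /set_mem/=; rewrite in_itv/= => /andP[s0 st].
by rewrite mxE hG// ltW//= (le_trans st).
Qed.

Let horizon tau : 0 <= tau <= T -> (0 : R) <= tau <= tau.
Proof. by move=> /andP[-> _]; rewrite lexx. Qed.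

Section control.
Variables (tau : R) (X0 : R -> 'cV[R]_n) (u : R -> 'cV[R]_m).
Hypotheses (tauT : 0 <= tau <= T) (hX0 : in_HK K X0) (hu : in_HT tau u).

Local Notation initial := (extend0 K X0).
Local Notation control := (extend0 `[0, tau]%classic u).
Local Notation Xhat := (ensemble_solution B' G' Phi' N initial control).
Local Notation mean := (ensemble_mean B' G' Phi' lambda initial control).

Let mX0 i j : measurable_fun setT (fun beta : mR => initial beta i j).
Proof. exact: extend0_measurable. Qed.

Let mcontrol i j : measurable_fun setT (fun t : mR => control t i j).
Proof. exact: extend0_measurable. Qed.

Let control2 i j : mu.-integrable `[0, T]%classic (fun t => (control t i j ^+ 2)%:E).
Proof.
exact: (integrableS (@measurableT _ mR) (mcc 0 T) (@subsetT _ _)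
  (extend0_sqr_integrable i j hu)).
Qed.

(** Pathwise uniqueness on [[0, tau]]: every solution coincides with the explicit one, so mean
    states and costs depend on the control only. *)
Lemma solution_eq_ensemble X : is_solution P K A B G N tau X0 u X ->
  {ae mu, forall beta, K beta -> {ae P, forall xi, forall t, 0 <= t <= tau ->
    X t beta xi = Xhat t beta xi}}.
Proof.
move=> [_ _ hX]; apply: (ae_mono (ae_and aeK0 hX)) => beta [KK0 hXb] Kb.
have Kb0 := KK0 Kb.
apply: (ae_mono (ae_and (hXb Kb)
  (ensemble_solution_unique (ltW T0) hN rd initial mcontrol control2 Kb0))).
move=> xi [[iX XE] uniq] t ttau; apply: (uniq tau (fun s => X s beta xi) tauT _ t ttau).
split=> // {t ttau}t ttau.
have tT : 0 <= t <= T.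
  by move: tauT ttau => /andP[_ ?] /andP[-> /le_trans->].
by rewrite XE// (drift_agree _ _ Kb0 tauT)// jump_agree// extend0E.
Qed.

Lemma ensemble_is_solution : tau = T -> is_solution P K A B G N tau X0 u Xhat.
Proof.
move=> tauE; split.
- move=> t i ttau; have tT : 0 <= t <= T by rewrite -tauE.
  apply: measurable_fun_realX.
  exact: (ensemble_solution_measurable hN rd mX0 mcontrol i tT).
- apply: aeW => beta Kb t i E ttau mE; have tT : 0 <= t <= T by rewrite -tauE.
  exact: (ensemble_solution_adapted rd initial control beta i tT mE).
- apply: (ae_mono aeK0) => beta KK0 Kb; have Kb0 := KK0 Kb.
  apply: (ae_mono (ensemble_solution_equation (ltW T0) hN rd initial mcontrol control2 Kb0)).
  move=> xi [iX XE]; split; first by rewrite {1}tauE.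
  move=> t ttau; have tT : 0 <= t <= T by rewrite -tauE.
  by rewrite (drift_agree _ _ Kb0 tauT)// jump_agree// -[X0 beta](extend0E X0 Kb) -XE.
Qed.

Lemma solution_mean X t : is_solution P K A B G N tau X0 u X -> 0 <= t <= tau ->
  {ae mu, forall beta, K beta -> mean_state P X t beta = mean t beta}.
Proof.
move=> /solution_eq_ensemble hX ttau; apply: (ae_mono hX) => beta hXb Kb.
have tT : 0 <= t <= T.
  by move: tauT ttau => /andP[_ ?] /andP[-> /le_trans->].
apply/matrixP => i j; rewrite [j]ord1 [LHS]mxE unlock.
transitivity (fine (\int[P]_xi (Xhat t beta xi i ord0)%:E)%E).
  congr fine; apply: eq_integral_ae; apply: (ae_mono (hXb Kb)) => xi XE _.
  by rewrite XE.
by rewrite (ensemble_solution_mean hN rd initial control beta i tT).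
Qed.

Lemma ensemble_mean_measurable t i :
  measurable_fun setT (fun beta : mR => mean t beta i ord0).
Proof.
under eq_fun do rewrite mxE.
apply: measurable_funD; first exact: (deterministic_part_measurable rd).
apply: measurable_sum => j; apply: measurable_funM => //.
apply: (@measurable_Rintegral_param _ _ _ _ (fun z : mR * mR =>
  noise_gain G' Phi' t z.1 i j z.2)) => //.
exact: (noise_gain_measurable2 rd).
Qed.

Lemma mean_error_measurable t (XF : R -> 'cV[R]_n) : in_HK K XF ->
  measurable_fun (K : set mR) (fun beta : mR => sqnorm2 (mean t beta - XF beta)).
Proof.
move=> hXF; apply: measurable_sqnorm2 => i.
apply: (eq_measurable_fun (fun beta : mR =>
  mean t beta i ord0 - extend0 K XF beta i ord0)).
  by move=> beta /set_mem Kb; rewrite [RHS]mxE [X in _ = _ + X]mxE extend0E.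
apply: measurable_funTS; apply: measurable_funB; first exact: ensemble_mean_measurable.
exact: extend0_measurable.
Qed.

Lemma J2_decomposition X (XF : R -> 'cV[R]_n) : tau = T -> in_HK K XF ->
  is_solution P K A B G N tau X0 u X ->
  (J2 P K tau XF X =
   \int[mu]_(beta in K) (sqnorm2 (mean tau beta - XF beta)%R)%:E +
   \int[mu]_(beta in K) (noise_energy T G' Phi' lambda beta)%:E)%E.
Proof.
move=> tauE hXF hX.
rewrite (J2_tonelli K_compact _ hXF hX); last by case/andP: tauT.
rewrite -ge0_integralD//; last 4 first.
- by move=> beta _; rewrite lee_fin sqnorm2_ge0.
- by apply/measurable_EFinP; exact: mean_error_measurable.
- move=> beta _; rewrite lee_fin noise_energy_ge0// => j.
  exact: (rate_ge0 hN).
- apply/measurable_EFinP; apply: measurable_funTS; exact: (noise_energy_measurable lambda rd).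
apply: eq_integral_ae; apply: (ae_mono (solution_eq_ensemble hX)) => beta hXb Kb.
transitivity (\int[P]_xi \sum_i ((Xhat T beta xi i ord0 - XF beta i ord0) ^+ 2)%:E)%E.
  apply: eq_integral_ae; apply: (ae_mono (hXb Kb)) => xi XE _.
  rewrite (XE tau) ?(horizon tauT)// sqnorm2E -sumEFin tauE.
  by apply: eq_bigr => i _; rewrite !mxE.
rewrite ge0_integral_sum//; last 2 first.
- move=> i; apply/measurable_EFinP; apply: measurable_funX; apply: measurable_funB => //.
  have tT : 0 <= T <= T by rewrite lexx ltW.
  exact: (measurableT_comp
    (ensemble_solution_measurable hN rd mX0 mcontrol i tT) (measurable_pair1 beta)).
- by move=> i xi _; rewrite lee_fin sqr_ge0.
under eq_bigr do
  rewrite (ensemble_solution_square (ltW T0) hN rd initial control).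
rewrite sumEFin -EFinD sqnorm2E big_split/=; congr ((_ + _)%:E).
apply: eq_bigr => i _.
have mxB (v w : 'cV[R]_n) : (v - w) i ord0 = v i ord0 - w i ord0 by rewrite !mxE.
by rewrite tauE mxB.
Qed.

End control.

(** The diagonal entry [i] of the integrand is the sum over [j] of [rate j] times the square of the
    entry [(i, j)] of [Phi *m G]. Passing from [[0, T]] to []0, T]] drops a single point. *)
Lemma state_covariance_trace beta : K0 beta ->
  \tr (state_covariance G Phi lambda T beta) = noise_energy T G' Phi' lambda beta.
Proof.
move=> Kb; have [_ hG hPhi _] := agree Kb.
apply: eq_bigr => i _; rewrite mxE.
have sqr j := noise_gain_sqr rd T beta i j.
have isqr j : mu.-integrable `[0, T]%classic
    (EFin \o (fun s => rate j * noise_gain G' Phi' T beta i j s ^+ 2)).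
  by apply: eq_integrable (integrableZl (mcc 0 T) (rate j) (sqr j)) => // s _.
transitivity (\int[mu]_(s in `[0, T]) \sum_j rate j * noise_gain G' Phi' T beta i j s ^+ 2).
  apply: eq_Rintegral => s /set_mem/=; rewrite in_itv/= => sT.
  have TT : 0 <= T <= T by rewrite lexx ltW.
  rewrite -hPhi// -hG// -!mulmxA -trmx_mul !mulmxA mxE; apply: eq_bigr => j _.
  rewrite mul_mx_diag !mxE /noise_gain mxE; ring.
rewrite (Rintegral_sum (mcc 0 T) _ isqr); apply: eq_bigr => j _.
rewrite (RintegralZl _ (mcc 0 T) (sqr j)); congr (_ * _).
rewrite Rintegral_itv_obnd_cbnd//.
have moc : measurable (`]0, T]%classic : set mR) by exact: measurable_itv.
apply: (integrableS (mcc 0 T) moc _ (sqr j)) => s /=.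
by rewrite !in_itv/= => /andP[/ltW -> ->].
Qed.

Lemma integral_state_covariance :
  (\int[mu]_(beta in K) (\tr (state_covariance G Phi lambda T beta))%:E =
   \int[mu]_(beta in K) (noise_energy T G' Phi' lambda beta)%:E)%E.
Proof.
apply: eq_integral_ae; apply: (ae_mono aeK0) => beta KK0 Kb.
by rewrite state_covariance_trace//; exact: KK0.
Qed.

(** Finiteness allows this constant to be cancelled when the costs of two controls are compared. *)
Lemma noise_energy_fin_num :
  (\int[mu]_(beta in K) (noise_energy T G' Phi' lambda beta)%:E)%E \is a fin_num.
Proof.
have l0 j := rate_ge0 hN j.
apply: integrable_fin_num => //.
pose c := (\sum_(i < n) \sum_j rate j) * b ^+ 2 * (n * k)%:R.
apply: (@le_integrable_fin _ mR R mu K _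
  (fun beta => c * coefficient_energy T G' beta)) => //.
- apply: measurable_funTS; exact: (noise_energy_measurable lambda rd).
- move=> beta _; rewrite ger0_norm ?noise_energy_ge0//.
  exact: (noise_energy_bound rd beta l0).
- have iE := integrableS (@measurableT _ mR) mK (@subsetT _ _) (coefficient_energy_integrable rd).
  by apply: eq_integrable (integrableZl mK c iE) => // beta _.
Qed.

(** * Approximate steering by rescaled controls *)

Section density.
Hypothesis hctrl : ensemble_controllable P K A B G N T.
Variables (X0 XF : R -> 'cV[R]_n).
Hypotheses (hX0 : in_HK K X0) (hXF : in_HK K XF).

Local Notation noise t := (noise_part G' Phi' lambda t).

Let TT : 0 <= T <= T. Proof. by rewrite lexx ltW. Qed.

Let b0 := rd_b_ge0 rd.

(** The vector [p] that the control part at time [T] must equal for exact steering, computed from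
    the regular versions. *)
Let defect (beta : R) : 'cV[R]_n :=
  Phi' 0 T beta *m extend0 K XF beta - extend0 K X0 beta - noise T beta.

Let mPhi' t s i j : measurable_fun setT (fun beta : mR => Phi' t s beta i j).
Proof. exact: (measurableT_comp (rd_Phi rd i j) (measurable_pair1 ((t, s) : mR * mR))). Qed.

Let defect_measurable i j : measurable_fun setT (fun beta : mR => defect beta i j).
Proof.
rewrite [j]ord1; have h : measurable_fun setT (fun beta : mR =>
    (Phi' 0 T beta *m extend0 K XF beta) i ord0 - extend0 K X0 beta i ord0
    - noise T beta i ord0).
  apply: measurable_funB; last exact: (noise_part_measurable lambda rd).
  apply: measurable_funB; last exact: extend0_measurable.
  apply: measurable_mulmx => [i' j'|i' j']; first exact: mPhi'.
  exact: extend0_measurable.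
by move: h; apply: eq_measurable_fun => beta _; rewrite [RHS]mxE [X in _ = X + _]mxE
  [X in _ = _ + X + _]mxE [X in _ = _ + X]mxE.
Qed.

Let energy_const := (b * mxl1 lambda) ^+ 2 * T * (n * k)%:R.

Let energy (beta : R) := energy_const * coefficient_energy T G' beta.

Let energy_integrable : mu.-integrable (K : set mR) (EFin \o energy).
Proof.
have iE := integrableS (@measurableT _ mR) mK (@subsetT _ _) (coefficient_energy_integrable rd).
by apply: eq_integrable (integrableZl mK energy_const iE) => // beta _.
Qed.

Let sqr_integrable_K (F : R -> 'cV[R]_n) : in_HK K F ->
  mu.-integrable (K : set mR) (EFin \o (fun beta => mxl1 (extend0 K F beta) ^+ 2)).
Proof.
move=> hF; apply: (sqr_mxl1_integrable mK) => i j.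
  by apply: measurable_funTS; exact: extend0_measurable.
exact: (integrableS (@measurableT _ mR) mK (@subsetT _ _) (extend0_sqr_integrable i j hF)).
Qed.

Let defect_in_HK (c : R) : in_HK K (fun beta => c *: defect beta).
Proof.
have mcd i j : measurable_fun setT (fun beta : mR => (c *: defect beta) i j).
  under eq_fun do rewrite mxE.
  by apply: measurable_funM => //; exact: defect_measurable.
apply: (mxL2_intro mK mcd) => i j.
(* The dominating function comes from [(x + y + z) ^ 2 <= 3 * (x ^ 2 + y ^ 2 + z ^ 2)] applied to
   the three terms of the defect; [energy] bounds the square of its noise term. *)
pose h beta := c ^+ 2 * (3 * (b ^+ 2 * mxl1 (extend0 K XF beta) ^+ 2
  + mxl1 (extend0 K X0 beta) ^+ 2 + energy beta)).
apply: (@le_integrable_fin _ mR R mu K _ h mK).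
- by apply: measurable_funTS; apply: measurable_funX; exact: mcd.
- move=> beta Kb; rewrite ger0_norm ?sqr_ge0// /h mxE exprMn.
  rewrite ler_wpM2l ?sqr_ge0//.
  apply: (@le_trans _ _ (mxl1 (defect beta) ^+ 2)).
    rewrite -real_normK ?num_real// ler_sqr ?nnegrE ?mxl1_ge0//.
    exact: entry_le_mxl1.
  have hN' := noise_part_bound lambda T0 rd beta TT.
  have h1 : mxl1 (Phi' 0 T beta *m extend0 K XF beta) <= b * mxl1 (extend0 K XF beta).
    by rewrite (le_trans (mxl1M _ _))// ler_wpM2r ?mxl1_ge0// (rd_Phib rd).
  have h2 : mxl1 (defect beta) <= b * mxl1 (extend0 K XF beta) +
      mxl1 (extend0 K X0 beta) + mxl1 (noise T beta).
    rewrite /defect (le_trans (mxl1D _ _))// mxl1N lerD2r (le_trans (mxl1D _ _))//.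
    by rewrite mxl1N lerD2r.
  apply: (@le_trans _ _ ((b * mxl1 (extend0 K XF beta) +
      mxl1 (extend0 K X0 beta) + mxl1 (noise T beta)) ^+ 2)).
    by rewrite ler_sqr ?nnegrE ?mxl1_ge0// !addr_ge0 ?mulr_ge0 ?mxl1_ge0.
  apply: (@le_trans _ _ (3 * (b ^+ 2 * mxl1 (extend0 K XF beta) ^+ 2
      + mxl1 (extend0 K X0 beta) ^+ 2 + mxl1 (noise T beta) ^+ 2))).
    rewrite -exprMn; set x := b * _; set y := mxl1 _; set z := mxl1 _.
    rewrite -subr_ge0 (_ : _ - _ = (x - y) ^+ 2 + (y - z) ^+ 2 + (x - z) ^+ 2); last by ring.
    by rewrite !addr_ge0 ?sqr_ge0.
  by rewrite ler_wpM2l// lerD2l.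
- have i1 : mu.-integrable (K : set mR)
      (EFin \o (fun beta => b ^+ 2 * mxl1 (extend0 K XF beta) ^+ 2)).
    by apply: eq_integrable (integrableZl mK (b ^+ 2) (sqr_integrable_K hXF)) => // beta _.
  have i3 := integrableD mK (integrableD mK i1 (sqr_integrable_K hX0)) energy_integrable.
  by apply: eq_integrable (integrableZl mK (c ^+ 2) (integrableZl mK 3 i3)) => // beta _.
Qed.

Let zero_in_HK : in_HK K (fun=> 0 : 'cV[R]_n).
Proof.
apply: (mxL2_intro mK) => i j; first exact: measurable_cst.
by apply: eq_integrable (integrable0 _ _) => // beta _; rewrite mxE expr0n.
Qed.

Local Notation mean_of v t := (ensemble_mean B' G' Phi' lambda (extend0 K X0)
  (extend0 `[0, T]%classic v) t).

(* Steering from [- c *: defect] to 0 within error 1 and rescaling the control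
   by 1 / c leaves an error of order 1 / c: the contribution of the noise, which
   does not scale, is bounded uniformly in the steering time. *)
Lemma rescaled_steering (c : R) : 0 < c -> exists v : R -> 'cV[R]_m,
  in_HT T v /\ exists2 e : R -> R,
    [/\ forall beta, 0 <= e beta, mu.-integrable (K : set mR) (EFin \o e) &
        \int[mu]_(beta in K) e beta <= 1] &
    forall beta, K0 beta -> sqnorm2 (mean_of v T beta - XF beta) <=
      c^-1 ^+ 2 * (2 * b ^+ 2 * (b ^+ 2 * n%:R * e beta + energy beta)).
Proof.
move=> c0.
have [tau [u [X [/andP[tau0 tauT] _ hu hX hnorm]]]] :=
  hctrl ltr01 (defect_in_HK (- c)) zero_in_HK.
have tau0T : 0 <= tau <= T by rewrite ltW.
pose u0 := extend0 `[0, tau]%classic u.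
pose x0 := extend0 K (fun beta => - c *: defect beta).
pose v t := c^-1 *: u0 t.
have mu0 i j : measurable_fun setT (fun t : mR => u0 t i j) by exact: extend0_measurable.
have u02 i j : mu.-integrable `[0, T]%classic (fun t => (u0 t i j ^+ 2)%:E).
  exact: (integrableS (@measurableT _ mR) (mcc 0 T) (@subsetT _ _)
    (extend0_sqr_integrable i j hu)).
have hv : in_HT T v.
  apply: (mxL2_intro (mcc 0 T)) => i j.
    under eq_fun do rewrite mxE.
    by apply: measurable_funM => //; exact: mu0.
  apply: eq_integrable (integrableZl (mcc 0 T) (c^-1 ^+ 2) (u02 i j)) => // t _.
  by rewrite mxE exprMn.
(* [u0] vanishes off [[0, tau]], so restricting [v] to [[0, T]] changes nothing. *)
have vE : extend0 `[0, T]%classic v = v.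
  apply/funext => t; rewrite /extend0; case: ifPn => // /negP tT.
  rewrite /v /u0 /extend0 ifF ?scaler0//; apply/negP => /set_mem ttau; apply: tT.
  exact/mem_set/(sub_0 tauT).
pose e beta := sqnorm2 (ensemble_mean B' G' Phi' lambda x0 u0 tau beta).
have me : measurable_fun (K : set mR) (e : mR -> R).
  apply: measurable_sqnorm2 => i; apply: measurable_funTS.
  by apply: ensemble_mean_measurable => //; exact: defect_in_HK.
(* Comparison with [sqrte 1 = 1] turns the bound on [normK] into the same bound on its square. *)
have e1 : (\int[mu]_(beta in K) (e beta)%:E < 1)%E.
  have -> : (\int[mu]_(beta in K) (e beta)%:E = \int[mu]_(beta in K)
      (sqnorm2 (mean_state P X tau beta - 0)%R)%:E)%E.
    have ttau : 0 <= tau <= tau by rewrite lexx ltW.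
    apply: eq_integral_ae.
    apply: (ae_mono (solution_mean tau0T hu hX ttau)) => beta h Kb.
    by rewrite h// subr0.
  move: hnorm; rewrite /normK => hnorm; rewrite ltNge; apply/negP => h.
  move: hnorm; rewrite ltNge => /negP; apply.
  have sq1 : sqrte 1 = 1%E :> \bar R by rewrite /sqrte sqrtr1.
  rewrite -[leLHS]sq1 lee_sqrt//; apply: integral_ge0 => beta _.
  by rewrite lee_fin sqnorm2_ge0.
have e0 beta : 0 <= e beta by exact: sqnorm2_ge0.
have ie : mu.-integrable (K : set mR) (EFin \o e).
  apply/integrableP; split; first exact/measurable_EFinP.
  under eq_integral do rewrite gee0_abs ?lee_fin//.
  exact: lt_trans e1 (ltry _).
exists v; split=> //; exists e.
  split=> //; rewrite -lee_fin /Rintegral fineK ?(ltW e1)//.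
  exact: integrable_fin_num.
move=> beta Kb0; have Kb := K0K Kb0.
have mA1 := rd_A_section rd beta.
have PhiV s : 0 <= s <= T -> Phi' 0 s beta *m Phi' s 0 beta = 1%:M.
  by move=> sT; exact: (Phi_invl (ltW T0) (rd_a rd) mA1 (fun t => rd_Aa rd t beta)
    (rd_ode rd Kb0)).
have PhiVr s : 0 <= s <= T -> Phi' s 0 beta *m Phi' 0 s beta = 1%:M.
  by move=> sT; exact: (Phi_invr (ltW T0) (rd_a rd) mA1 (fun t => rd_Aa rd t beta)
    (rd_ode rd Kb0)).
have eE : ensemble_mean B' G' Phi' lambda x0 u0 tau beta = Phi' tau 0 beta *m
    (- c *: defect beta + control_part B' Phi' u0 tau beta + noise tau beta).
  by rewrite (ensemble_mean_pullback lambda T0 rd x0 mu0 u02 Kb0 tau0T) /x0 extend0E.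
set w := ensemble_mean _ _ _ _ _ _ tau beta in eE.
(* The control is off after [tau], so its pulled-back contribution is the same at [tau] and at [T],
   up to the factor [c^-1]. *)
have controlE : control_part B' Phi' (extend0 `[0, T]%classic v) T beta =
    c^-1 *: control_part B' Phi' u0 tau beta.
  rewrite vE -mul_scalar_mx -(mxintegralMl (mcc 0 tau)); last first.
    exact: (control_integrable rd mu0 u02 beta tauT).
  apply/matrixP => i j; rewrite !mxE [LHS]Rintegral_mkcond [RHS]Rintegral_mkcond.
  apply: eq_Rintegral => s _; rewrite !patchE; case: ifPn => [/set_mem sT|sT].
    case: ifPn => [/set_mem stau|stau].
      by rewrite mul_scalar_mx /v -!scalemxAr.
    by rewrite /v /u0 /extend0 (negbTE stau) scaler0 !mulmx0 mxE.
  rewrite ifF//; apply/negP => /set_mem stau; move/negP: sT; apply.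
  exact/mem_set/(sub_0 tauT).
have mv i j : measurable_fun setT (fun t : mR => extend0 `[0, T]%classic v t i j).
  exact: extend0_measurable.
have v2 i j : mu.-integrable `[0, T]%classic
    (fun t => (extend0 `[0, T]%classic v t i j ^+ 2)%:E).
  exact: (integrableS (@measurableT _ mR) (mcc 0 T) (@subsetT _ _)
    (extend0_sqr_integrable i j hv)).
(* By [eE], the control part of [u0] at [tau] equals [Phi' 0 tau *m w + c *: defect - noise tau].
   After division by [c], the defect cancels what [X0], [XF] and [noise T] leave in the pulled-back
   error, and only terms with the factor [c^-1] remain. *)
have errE : mean_of v T beta - XF beta = c^-1 *: (Phi' T 0 beta *m
    (Phi' 0 tau beta *m w - noise tau beta)).
  rewrite (ensemble_mean_pullback lambda T0 rd _ mv v2 Kb0 TT) controlE eE.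
  rewrite [Phi' 0 tau beta *m _]mulmxA PhiV// mul1mx addrK.
  rewrite -[XF beta]mul1mx -(PhiVr T TT) -mulmxA -mulmxBr scalemxAr; congr (_ *m _).
  rewrite scalerDr scalerA mulrN mulVf ?gt_eqF// scaleN1r /defect (extend0E XF Kb).
  have abel (x q g p : 'cV[R]_n) : x + q + g - p = - (p - x - g) + q.
    by apply/matrixP => i j; rewrite !mxE; ring.
  exact: abel.
have hN' := noise_part_bound lambda T0 rd beta tau0T.
have bP t s : mxl1 (Phi' t s beta) <= b by exact: (rd_Phib rd).
have h1 : mxl1 (Phi' 0 tau beta *m w) <= b * mxl1 w.
  by rewrite (le_trans (mxl1M _ _))// ler_wpM2r ?mxl1_ge0.
have h2 : mxl1 (Phi' T 0 beta *m (Phi' 0 tau beta *m w - noise tau beta)) <=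
    b * (b * mxl1 w + mxl1 (noise tau beta)).
  rewrite (le_trans (mxl1M _ _))// ler_pM ?mxl1_ge0//.
  by rewrite (le_trans (mxl1D _ _))// mxl1N lerD2r.
have sqnorm2Z (x : R) (z : 'cV[R]_n) : sqnorm2 (x *: z) = x ^+ 2 * sqnorm2 z.
  by rewrite !sqnorm2E mulr_sumr; apply: eq_bigr => i _; rewrite mxE exprMn.
rewrite errE sqnorm2Z ler_wpM2l ?sqr_ge0//.
apply: le_trans (sqnorm2_le_mxl1 _) _.
apply: (@le_trans _ _ ((b * (b * mxl1 w + mxl1 (noise tau beta))) ^+ 2)).
  by rewrite ler_sqr ?nnegrE ?mxl1_ge0// !(mulr_ge0, addr_ge0) ?mxl1_ge0.
rewrite exprMn [leRHS]mulrAC [leRHS]mulrC ler_wpM2l ?sqr_ge0//.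
(* The factor 2 comes from [(x + y) ^ 2 <= 2 * (x ^ 2 + y ^ 2)]; the factor [n] comes below from
   comparing the l1 norm of [w] with its Euclidean norm. *)
apply: (@le_trans _ _ (2 * ((b * mxl1 w) ^+ 2 + mxl1 (noise tau beta) ^+ 2))).
  set x := b * _; set y := mxl1 _.
  rewrite -subr_ge0 (_ : _ - _ = (x - y) ^+ 2) ?sqr_ge0//; ring.
rewrite ler_wpM2l// lerD// exprMn -mulrA ler_wpM2l ?sqr_ge0//.
exact: mxl1_sqr_le_sqnorm2.
Qed.

Lemma approximate_steering (delta : R) : 0 < delta -> exists2 v : R -> 'cV[R]_m,
  in_HT T v & (\int[mu]_(beta in K)
    (sqnorm2 (mean_of v T beta - XF beta)%R)%:E <= delta%:E)%E.
Proof.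
move=> d0; pose I := \int[mu]_(beta in K) energy beta.
have T0' := ltW T0.
have E0 beta : 0 <= energy beta.
  apply: mulr_ge0; last exact: coefficient_energy_ge0.
  by apply: mulr_ge0 => //; apply: mulr_ge0 => //; exact: sqr_ge0.
have I0 : 0 <= I by apply: Rintegral_ge0 => beta _; exact: E0.
(* The integral over [K] of the error bound without its factor [c^-1 ^+ 2], using that [e] has
   integral at most 1. *)
pose M := 2 * b ^+ 2 * (b ^+ 2 * n%:R + I).
have M0 : 0 <= M by rewrite !mulr_ge0 ?sqr_ge0// addr_ge0// mulr_ge0 ?sqr_ge0.
(* With this choice [c >= 1] and [M <= delta * c], hence [M <= delta * c ^ 2]. *)
pose c := 1 + M / delta.
have c1 : 1 <= c by rewrite lerDl divr_ge0// ltW.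
have c0 : 0 < c by exact: lt_le_trans c1.
have [v [hv [e [e0 ie e1] he]]] := rescaled_steering c0.
exists v => //.
pose h beta := c^-1 ^+ 2 * (2 * b ^+ 2 * (b ^+ 2 * n%:R * e beta + energy beta)).
have i1 : mu.-integrable (K : set mR) (EFin \o (fun beta => b ^+ 2 * n%:R * e beta)).
  by apply: eq_integrable (integrableZl mK (b ^+ 2 * n%:R) ie) => // beta _.
have i2 : mu.-integrable (K : set mR)
    (EFin \o (fun beta => b ^+ 2 * n%:R * e beta + energy beta)).
  by apply: eq_integrable (integrableD mK i1 energy_integrable) => // beta _.
have i3 : mu.-integrable (K : set mR)
    (EFin \o (fun beta => 2 * b ^+ 2 * (b ^+ 2 * n%:R * e beta + energy beta))).
  by apply: eq_integrable (integrableZl mK (2 * b ^+ 2) i2) => // beta _.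
have ih : mu.-integrable (K : set mR) (EFin \o h).
  by apply: eq_integrable (integrableZl mK (c^-1 ^+ 2) i3) => // beta _.
have merr := mean_error_measurable hX0 hv T hXF.
have h0 beta : 0 <= h beta.
  apply: mulr_ge0; first exact: sqr_ge0.
  apply: mulr_ge0; first by rewrite mulr_ge0// sqr_ge0.
  by apply: addr_ge0 => //; apply: mulr_ge0 => //; rewrite mulr_ge0// sqr_ge0.
apply: (@le_trans _ _ (\int[mu]_(beta in K) (h beta)%:E)%E).
  apply: ae_ge0_le_integral => //.
  - by move=> beta _; rewrite lee_fin sqnorm2_ge0.
  - exact/measurable_EFinP.
  - by move=> beta _; rewrite lee_fin.
  - exact: measurable_int ih.
  - by apply: (ae_mono aeK0) => beta KK0 Kb; rewrite lee_fin; exact: he (KK0 Kb).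
rewrite -[leLHS]fineK ?lee_fin; last exact: integrable_fin_num.
rewrite [leLHS](_ : _ = \int[mu]_(beta in K) h beta)//.
rewrite (RintegralZl _ mK i3) (RintegralZl _ mK i2) (RintegralD mK i1 energy_integrable).
rewrite (RintegralZl _ mK ie) -/I.
apply: (@le_trans _ _ (c^-1 ^+ 2 * M)).
  rewrite ler_wpM2l ?sqr_ge0// ler_wpM2l ?mulr_ge0 ?sqr_ge0// lerD2r.
  by rewrite -[leRHS]mulr1 ler_wpM2l// mulr_ge0 ?sqr_ge0.
rewrite exprVn mulrC ler_pdivrMr ?exprn_gt0//.
have Mc : M <= delta * c by rewrite /c mulrDr mulr1 mulrCA divff ?gt_eqF// mulr1 lerDr ltW.
by rewrite (le_trans Mc)// ler_wpM2l ?(ltW d0)// expr2 ler_peMl// ltW.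
Qed.

End density.

End steered_ensemble.

(** Controllability gives approximate steering only, so existence of a minimizer is not asserted:
    the minimal value appears both as the cost of any minimizer and as the infimum over all
    admissible controls. The integral equation holds for almost every [beta], as [Phi] and the
    elements of L2 are themselves determined only almost everywhere. *)
Theorem theorem8 (R : realType) (n m k : nat)
  (d : measure_display) (Xi : measurableType d) (P : probability Xi R)
  (T : R) (T_gt0 : 0 < T) (K : set R) (K_compact : compact K)
  (A : R -> R -> 'M[R]_n) (B : R -> R -> 'M[R]_(n, m))
  (G : R -> R -> 'M[R]_(n, k))
  (hA : in_LpD +oo%E T K A) (hB : in_LpD 2%:E T K B) (hG : in_LpD 2%:E T K G)
  (N : 'I_k -> Xi -> cumulative R R) (lambda : 'cV[R]_k)
  (hN : independent_poisson_counters P N T lambda)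
  (Phi : R -> R -> R -> 'M[R]_n) (hPhi : transition_matrix T K A Phi)
  (hctrl : ensemble_controllable P K A B G N T)
  (X0 XF : R -> 'cV[R]_n) (hX0 : in_HK K X0) (hXF : in_HK K XF) :
  let Jmin : \bar R :=
    (\int[lebesgue_measure]_(beta in K)
       (\tr (state_covariance G Phi lambda T beta))%:E)%E in
  (forall (u : R -> 'cV[R]_m) (X : R -> R -> Xi -> 'cV[R]_n),
     minimizes_J2 P K A B G N T X0 XF u X ->
     {ae lebesgue_measure, forall beta : R, K beta ->
        mxintegral lebesgue_measure `[0, T]%classic
          (fun sigma => Phi 0 sigma beta *m
             (B sigma beta *m u sigma + G sigma beta *m lambda))
        = Phi 0 T beta *m XF beta - X0 beta} /\
     J2 P K T XF X = Jmin) /\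
  ereal_inf [set J | exists (u : R -> 'cV[R]_m) (X : R -> R -> Xi -> 'cV[R]_n),
     [/\ in_HT T u, is_solution P K A B G N T X0 u X & J = J2 P K T XF X]]
  = Jmin.
Proof.
move=> Jmin.
have T0 := ltW T_gt0.
have TT : 0 <= T <= T by rewrite T0 lexx.
have mK : measurable (K : set (measurableTypeR R)) by exact: compact_measurable.
have [a [b [K0 [A' [B' [G' [Phi' [rd K0K aeK0 agree]]]]]]]] :=
  regularize mK hA hB hG hPhi.
have JE : Jmin = (\int[lebesgue_measure]_(beta in K)
    (noise_energy T G' Phi' lambda beta)%:E)%E.
  exact: (integral_state_covariance lambda T_gt0 rd aeK0 agree).
have Jfin : Jmin \is a fin_num.
  by rewrite JE; exact: (noise_energy_fin_num K_compact hN rd).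
pose mean v := ensemble_mean B' G' Phi' lambda (extend0 K X0)
  (extend0 `[0, T]%classic v) T.
pose err v := (\int[lebesgue_measure]_(beta in K)
  (sqnorm2 (mean v beta - XF beta)%R)%:E)%E.
have err0 v : (0 <= err v)%E.
  by apply: integral_ge0 => beta _; rewrite lee_fin sqnorm2_ge0.
have J2E v Y : in_HT T v -> is_solution P K A B G N T X0 v Y ->
    J2 P K T XF Y = (err v + Jmin)%E.
  move=> hv hY; rewrite JE.
  exact: (J2_decomposition T_gt0 K_compact hN rd aeK0 agree TT hX0 hv erefl hXF hY).
have approx (delta : R) : 0 < delta -> exists v Y, [/\ in_HT T v,
    is_solution P K A B G N T X0 v Y & (J2 P K T XF Y <= Jmin + delta%:E)%E].
  move=> d0; have [v hv vd] := approximate_steering T_gt0 K_compact hN rd K0K aeK0 agree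
    hctrl hX0 hXF d0.
  have hY := ensemble_is_solution T_gt0 hN rd aeK0 agree TT hX0 hv erefl.
  eexists v, _; split; [exact: hv|exact: hY|].
  by rewrite (J2E _ _ hv hY) addeC; exact: leeD2l.
split; last first.
  apply/eqP; rewrite eq_le; apply/andP; split.
    apply/lee_addgt0Pr => delta d0; have [v [Y [hv hY J2d]]] := approx _ d0.
    by apply: le_trans J2d; apply: ereal_inf_lbound; exists v, Y.
  apply: le_ereal_inf_tmp => _ [v [Y [hv hY ->]]].
  by rewrite (J2E _ _ hv hY); exact: leeDr.
move=> u X [hu hX umin].
(* The finite constant [Jmin] cancels from the comparison with approximate controls, which leaves
   the error of the minimizer below every positive [delta]. *)
have err_u : err u = 0%E.
  apply/eqP; rewrite eq_le err0 andbT; apply/lee_addgt0Pr => delta d0.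
  have [v [Y [hv hY J2d]]] := approx _ d0.
  have := le_trans (umin v Y hv hY) J2d.
  by rewrite (J2E _ _ hu hX) add0e addeC leeD2lE.
split; last by rewrite (J2E _ _ hu hX) err_u add0e.
have merr := mean_error_measurable lambda rd hX0 hu T hXF.
(* A nonnegative function with integral 0 vanishes almost everywhere, so the mean state hits the
   target for almost every [beta]. *)
have : ae_eq lebesgue_measure K
    (fun beta => (sqnorm2 (mean u beta - XF beta)%R)%:E) (cst 0%E).
  apply/(ae_eq_integral_abs _ mK); first exact/measurable_EFinP.
  rewrite -[RHS]err_u; apply: eq_integral => beta _.
  by rewrite gee0_abs// lee_fin sqnorm2_ge0.
move=> err_ae; apply: (ae_mono (ae_and aeK0 err_ae)) => beta [KK0 errb] Kb.
have Kb0 := KK0 Kb; have [hB' hG' hPhi' _] := agree _ Kb0.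
have m0 : mean u beta = XF beta.
  have [/sqnorm2_eq0/eqP] := errb Kb.
  by rewrite subr_eq0 => /eqP.
have mA1 := rd_A_section rd beta.
have mu_u i j : measurable_fun setT
    (fun t : measurableTypeR R => extend0 `[0, T]%classic u t i j).
  exact: extend0_measurable.
have u2 i j : lebesgue_measure.-integrable `[0, T]%classic
    (fun t => (extend0 `[0, T]%classic u t i j ^+ 2)%:E).
  have mI : measurable (`[0, T]%classic : set (measurableTypeR R)) by exact: measurable_itv.
  exact: (integrableS (@measurableT _ (measurableTypeR R)) mI (@subsetT _ _)
    (extend0_sqr_integrable i j hu)).
have := ensemble_mean_pullback lambda T_gt0 rd (extend0 K X0) mu_u u2 Kb0 TT.
(* Multiplying by [Phi' 0 T], the inverse of [Phi' T 0], transports the equality at time [T] back to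
   time 0. *)
rewrite -/(mean u beta) m0 => /(congr1 (mulmx (Phi' 0 T beta))).
rewrite mulmxA (Phi_invl T0 (rd_a rd) mA1 (fun t => rd_Aa rd t beta) (rd_ode rd Kb0) TT).
rewrite mul1mx -addrA -(control_noise_part lambda rd mu_u u2 beta (lexx T)).
rewrite hPhi' ?lexx ?T0// => ->; rewrite extend0E// addrAC subrr add0r.
apply: eq_mxintegral => s /=; rewrite in_itv/= => sT.
by rewrite hPhi' ?lexx ?T0// hB'// hG'// extend0E//= in_itv.
Qed.
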